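(* Assume the OMv Conjecture. Then there is no algorithm that, for a text $T$ of length $n$ and a dictionary $\mathcal{D}$ of patterns, preprocesses $T$ and $\mathcal{D}$ in time polynomial in $n$, performs insertions of patterns into $\mathcal{D}$ in time $\mathcal{O}(n^{\alpha})$, and answers $\textsc{Exists}(i,j)$ queries in time $\mathcal{O}(n^{\beta})$, in an online manner (interleaved updates and queries), where $\alpha+\beta=1-\epsilon$ for some $\epsilon>0$, and has error probability at most $1/3$. *)

(* Defs.v *)
From mathcomp Require Import all_boot all_order all_algebra.
From mathcomp Require Import all_classical all_reals all_analysis.
From Stdlib Require PeanoNat.

Set Implicit Arguments.
Unset Strict Implicit.
Unset Printing Implicit Defensive.

Import Order.TTheory GRing.Theory Num.Theory.
Import numFieldNormedType.Exports.

Local Open Scope classical_set_scope.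
Local Open Scope ring_scope.

(** A program uses finitely many registers and finitely many unbounded arrays:
    register and array names are constants of the program text.  [Get] and
    [Put] access the array cell addressed by a register, [Read] the cell of the
    read-only input addressed by a register.  Every command costs one time unit.
    The word length is not a parameter of the programs: execution takes a bound
    [W] and gets stuck as soon as a value outside [0, W) is produced.  Taking
    [W] to be a polynomial in the size parameter [n], i.e. words of O(log n)
    bits, is essential: with unbounded integers at unit cost whole vectors would
    fit in one register. *)

Inductive binop : Set :=
  | OAdd | OSub | OMul | ODiv | OMod | OAnd | OOr | OXor | OShl | OShr | OEq | OLt.

Definition eval_binop (o : binop) (x y : nat) : nat :=
  match o with
  | OAdd => x + y
  | OSub => x - y
  | OMul => x * y
  | ODiv => x %/ y
  | OMod => x %% y
  | OAnd => PeanoNat.Nat.land x y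
  | OOr => PeanoNat.Nat.lor x y
  | OXor => PeanoNat.Nat.lxor x y
  | OShl => x * 2 ^ y
  | OShr => x %/ 2 ^ y
  | OEq => x == y
  | OLt => x < y
  end%N.

Inductive cmd : Set :=
  | Skip
  | Const (x v : nat)
  | Op (o : binop) (x y z : nat)
  | Get (x a y : nat)
  | Put (a x y : nat)
  | Read (x y : nat)
  | Write (x : nat)
  | Flip (x : nat)
  | Seq (c1 c2 : cmd)
  | If (x : nat) (c1 c2 : cmd)
  | While (x : nat) (c : cmd).

Record state := State {
  regs : nat -> nat;
  arrs : nat -> nat -> nat;
  tape : seq bool;
  out : seq nat }.

Definition init (r : seq bool) : state :=
  State (fun=> 0%N) (fun _ _ => 0%N) r [::].

Definition upd (U : Type) (f : nat -> U) (x : nat) (v : U) : nat -> U :=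
  fun y => if y == x then v else f y.

Definition set_reg (W x v : nat) (s : state) : option state :=
  if (v < W)%N then Some (State (upd (regs s) x v) (arrs s) (tape s) (out s))
  else None.

(** One step, from the top command [c] of the control stack [c :: k]. *)
Definition step (W : nat) (inp : seq nat) (c : cmd) (k : seq cmd) (s : state)
    : option (seq cmd * state) :=
  let ret := omap (pair k) in
  let R := regs s in
  match c with
  | Skip => Some (k, s)
  | Const x v => ret (set_reg W x v s)
  | Op o x y z => ret (set_reg W x (eval_binop o (R y) (R z)) s)
  | Get x a y => ret (set_reg W x (arrs s a (R y)) s)
  | Put a x y =>
      Some (k, State R (upd (arrs s) a (upd (arrs s a) (R x) (R y)))
                     (tape s) (out s))
  | Read x y => ret (set_reg W x (nth 0%N inp (R y)) s)
  | Write x => Some (k, State R (arrs s) (tape s) (rcons (out s) (R x)))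
  | Flip x =>
      if tape s is b :: r then
        ret (set_reg W x b (State R (arrs s) r (out s)))
      else None
  | Seq c1 c2 => Some ([:: c1, c2 & k], s)
  | If x c1 c2 => Some ((if R x != 0%N then c1 else c2) :: k, s)
  | While x c1 => Some (if R x != 0%N then [:: c1, c & k] else k, s)
  end.

(** Runs until the control stack is empty, in at most [g] steps; returns the
    final state and the number of unused steps. *)
Fixpoint run (W : nat) (inp : seq nat) (g : nat) (k : seq cmd) (s : state)
    : option (state * nat) :=
  if k is c :: k' then
    if g is g'.+1 then
      if step W inp c k' s is Some (k'', s') then run W inp g' k'' s' else None
    else None
  else Some (s, g).

(** An online computation: procedure calls served one after the other, the
    registers and arrays persisting between calls.  A call sees only its own
    input.  At most [g] steps are allowed in total; the result lists, for each
    call, its output and the number of steps it took. *)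
Fixpoint session (W g : nat) (s : state) (calls : seq (cmd * seq nat))
    : option (seq (seq nat * nat)) :=
  if calls is (c, inp) :: calls' then
    if run W inp g [:: c] (State (regs s) (arrs s) (tape s) [::])
      is Some (s', g') then
      omap (cons (out s', g - g')%N) (session W g' s' calls')
    else None
  else Some [::].

(** Probability over [L] independent fair bits.  A session of at most [L] steps
    flips at most [L] coins, hence never exhausts a tape of length [L]. *)
Definition Pr (L : nat) (E : pred (L.-tuple bool)) : rat :=
  #|E|%:R / (2 ^ L)%:R.

Definition time_bigO (R : realType) (t : nat -> nat) (a : R) : Prop :=
  (fun n => (t n)%:R : R^o) =O_\oo (fun n => n%:R `^ a : R^o).

(** Boolean (or-and) product; [*m] would be the product over the field F_2. *)
Definition bool_mulmx (n : nat) (M : 'M[bool]_n) (v : 'cV[bool]_n)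
    : 'cV[bool]_n :=
  \col_i [exists j, M i j && v j 0].

Definition mx_code (n : nat) (M : 'M[bool]_n) : seq nat :=
  [seq nat_of_bool (M i j) | i <- enum 'I_n, j <- enum 'I_n].

Definition cv_code (n : nat) (v : 'cV[bool]_n) : seq nat :=
  [seq nat_of_bool (v i 0) | i <- enum 'I_n].

Record omv_algorithm := OMvAlgorithm {
  omv_prep : cmd;
  omv_round : cmd }.

Definition omv_calls (A : omv_algorithm) (n : nat) (M : 'M[bool]_n)
    (vs : n.-tuple 'cV[bool]_n) : seq (cmd * seq nat) :=
  (omv_prep A, n :: mx_code M) :: [seq (omv_round A, cv_code v) | v <- vs].

Definition omv_correct (n : nat) (M : 'M[bool]_n) (vs : n.-tuple 'cV[bool]_n)
    (res : option (seq (seq nat * nat))) : bool :=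
  if res is Some tr then
    behead (unzip1 tr) == [seq cv_code (bool_mulmx M v) | v <- vs]
  else false.

(** [A] solves OMv with words in [0, C * n ^ c), in total time at most [t n]
    for every outcome of the coin flips, and with error probability at most
    1/3. *)
Definition solves_omv (A : omv_algorithm) (C c : nat) (t : nat -> nat) : Prop :=
  forall (n : nat) (M : 'M[bool]_n) (vs : n.-tuple 'cV[bool]_n),
    (0 < n)%N ->
    let res (r : (t n).-tuple bool) :=
      session (C * n ^ c) (t n) (init r) (omv_calls A M vs) in
    (forall r, res r <> None) /\
    Pr (fun r => ~~ omv_correct M vs (res r)) <= 1 / 3.

Definition OMv_conjecture (R : realType) : Prop :=
  forall eps : R, 0 < eps ->
    ~ exists (A : omv_algorithm) (C c : nat) (t : nat -> nat),
        solves_omv A C c t /\ time_bigO t (3 - eps).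

(** [T[i..j]], positions being numbered from 1. *)
Definition fragment (T : seq nat) (p : nat * nat) : seq nat :=
  take (p.2 - p.1).+1 (drop p.1.-1 T).

Definition is_fragment (n : nat) (p : nat * nat) : bool :=
  (0 < p.1 <= p.2)%N && (p.2 <= n)%N.

(** The answer to [Exists(i,j)], for [q = (i,j)].  Patterns are given by the
    endpoints of one of their occurrences in [T]. *)
Definition exists_answer (T : seq nat) (D : seq (nat * nat)) (q : nat * nat)
    : bool :=
  has (fun p => infix (fragment T p) (fragment T q)) D.

Inductive operation : Set :=
  | Insert (p : nat * nat)
  | Exists (q : nat * nat).

Definition op_valid (n : nat) (o : operation) : bool :=
  match o with Insert p => is_fragment n p | Exists q => is_fragment n q end.

Definition dict_after (D : seq (nat * nat)) (ops : seq operation)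
    : seq (nat * nat) :=
  D ++ pmap (fun o => if o is Insert p then Some p else None) ops.

Record idm_algorithm := IDMAlgorithm {
  idm_prep : cmd;
  idm_insert : cmd;
  idm_exists : cmd }.

Definition idm_calls (A : idm_algorithm) (T : seq nat) (D : seq (nat * nat))
    (ops : seq operation) : seq (cmd * seq nat) :=
  (idm_prep A,
    size T :: T ++ size D :: flatten [seq [:: p.1; p.2] | p <- D])
  :: [seq match o with
          | Insert p => (idm_insert A, [:: p.1; p.2])
          | Exists q => (idm_exists A, [:: q.1; q.2])
          end | o <- ops].

Definition idm_budgets (tp ti tq : nat -> nat) (n : nat) (ops : seq operation)
    : seq nat :=
  tp n :: [seq (if o is Insert _ then ti n else tq n) | o <- ops].

Definition last_output (tr : seq (seq nat * nat)) : seq nat :=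
  last [::] (unzip1 tr).

(** [A] maintains the dictionary with words in [0, C * n ^ c), spending at most
    [tp n], [ti n] and [tq n] steps on the preprocessing, on each insertion and
    on each query, for every outcome of the coin flips.  For every sequence of
    operations, fixed independently of the coin flips, each answer is wrong
    with probability at most 1/3; as all sequences [ops] are considered, it
    is enough to look at a query [q] issued after [ops].  Every text of length
    [n] has at most [n] distinct letters, and these are taken in [0, n). *)
Definition solves_idm (A : idm_algorithm) (C c : nat) (tp ti tq : nat -> nat)
    : Prop :=
  forall (T : seq nat) (D : seq (nat * nat)) (ops : seq operation)
      (q : nat * nat),
    let n := size T in
    (0 < n)%N -> all (fun a => a < n)%N T ->
    all (is_fragment n) D -> uniq [seq fragment T p | p <- D] ->
    all (op_valid n) ops -> is_fragment n q ->
    let ops' := rcons ops (Exists q) in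
    let budgets := idm_budgets tp ti tq n ops' in
    let res (r : (sumn budgets).-tuple bool) :=
      session (C * n ^ c) (sumn budgets) (init r) (idm_calls A T D ops') in
    (forall r, exists2 tr, res r = Some tr &
       all2 (fun steps b => steps <= b)%N (unzip2 tr) budgets) /\
    Pr (fun r => omap last_output (res r)
                 != Some [:: nat_of_bool (exists_answer T (dict_after D ops) q)])
      <= 1 / 3.

(* Main.v *)
Require Import Defs.
From mathcomp Require Import all_boot all_order all_algebra.
From mathcomp Require Import all_classical all_reals all_analysis.
From mathcomp Require Import zify ring lra.

(** Split the matrix into blocks of n1 = s^a rows and n2 = s^b columns, where s is
    about n^(1/d).  A block becomes a text that lists, row by row, a letter for
    each column holding a one, and then all the letters.  Inserting the one-letter
    patterns of the ones of a vector and asking [Exists] for each row computes the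
    product of the block by the vector.  With a + b = q, with a and b slightly above
    q alpha and q beta, and with q eps >= 5, this costs O(s^(q-2)) steps for a block
    of s^q entries; if d is large, the polynomial preprocessing of all the blocks
    takes only O(n^3 / s) steps.

    As patterns cannot be deleted, the data structure is rolled back after each
    vector: it is run on a simulated memory whose writes go to an overlay of the
    contents reached by the preprocessing, and every round starts with a fresh
    overlay.  Errors are reduced by a majority vote among 2 (s + K0) copies of each
    block with independent coins.  The coins are drawn and recorded in advance, so
    every query is a fixed event on them and a union bound applies.  The total time
    is O(n^3 / s) = O(n^(3 - 1/d)). *)

Set Implicit Arguments.
Unset Strict Implicit.
Unset Printing Implicit Defensive.

Import Order.TTheory GRing.Theory Num.Theory.

(** * Programs with expressions and bounded loops *)

(** The two factors saved in [s ^ (q - 2)] have different uses: one pays for the copies of each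
    block, the other is the gain over cubic time. About [s] copies are enough because
    [n < (s + 1) ^ d]: the number of events in the union bound is polynomial in [s], hence beaten by
    a factor that is geometric in the number of copies, and [K0] absorbs the constants. An instance
    meets the same coins again after each rollback, so its errors in different rounds are
    correlated. This is harmless: the vectors are fixed before the coins, and a union bound asks
    nothing about the joint law of the events. Independence is used only between the copies of one
    block, whose coins lie in disjoint segments. The machine gets stuck on values that exceed the
    word bound. All stored values are therefore kept below one polynomial quantity [Z], and all
    intermediate values below the fixed power [Z ^ D]. *)

Lemma step_cat W inp c k1 k2 s :
  step W inp c (k1 ++ k2) s =
  omap (fun p => (p.1 ++ k2, p.2)) (step W inp c k1 s).
Proof.
case: c => [|x v|o x y z|x a y|a x y|x y|x|x|c1 c2|x c1 c2|x c] //=;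
  try by rewrite /set_reg; case: ifP.
by case: (tape s) => [|b r] //; rewrite /set_reg; case: ifP.
Qed.

Lemma run_nil W inp g s : run W inp g [::] s = Some (s, g).
Proof. by case: g. Qed.

Lemma run_cat W inp g k1 k2 s :
  run W inp g (k1 ++ k2) s =
  obind (fun p => run W inp p.2 k2 p.1) (run W inp g k1 s).
Proof.
elim: g k1 s => [|g IH] [|c k1] s; try by [].
by rewrite /= step_cat; case: (step W inp c k1 s) => [[k s']|] /=.
Qed.

Lemma run_gas W inp g k s s' g' :
  run W inp g k s = Some (s', g') ->
  g' <= g /\ forall e, run W inp (g + e) k s = Some (s', g' + e).
Proof.
elim: g k s => [|g IH] [|c k] s //=; try by case=> -> <-; split=> // -[|e].
case: (step W inp c k s) => [[k' s1]|] // /IH [le_g' run_e].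
by split=> [|e]; [exact: leqW | exact: run_e].
Qed.

Definition add_tape (s : state) (e : seq bool) : state :=
  State (regs s) (arrs s) (tape s ++ e) (out s).

Lemma step_add_tape W inp c k s e k' s' :
  step W inp c k s = Some (k', s') ->
  step W inp c k (add_tape s e) = Some (k', add_tape s' e).
Proof.
case: c => [|x v|o x y z|x a y|a x y|x y|x|x|c1 c2|x c1 c2|x c] //=;
  rewrite /set_reg /add_tape; try by case=> <- <-.
all: try by case: ifP => // _ [<- <-].
by case: (tape s) => [|b r] //=; case: ifP => // _ [<- <-].
Qed.

Lemma run_add_tape W inp g k s e s' g' :
  run W inp g k s = Some (s', g') ->
  run W inp g k (add_tape s e) = Some (add_tape s' e, g').
Proof.
elim: g k s => [|g IH] [|c k] s //=; try by case=> <- <-.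
case Es: (step W inp c k s) => [[k' s1]|] //.
by rewrite (step_add_tape e Es); exact: IH.
Qed.

(** The step count is exact, for every continuation [k] and every remaining allowance [g], so that
    executions compose by rewriting; slack in the time bounds appears only in [hwp]. *)
Definition ev W inp c m s s' : Prop :=
  forall k g, run W inp (m + g) (c :: k) s = run W inp g k s'.

Lemma run_ev W inp g c s s' g' :
  run W inp g [:: c] s = Some (s', g') ->
  run W inp (g - g') [:: c] s = Some (s', 0).
Proof.
elim: g [:: c] s => [|g IH] [|c' k] s //=; try by case=> -> ->; rewrite ?subnn.
case E: (step W inp c' k s) => [[k' s1]|] // R.
have [le_g' _] := run_gas R.
by rewrite subSn //= E (IH _ _ R).
Qed.

Lemma ev_step W inp c s s' :
  (forall k, step W inp c k s = Some (k, s')) -> ev W inp c 1 s s'.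
Proof. by move=> H k g; rewrite add1n /= H. Qed.

Lemma ev_seq W inp c1 c2 m1 m2 s s1 s2 :
  ev W inp c1 m1 s s1 -> ev W inp c2 m2 s1 s2 ->
  ev W inp (Seq c1 c2) (m1 + m2).+1 s s2.
Proof. by move=> H1 H2 k g; rewrite addSn /= -addnA H1 H2. Qed.

Inductive expr : Set :=
  | Var of nat
  | Lit of nat
  | Bin of binop & expr & expr
  | Arr of nat & expr
  | Inp of expr.

(* Registers below [T0] are program variables, the others hold temporary values. *)
Definition T0 : nat := 30.

(** In the absence of a move instruction, a register is copied by [x lor x], which creates no larger
    value. The first operand survives in [d] because the second one only uses temporaries from
    [d.+1] on. *)
Fixpoint cexp (d : nat) (e : expr) : cmd :=
  match e with
  | Var x => Op OOr d x x
  | Lit v => Const d v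
  | Bin o e1 e2 => Seq (cexp d e1) (Seq (cexp d.+1 e2) (Op o d d d.+1))
  | Arr a e => Seq (cexp d e) (Get d a d)
  | Inp e => Seq (cexp d e) (Read d d)
  end.

Fixpoint esize (e : expr) : nat :=
  match e with
  | Var _ | Lit _ => 1
  | Bin o e1 e2 => esize e1 + esize e2 + 3
  | Arr _ e | Inp e => esize e + 2
  end.

Fixpoint evalx (inp : seq nat) (s : state) (e : expr) : nat :=
  match e with
  | Var x => regs s x
  | Lit v => v
  | Bin o e1 e2 => eval_binop o (evalx inp s e1) (evalx inp s e2)
  | Arr a e => arrs s a (evalx inp s e)
  | Inp e => nth 0 inp (evalx inp s e)
  end.

(** As the machine gets stuck on any value outside the word, the bound is required of every
    subexpression and not only of the result. *)
Fixpoint safe (W : nat) (inp : seq nat) (s : state) (e : expr) : bool :=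
  (evalx inp s e < W) &&
  match e with
  | Var x => x < T0
  | Lit v => true
  | Bin o e1 e2 => safe W inp s e1 && safe W inp s e2
  | Arr _ e | Inp e => safe W inp s e
  end.

Definition eqv (s h : state) : Prop :=
  [/\ forall x, x < T0 -> regs s x = regs h x, arrs s = arrs h,
      tape s = tape h & out s = out h].

Lemma eqv_refl s : eqv s s.
Proof. by []. Qed.

Lemma eqv_trans s1 s2 s3 : eqv s1 s2 -> eqv s2 s3 -> eqv s1 s3.
Proof.
move=> [r1 a1 t1 o1] [r2 a2 t2 o2].
by split; [move=> x lx; rewrite r1 ?r2 | rewrite a1 | rewrite t1 | rewrite o1].
Qed.

Lemma safe_lt W inp s e : safe W inp s e -> evalx inp s e < W.
Proof. by case: e => [x|v|o e1 e2|a e|e] /andP[]. Qed.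

Lemma val_eqv W inp s h e :
  eqv s h -> safe W inp h e -> evalx inp s e = evalx inp h e.
Proof.
move=> [er ea _ _]; elim: e => [x|v|o e1 IH1 e2 IH2|a e IH|e IH] //=.
- by move=> /andP[_ lx]; exact: er.
- by move=> /and3P[_ s1 s2]; rewrite IH1 ?IH2.
- by move=> /andP[_ s1]; rewrite ea IH.
- by move=> /andP[_ s1]; rewrite IH.
Qed.

Lemma safe_eqv W inp s h e : eqv s h -> safe W inp h e -> safe W inp s e.
Proof.
move=> E; elim: e => [x|v|o e1 IH1 e2 IH2|a e IH|e IH].
- by move=> H; have /= -> := val_eqv E H.
- by [].
- move=> H; have /= -> := val_eqv E H.
  by move: H => /= /and3P[-> /IH1-> /IH2->].
- move=> H; have /= -> := val_eqv E H.
  by move: H => /= /andP[-> /IH->].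
- move=> H; have /= -> := val_eqv E H.
  by move: H => /= /andP[-> /IH->].
Qed.

Lemma upd_same U (f : nat -> U) x v : upd f x v x = v.
Proof. by rewrite /upd eqxx. Qed.

Lemma upd_other U (f : nat -> U) x v y : y != x -> upd f x v y = f y.
Proof. by rewrite /upd => /negbTE->. Qed.

(* The temporaries above [d] are arbitrary. *)
Definition put_temp (d v : nat) (s s' : state) : Prop :=
  [/\ regs s' d = v, forall x, x < d -> regs s' x = regs s x, arrs s' = arrs s,
      tape s' = tape s & out s' = out s].

Lemma put_temp_eqv d v s s' : T0 <= d -> put_temp d v s s' -> eqv s' s.
Proof.
by move=> ld [_ er ea et eo]; split=> // x lx; apply: er; exact: leq_trans ld.
Qed.

Lemma cexp_ev W inp e d s :
  T0 <= d -> safe W inp s e ->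
  exists2 s', ev W inp (cexp d e) (esize e) s s' &
    put_temp d (evalx inp s e) s s'.
Proof.
elim: e d s => [x|v|o e1 IH1 e2 IH2|a e IH|e IH] d s ld.
- move=> /andP[lW lx].
  exists (State (upd (regs s) d (regs s x)) (arrs s) (tape s) (out s)).
    by apply: ev_step => k /=; rewrite PeanoNat.Nat.lor_diag /set_reg lW.
  by split=> //=; [rewrite upd_same | move=> y ly; rewrite upd_other // neq_ltn ly].
- move=> /andP[lW _].
  exists (State (upd (regs s) d v) (arrs s) (tape s) (out s)).
    by apply: ev_step => k /=; rewrite /set_reg lW.
  by split=> //=; [rewrite upd_same | move=> y ly; rewrite upd_other // neq_ltn ly].
- move=> H; have /= /and3P[lW S1 S2] := H.
  have [s1 E1 P1] := IH1 _ _ ld S1; have [r1 er1 ea1 et1 eo1] := P1.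
  have Q1 := put_temp_eqv ld P1.
  have [s2 E2 P2] := IH2 d.+1 s1 (leqW ld) (safe_eqv Q1 S2).
  have [r2 er2 ea2 et2 eo2] := P2.
  exists (State (upd (regs s2) d (evalx inp s (Bin o e1 e2))) (arrs s2) (tape s2) (out s2)).
    rewrite /= (_ : _ + 3 = (esize e1 + (esize e2 + 1).+1).+1); last by lia.
    refine (ev_seq E1 _); refine (ev_seq E2 _).
    apply: ev_step => k /=; rewrite er2 // r1 r2 (val_eqv Q1 S2).
    by rewrite /set_reg lW.
  split=> /=; rewrite ?upd_same ?ea2 ?et2 ?eo2 // => x lx.
  by rewrite upd_other ?neq_ltn ?lx // er2 ?er1 // ltnS ltnW.
- move=> H; have /= /andP[lW S1] := H.
  have [s1 E1 P1] := IH _ _ ld S1; have [r1 er1 ea1 et1 eo1] := P1.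
  exists (State (upd (regs s1) d (evalx inp s (Arr a e))) (arrs s1) (tape s1) (out s1)).
    rewrite /= (_ : _ + 2 = (esize e + 1).+1); last by lia.
    refine (ev_seq E1 _).
    by apply: ev_step => k; rewrite /= /set_reg r1 ea1 lW.
  split=> /=; rewrite ?upd_same // => x lx.
  by rewrite upd_other ?neq_ltn ?lx // er1.
- move=> H; have /= /andP[lW S1] := H.
  have [s1 E1 P1] := IH _ _ ld S1; have [r1 er1 ea1 et1 eo1] := P1.
  exists (State (upd (regs s1) d (evalx inp s (Inp e))) (arrs s1) (tape s1) (out s1)).
    rewrite /= (_ : _ + 2 = (esize e + 1).+1); last by lia.
    refine (ev_seq E1 _).
    by apply: ev_step => k /=; rewrite r1 /set_reg lW.
  split=> /=; rewrite ?upd_same // => x lx.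
  by rewrite upd_other ?neq_ltn ?lx // er1.
Qed.

(* Total correctness within [t] steps, the temporaries being ignored. *)
Definition hwp W inp c t (Q : state -> Prop) h : Prop :=
  forall s, eqv s h -> exists m s' h',
    [/\ m <= t, ev W inp c m s s', eqv s' h' & Q h'].

Definition set_var (h : state) x v :=
  State (upd (regs h) x v) (arrs h) (tape h) (out h).
Definition set_arr (h : state) a i v :=
  State (regs h) (upd (arrs h) a (upd (arrs h a) i v)) (tape h) (out h).

Definition Asg x e := Seq (cexp T0 e) (Op OOr x T0 T0).
Definition Sto a e1 e2 :=
  Seq (cexp T0 e1) (Seq (cexp T0.+1 e2) (Put a T0 T0.+1)).
Definition IfE e c1 c2 := Seq (cexp T0 e) (If T0 c1 c2).
(** [While] tests a register only, so the guard is recomputed into [T0] at the end of each turn. *)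
Definition loop e c := While T0 (Seq c (cexp T0 e)).
Definition WhileE e c := Seq (cexp T0 e) (loop e c).

Lemma set_var_eqv s h x v : eqv s h -> eqv (set_var s x v) (set_var h x v).
Proof.
move=> [er ea et eo]; split=> //= y ly.
by rewrite /upd; case: ifP => // _; exact: er.
Qed.

Section Logic.
Variables (W : nat) (inp : seq nat).
Notation hwp := (hwp W inp).

Lemma hwp_weak c t t' (Q Q' : state -> Prop) h :
  hwp c t Q h -> t <= t' -> (forall h', Q h' -> Q' h') -> hwp c t' Q' h.
Proof.
move=> H lt QQ s /H[m [s' [h' [lm E E' q]]]].
by exists m, s', h'; split=> //; [exact: leq_trans lt | exact: QQ].
Qed.

Lemma hwp_seq c1 c2 t1 t2 Q h :
  hwp c1 t1 (hwp c2 t2 Q) h -> hwp (Seq c1 c2) (t1 + t2).+1 Q h.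
Proof.
move=> H s /H[m1 [s1 [h1 [l1 E1 /[swap] H1 /H1]]]] => -[m2 [s2 [h2 [l2 E2 q1 q2]]]].
exists (m1 + m2).+1, s2, h2; split=> //; first by rewrite ltnS leq_add.
exact: ev_seq E1 E2.
Qed.

Lemma hwp_skip (Q : state -> Prop) h : Q h -> hwp Skip 1 Q h.
Proof. by move=> q s e; exists 1, s, h; split=> //; exact: ev_step. Qed.

Lemma hwp_asg x e (Q : state -> Prop) h :
  safe W inp h e -> Q (set_var h x (evalx inp h e)) ->
  hwp (Asg x e) (esize e + 2) Q h.
Proof.
move=> S q s E.
have [s1 E1 P1] := cexp_ev (leqnn T0) (safe_eqv E S).
have [r1 _ _ _ _] := P1.
have lW := safe_lt S.
exists (esize e + 2), (set_var s1 x (evalx inp h e)), (set_var h x (evalx inp h e)).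
split=> //.
- rewrite (_ : _ + 2 = (esize e + 1).+1); last by lia.
  refine (ev_seq E1 _); apply: ev_step => k /=.
  by rewrite PeanoNat.Nat.lor_diag r1 (val_eqv E S) /set_reg lW.
- apply: set_var_eqv; apply: eqv_trans E; exact: put_temp_eqv P1.
Qed.

Lemma hwp_sto a e1 e2 (Q : state -> Prop) h :
  safe W inp h e1 -> safe W inp h e2 ->
  Q (set_arr h a (evalx inp h e1) (evalx inp h e2)) ->
  hwp (Sto a e1 e2) (esize e1 + esize e2 + 3) Q h.
Proof.
move=> S1 S2 q s E.
have [s1 E1 P1] := cexp_ev (leqnn T0) (safe_eqv E S1).
have [r1 er1 ea1 et1 eo1] := P1; have Q1 := put_temp_eqv (leqnn T0) P1.
have E' := eqv_trans Q1 E.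
have [s2 E2 P2] := cexp_ev (leqnSn T0) (safe_eqv E' S2).
have [r2 er2 ea2 et2 eo2] := P2; have Q2 := put_temp_eqv (leqnSn T0) P2.
have E'' := eqv_trans Q2 E'.
exists (esize e1 + esize e2 + 3), (set_arr s2 a (evalx inp h e1) (evalx inp h e2)),
   (set_arr h a (evalx inp h e1) (evalx inp h e2)).
split=> //.
- rewrite (_ : _ + 3 = (esize e1 + (esize e2 + 1).+1).+1); last by lia.
  refine (ev_seq E1 _); refine (ev_seq E2 _); apply: ev_step => k.
  by rewrite /= er2 // r1 r2 (val_eqv E S1) (val_eqv E' S2).
- by case: E'' => er ea et eo; split=> //=; rewrite ea.
Qed.

Lemma hwp_write x (Q : state -> Prop) h :
  x < T0 -> Q (State (regs h) (arrs h) (tape h) (rcons (out h) (regs h x))) ->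
  hwp (Write x) 1 Q h.
Proof.
move=> lx q s E; have [er ea et eo] := E.
eexists 1, _, _; split; [by [] | exact: ev_step | | exact: q].
by split=> //=; rewrite eo er.
Qed.

Lemma hwp_flip x b r (Q : state -> Prop) h :
  1 < W -> tape h = b :: r ->
  Q (State (upd (regs h) x b) (arrs h) r (out h)) ->
  hwp (Flip x) 1 Q h.
Proof.
move=> lW th q s E; have [er ea et eo] := E.
exists 1, (State (upd (regs s) x b) (arrs s) r (out s)); eexists.
split; [by [] | | | exact: q].
- apply: ev_step => k /=; rewrite et th /set_reg.
  by rewrite (leq_ltn_trans _ lW) //; case: b {th q}.
- split=> //= y ly; rewrite /upd; case: ifP => // _; exact: er.
Qed.

Lemma hwp_if e c1 c2 t (Q : state -> Prop) h :
  safe W inp h e ->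
  (evalx inp h e != 0 -> hwp c1 t Q h) -> (evalx inp h e = 0 -> hwp c2 t Q h) ->
  hwp (IfE e c1 c2) (esize e + t + 2) Q h.
Proof.
move=> S H1 H2 s E.
have [s1 E1 P1] := cexp_ev (leqnn T0) (safe_eqv E S).
have [r1 _ _ _ _] := P1.
have E' := eqv_trans (put_temp_eqv (leqnn T0) P1) E.
have [m [s2 [h2 [lm E2 E3 q]]]] : exists m s2 h2,
    [/\ m <= t, ev W inp (if evalx inp h e != 0 then c1 else c2) m s1 s2, eqv s2 h2 & Q h2].
  by case: ifPn => [/H1|/negbNE/eqP/H2]; apply.
exists (esize e + m + 2), s2, h2; split=> //; first by rewrite leq_add2r leq_add2l.
rewrite (_ : _ + 2 = (esize e + (1 + m)).+1); last by lia.
refine (ev_seq E1 _) => k g.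
by rewrite -addnA add1n /= r1 (val_eqv E S) E2.
Qed.

(** At the loop head the value of the guard sits in the temporary [T0], which [eqv] ignores; it has
    to be carried as a separate premise. *)
Definition hwp_loop e c t (Q : state -> Prop) h : Prop :=
  forall s, eqv s h -> regs s T0 = evalx inp h e -> exists m s' h',
    [/\ m <= t, ev W inp (loop e c) m s s', eqv s' h' & Q h'].

Lemma hwp_while e c t (Q : state -> Prop) h :
  safe W inp h e -> hwp_loop e c t Q h -> hwp (WhileE e c) (esize e + t).+1 Q h.
Proof.
move=> S H s E.
have [s1 E1 P1] := cexp_ev (leqnn T0) (safe_eqv E S).
have [r1 _ _ _ _] := P1; rewrite (val_eqv E S) in r1.
have [m [s2 [h2 [lm E2 E3 q]]]] :=
  H _ (eqv_trans (put_temp_eqv (leqnn T0) P1) E) r1.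
exists (esize e + m).+1, s2, h2; split=> //; first by rewrite ltnS leq_add2l.
exact: ev_seq E1 E2.
Qed.

Lemma hwp_loop_exit e c t (Q : state -> Prop) h :
  evalx inp h e = 0 -> 0 < t -> Q h -> hwp_loop e c t Q h.
Proof.
move=> v0 t0 q s E r; exists 1, s, h; split=> //.
by move=> k g; rewrite add1n /= r v0.
Qed.

Lemma hwp_loop_step e c t1 t2 (Q : state -> Prop) h :
  evalx inp h e != 0 ->
  hwp c t1 (fun h1 => safe W inp h1 e /\ hwp_loop e c t2 Q h1) h ->
  hwp_loop e c (t1 + esize e + t2 + 2) Q h.
Proof.
move=> v0 H s E r.
have [m1 [s1 [h1 [l1 E1 Q1 [S1 L1]]]]] := H _ E.
have [s2 E2 P2] := cexp_ev (leqnn T0) (safe_eqv Q1 S1).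
have [r2 _ _ _ _] := P2; rewrite (val_eqv Q1 S1) in r2.
have [m3 [s3 [h3 [l3 E3 Q3 q]]]] :=
  L1 _ (eqv_trans (put_temp_eqv (leqnn T0) P2) Q1) r2.
exists (m1 + esize e + m3 + 2), s3, h3; split=> //; first by lia.
move=> k g; rewrite (_ : _ + g = ((m1 + esize e).+1 + (m3 + g)).+1); last by lia.
rewrite [LHS]/= r (negbTE v0) /=.
by rewrite -E3; exact: (ev_seq E1 E2).
Qed.

End Logic.

Definition For x y c :=
  Seq (Asg x (Lit 0))
    (WhileE (Bin OLt (Var x) (Var y)) (Seq c (Asg x (Bin OAdd (Var x) (Lit 1))))).

(** Beside its body, a turn takes 15 steps for the increment and the guard, and entering and leaving
    the loop takes 11; both are rounded up to 20. *)
Definition for_time b t := b * (t + 20) + 20.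

(** [J i] describes the loop head with the counter already equal to [i]; hence the body is checked
    against the state after the increment, and must itself leave the counter alone. *)
Lemma hwp_for W inp x y c b t (J : nat -> state -> Prop) h :
  x < T0 -> y < T0 -> b.+1 < W ->
  (forall i h', J i h' -> regs h' y = b) ->
  J 0 (set_var h x 0) ->
  (forall i h', i < b -> regs h' x = i -> J i h' ->
    hwp W inp c t (fun h1 => regs h1 x = i /\ J i.+1 (set_var h1 x i.+1)) h') ->
  hwp W inp (For x y c) (for_time b t) (J b) h.
Proof.
move=> lx ly lb Jy J0 Jc.
pose e := Bin OLt (Var x) (Var y).
have safe_e i h' : i <= b -> regs h' x = i -> J i h' -> safe W inp h' e.
  by move=> li rx /Jy ry; rewrite /= rx ry lx ly; case: (i < b) => /=; lia.
have L i j h' : i + j = b -> regs h' x = i -> J i h' ->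
  hwp_loop W inp e (Seq c (Asg x (Bin OAdd (Var x) (Lit 1)))) (j * (t + 20) + 1) (J b) h'.
  elim: j i h' => [|j IH] i h' Eb rx Ji.
    apply: hwp_loop_exit; rewrite ?addn0 //= in Eb *; last by rewrite -Eb.
    by rewrite rx (Jy _ _ Ji) Eb ltnn.
  have lib : i < b by lia.
  rewrite (_ : _ + 1 = (t + 7).+1 + esize e + (j * (t + 20) + 1) + 7); last by rewrite /=; lia.
  have LS : hwp_loop W inp e (Seq c (Asg x (Bin OAdd (Var x) (Lit 1))))
     ((t + 7).+1 + esize e + (j * (t + 20) + 1) + 2) (J b) h'.
    apply: hwp_loop_step; first by rewrite /= rx (Jy _ _ Ji) lib.
    apply: hwp_seq; apply: (hwp_weak (Jc i h' lib rx Ji) (leqnn _)) => h1 [rx1 J1].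
    apply: hwp_asg; rewrite /= rx1 ?(addn1 i); first by rewrite lx; lia.
    split; last by apply: (IH i.+1) => //; [lia | rewrite /= upd_same].
    by apply: (safe_e i.+1 _ lib _ J1); rewrite /= upd_same.
  move=> s E r; have [m [s1 [h1 [lm ? ? ?]]]] := LS s E r.
  by exists m, s1, h1; split=> //; lia.
rewrite /for_time (_ : _ + 20 = (3 + (esize e + (b * (t + 20) + 1)).+1).+1 + 9);
  last by rewrite /=; lia.
apply: (@hwp_weak _ _ _ (3 + (esize e + (b * (t + 20) + 1)).+1).+1 _ (J b)) => //.
  2: exact: leq_addr.
apply: hwp_seq; apply: hwp_asg => /=; first by lia.
apply: hwp_while; first by apply: (safe_e 0) => //=; rewrite upd_same.
by apply: (L 0) => //=; rewrite upd_same.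
Qed.

(** * Simulation on a virtual memory *)

Definition small (Z : nat) (h : state) : Prop :=
  (forall x, x < T0 -> regs h x <= Z) /\ forall a i, arrs h a i <= Z.

(** Operations for which [deg] gives a polynomial bound; a left shift would be exponential.
    Operations of a simulated program are not restricted in this way: their results are bounded
    because the simulated run itself does not get stuck. *)
Definition arith (o : binop) : bool :=
  match o with
  | OAdd | OSub | OMul | ODiv | OMod | OEq | OLt => true
  | _ => false
  end.

Fixpoint wfe (Z : nat) (e : expr) : bool :=
  match e with
  | Var x => x < T0
  | Lit v => v <= Z
  | Bin o e1 e2 => [&& arith o, wfe Z e1 & wfe Z e2]
  | Arr _ e | Inp e => wfe Z e
  end.

(* The intermediate values of [e] are at most [Z ^ deg e] when all variables,
   array cells and input cells are at most [Z]. *)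
Fixpoint deg (e : expr) : nat :=
  match e with
  | Var _ | Lit _ => 1
  | Bin o e1 e2 =>
      match o with
      | OAdd => (maxn (deg e1) (deg e2)).+1
      | OMul => deg e1 + deg e2
      | _ => maxn (deg e1) (deg e2)
      end
  | Arr _ e | Inp e => deg e
  end.

Lemma deg_gt0 e : 0 < deg e.
Proof. by elim: e => //= o e1 H1 e2 H2; case: o; rewrite ?leq_max ?H1 ?addn_gt0 ?H1. Qed.

(** Since [Z >= 2], a sum is at most [2 * Z ^ m <= Z ^ m.+1], so an addition costs one degree. A
    product adds the degrees, and the other operations of [arith] never exceed the larger of their
    first operand and 1. *)
Lemma val_deg Z inp h e : 1 < Z -> small Z h -> (forall i, nth 0 inp i <= Z) ->
  wfe Z e -> evalx inp h e <= Z ^ deg e.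
Proof.
move=> Z1 [hr ha] hi; have Z0 : 0 < Z by exact: ltnW.
elim: e => [x|v|o e1 IH1 e2 IH2|a e IH|e IH] //=.
- by move=> lx; exact: hr.
- move=> /and3P[ao /IH1 {}IH1 /IH2 {}IH2].
  have ML : Z ^ deg e1 <= Z ^ maxn (deg e1) (deg e2) by rewrite leq_pexp2l ?leq_maxl.
  have MR : Z ^ deg e2 <= Z ^ maxn (deg e1) (deg e2) by rewrite leq_pexp2l ?leq_maxr.
  have L1 := leq_trans IH1 ML; have L2 := leq_trans IH2 MR.
  have P0 : 0 < Z ^ maxn (deg e1) (deg e2) by rewrite expn_gt0 Z0.
  case: o ao => //= _.
  + rewrite expnS; apply: leq_trans (leq_mul Z1 (leqnn _)).
    by rewrite mul2n -addnn leq_add.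
  + exact: leq_trans (leq_subr _ _) L1.
  + by rewrite expnD leq_mul.
  + exact: leq_trans (leq_div _ _) L1.
  + exact: leq_trans (leq_mod _ _) L1.
  + by apply: leq_trans P0; case: (_ == _).
  + by apply: leq_trans P0; case: (_ < _).
- by move=> _; apply: leq_trans (ha _ _) _; rewrite -{1}(expn1 Z) leq_pexp2l ?deg_gt0.
- by move=> _; apply: leq_trans (hi _) _; rewrite -{1}(expn1 Z) leq_pexp2l ?deg_gt0.
Qed.

Lemma safe_small Z D W inp h e : 1 < Z -> small Z h ->
  (forall i, nth 0 inp i <= Z) -> Z ^ D < W ->
  wfe Z e -> deg e <= D -> safe W inp h e.
Proof.
move=> Z1 sm hi lW; have Z0 : 0 < Z by exact: ltnW.
have val_lt f : wfe Z f -> deg f <= D -> evalx inp h f < W.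
  move=> wf lf; apply: leq_ltn_trans lW.
  by apply: leq_trans (val_deg Z1 sm hi wf) _; rewrite leq_pexp2l.
elim: e => [x|v|o e1 IH1 e2 IH2|a e IH|e IH] wf ld; have L := val_lt _ wf ld.
- by move: wf L => /= -> ->.
- by rewrite /safe L.
- rewrite /safe -!/(safe _ _ _ _) L /=.
  move: wf => /= /and3P[_ w1 w2].
  by rewrite IH1 ?IH2 //; move: ld; rewrite /=; case: (o); lia.
- by rewrite /safe -!/(safe _ _ _ _) L /= IH.
- by rewrite /safe -!/(safe _ _ _ _) L /= IH.
Qed.

Fixpoint pow (e : expr) (k : nat) : expr :=
  if k is k'.+1 then Bin OMul e (pow e k') else Lit 1.

Lemma val_pow inp h e k : evalx inp h (pow e k) = evalx inp h e ^ k.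
Proof. by elim: k => //= k ->; rewrite expnS. Qed.

Lemma deg_pow e k : deg (pow e k) = k * deg e + 1.
Proof. by elim: k => //= k ->; rewrite mulSn addnA. Qed.

Lemma wfe_pow Z e k : 0 < Z -> wfe Z e -> wfe Z (pow e k).
Proof. by move=> Z0 we; elim: k => //= k ->; rewrite we. Qed.

Lemma small_set_var Z h x v : small Z h -> v <= Z -> small Z (set_var h x v).
Proof.
move=> [hr ha] lv; split=> //= y ly.
by rewrite /upd; case: ifP => // _; exact: hr.
Qed.

Lemma small_set_arr Z h a i v : small Z h -> v <= Z -> small Z (set_arr h a i v).
Proof.
move=> [hr ha] lv; split=> //= b j.
by rewrite /upd; case: ifP => // _; case: ifP => // _; exact: ha.
Qed.

(* Registers with the start of the overlay window, of the base copy and of the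
   coins of the current instance, and with the last value written by a call. *)
Notation vkb := 14.
Notation vbk := 15.
Notation vcb := 16.
Notation vout := 19.

(* Input of the preprocessing, input of an operation, coins, recorded answers. *)
Notation INP := 0.
Notation INO := 1.
Notation COIN := 2.
Notation ANS := 3.

(** The names 0 to 3 being taken, overlays get the even names and base copies the odd names from 4
    on. Virtual names are split by their residue modulo 3 into registers, arrays and the coin
    position [PT]. *)
Definition OVn (nm : nat) := nm.*2 + 4.
Definition BSn (nm : nat) := nm.*2 + 5.
Definition RG (x : nat) := 3 * x.
Definition AR (a : nat) := 3 * a + 1.
Notation PT := 2.

(* The virtual cell [y] of the virtual array [nm] holds the value stored in the
   overlay, incremented there so that 0 means absent, and otherwise the value
   stored in the base copy.  Moving the overlay window to fresh cells undoes all
   the writes made since the base copy was completed. *)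
Definition vget (nm : nat) (ye : expr) : expr :=
  let o := Arr (OVn nm) (Bin OAdd (Var vkb) ye) in
  Bin OAdd (Bin OSub o (Lit 1))
    (Bin OMul (Bin OEq o (Lit 0)) (Arr (BSn nm) (Bin OAdd (Var vbk) ye))).

Definition view (h : state) (nm y : nat) : nat :=
  let o := arrs h (OVn nm) (regs h vkb + y) in
  o - 1 + (o == 0) * arrs h (BSn nm) (regs h vbk + y).

Definition vput (md : bool) (nm : nat) (ye ve : expr) : cmd :=
  if md then Sto (BSn nm) (Bin OAdd (Var vbk) ye) ve
  else Sto (OVn nm) (Bin OAdd (Var vkb) ye) (Bin OAdd ve (Lit 1)).

Definition hput (md : bool) (h : state) (nm y v : nat) : state :=
  if md then set_arr h (BSn nm) (regs h vbk + y) v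
  else set_arr h (OVn nm) (regs h vkb + y) (v + 1).

Definition vreg x := vget (RG x) (Lit 0).

(* [md] selects the writes to the base copy (preprocessing) or to the overlay
   (updates and queries).  The registers of the simulated machine live in virtual
   arrays too, and so does its position [PT] on the recorded coins. *)
Fixpoint comp (md : bool) (c : cmd) : cmd :=
  match c with
  | Skip => Skip
  | Const x v => vput md (RG x) (Lit 0) (Lit v)
  | Op o x y z => vput md (RG x) (Lit 0) (Bin o (vreg y) (vreg z))
  | Get x a y => vput md (RG x) (Lit 0) (vget (AR a) (vreg y))
  | Put a x y => vput md (AR a) (vreg x) (vreg y)
  | Read x y =>
      vput md (RG x) (Lit 0) (Arr (if md then INP else INO) (vreg y))
  | Write x => Asg vout (vreg x)
  | Flip x =>
      Seq (vput md (RG x) (Lit 0) (Arr COIN (Bin OAdd (Var vcb) (vget PT (Lit 0)))))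
          (vput md PT (Lit 0) (Bin OAdd (vget PT (Lit 0)) (Lit 1)))
  | Seq c1 c2 => Seq (comp md c1) (comp md c2)
  | If x c1 c2 => IfE (vreg x) (comp md c1) (comp md c2)
  | While x c => WhileE (vreg x) (comp md c)
  end.

Lemma val_vget inp h nm ye :
  evalx inp h (vget nm ye) = view h nm (evalx inp h ye).
Proof. by []. Qed.

(** A generous bound on the host steps per simulated step. The dearest one is [Get], with two nested
    virtual reads and a virtual write, for which [hwp_vput] counts 149 steps. *)
Definition kappa : nat := 400.

Section Simulation.
Variables (W Z D S Lc Wsrc : nat) (inp : seq nat).
Hypotheses (Z1 : 1 < Z) (inpZ : forall i, nth 0 inp i <= Z).
Hypotheses (WD : Z ^ D < W) (D40 : 40 <= D).
Hypotheses (SZ : S <= Z) (LS : Lc < S) (WS : Wsrc <= S) (S0 : 0 < S).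

Lemma SW : S < W.
Proof.
apply: leq_ltn_trans WD; apply: leq_trans SZ _.
by rewrite -{1}(expn1 Z) leq_pexp2l //; lia.
Qed.

(** Preprocessing writes to the base copy, and such a write can be seen only through an empty
    overlay; this is the purpose of [pre_zero]. *)
Record sim_pre (md : bool) (sinp : seq nat) (h : state) : Prop := SimPre {
  pre_small : small Z h;
  pre_inp : forall y, y < S ->
    arrs h (if md then INP else INO) y = nth 0 sinp y;
  pre_zero : md -> forall nm y, y < S ->
    arrs h (OVn nm) (regs h vkb + y) = 0 }.

(** Agreement of the arrays below [S] is enough, because an address is the content of a register and
    registers stay below [S]. The coins still unread are found in [COIN] at the position kept in
    [PT]; [mem_tape] keeps this position at most [Lc < S]. *)
Record memrel (s h : state) : Prop := MemRel {
  mem_regs : forall x, regs s x = view h (RG x) 0;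
  mem_bound : forall x, regs s x < S;
  mem_arrs : forall a y, y < S -> arrs s a y = view h (AR a) y;
  mem_tape : view h PT 0 + size (tape s) <= Lc;
  mem_coin : forall i, i < size (tape s) ->
    arrs h COIN (regs h vcb + view h PT 0 + i) = nth false (tape s) i }.

(** Only the last number written is tracked, since a correct answer to a query consists of a single
    number. *)
Definition rel (s h : state) : Prop :=
  memrel s h /\ regs h vout = last 0 (out s).

(** The locality that makes the rollback sound: a simulation changes at most its own window, of the
    base copies in preprocessing mode and of the overlays otherwise, so other instances and, during
    the rounds, all base copies are preserved. *)
Record frame (md : bool) (h h' : state) : Prop := Frame {
  fr_small : small Z h';
  fr_regs : forall x, x < T0 -> x != vout -> regs h' x = regs h x;
  fr_arrs : forall a, a < 4 -> arrs h' a = arrs h a;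
  fr_tape : tape h' = tape h;
  fr_out : out h' = out h;
  fr_ov : forall nm y, md || ~~ (regs h vkb <= y < regs h vkb + S) ->
    arrs h' (OVn nm) y = arrs h (OVn nm) y;
  fr_bs : forall nm y, ~~ md || ~~ (regs h vbk <= y < regs h vbk + S) ->
    arrs h' (BSn nm) y = arrs h (BSn nm) y }.

Lemma frame_refl md h : small Z h -> frame md h h.
Proof. by move=> sm; split. Qed.

Lemma frame_trans md h1 h2 h3 :
  frame md h1 h2 -> frame md h2 h3 -> frame md h1 h3.
Proof.
move=> [s1 r1 a1 t1 o1 v1 b1] [s2 r2 a2 t2 o2 v2 b2]; split=> //.
- by move=> x lx nx; rewrite r2 ?r1.
- by move=> a la; rewrite a2 ?a1.
- by rewrite t2.
- by rewrite o2.
- by move=> nm y H; rewrite v2 ?v1 // r1.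
- by move=> nm y H; rewrite b2 ?b1 // r1.
Qed.

Lemma sim_pre_frame md sinp h h' :
  sim_pre md sinp h -> frame md h h' -> sim_pre md sinp h'.
Proof.
move=> [sm pi pz] [s1 r1 a1 t1 o1 v1 b1]; split=> //.
- by move=> y ly; rewrite a1 ?pi //; case: (md).
- by move=> mdT nm y ly; rewrite r1 // v1 ?mdT // pz.
Qed.

Lemma view_hput (md : bool) h nm y v nm' y' :
  (md -> forall nm y, y < S -> arrs h (OVn nm) (regs h vkb + y) = 0) ->
  y' < S ->
  view (hput md h nm y v) nm' y' =
  if (nm' == nm) && (y' == y) then v else view h nm' y'.
Proof.
move=> pz ly; rewrite /view /hput; case: md pz => pz /=.
- have -> : upd (arrs h) (BSn nm) (upd (arrs h (BSn nm)) (regs h vbk + y) v) (OVn nm')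
  = arrs h (OVn nm').
    by rewrite upd_other //; rewrite /OVn /BSn; lia.
  rewrite pz //= mul1n sub0n add0n /upd.
  have -> : (BSn nm' == BSn nm) = (nm' == nm) by rewrite /BSn; lia.
  case: eqP => [->|_] /=; last by rewrite mul1n.
  by rewrite eqn_add2l; case: eqP => //; rewrite mul1n.
- rewrite /upd.
  have -> : (OVn nm' == OVn nm) = (nm' == nm) by rewrite /OVn; lia.
  have -> : (BSn nm' == OVn nm) = false by rewrite /OVn /BSn; lia.
  case: eqP => [->|_] //=.
  by rewrite eqn_add2l; case: eqP => //; rewrite addnK addn1 /= addn0.
Qed.

Lemma frame_hput md h nm y v :
  small Z h -> y < S -> v < S -> frame md h (hput md h nm y v).
Proof.
move=> sm ly lv; rewrite /hput; case: md; split=> //=.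
- by apply: small_set_arr => //; lia.
- by move=> a la; rewrite upd_other // /BSn; lia.
- by move=> nm' z _; rewrite upd_other // /OVn /BSn; lia.
- move=> nm' z H; rewrite /upd; case: eqP => // ->.
  by case: eqP => // Ez; move: H; rewrite Ez; lia.
- by apply: small_set_arr => //; lia.
- by move=> a la; rewrite upd_other // /OVn; lia.
- move=> nm' z H; rewrite /upd; case: eqP => // ->.
  by case: eqP => // Ez; move: H; rewrite Ez; lia.
- by move=> nm' z _; rewrite upd_other // /OVn /BSn; lia.
Qed.

Lemma arrs_hput md h nm y v a : a < 4 -> arrs (hput md h nm y v) a = arrs h a.
Proof. by rewrite /hput => la; case: md; rewrite /= upd_other // /OVn /BSn; lia. Qed.

Lemma regs_hput md h nm y v : regs (hput md h nm y v) = regs h.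
Proof. by case: md. Qed.

Lemma safe_Z h e : small Z h -> wfe Z e -> deg e <= 40 -> safe W inp h e.
Proof. by move=> sm we le; apply: safe_small WD we _ => //; exact: leq_trans D40. Qed.

Lemma wfe_vget nm ye : wfe Z ye -> wfe Z (vget nm ye).
Proof. by move=> H /=; rewrite H; lia. Qed.

Lemma wfe_vreg x : wfe Z (vreg x).
Proof. exact: wfe_vget. Qed.

Lemma hwp_vput md nm ye ve (Q : state -> Prop) h :
  small Z h -> wfe Z ye -> deg ye <= 30 -> safe W inp h ve -> evalx inp h ve < S ->
  Q (hput md h nm (evalx inp h ye) (evalx inp h ve)) ->
  hwp W inp (vput md nm ye ve) (esize ye + esize ve + 11) Q h.
Proof.
move=> sm wy dy sv lv; rewrite /vput /hput; case: md => q.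
- apply: (@hwp_weak _ _ _ (esize (Bin OAdd (Var vbk) ye) + esize ve + 3) _ Q) => //;
  last by rewrite /=; lia.
  by apply: hwp_sto => //; apply: safe_Z => //=; lia.
- apply: (@hwp_weak _ _ _ (esize (Bin OAdd (Var vkb) ye) + esize (Bin OAdd ve (Lit 1)) + 3) _
  Q) => //; last by rewrite /=; lia.
  apply: hwp_sto => //; first by apply: safe_Z => //=; lia.
  by rewrite /= sv; have := SW; lia.
Qed.

Lemma rel_set_reg (md : bool) h s x v :
  (md -> forall nm y, y < S -> arrs h (OVn nm) (regs h vkb + y) = 0) ->
  v < S -> rel s h ->
  rel (State (upd (regs s) x v) (arrs s) (tape s) (out s)) (hput md h (RG x) 0 v).
Proof.
move=> pz lv [[mr mb ma mt mc] ro]; split; last by rewrite regs_hput.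
have vP : view (hput md h (RG x) 0 v) PT 0 = view h PT 0.
  by rewrite view_hput // (_ : PT == RG x = false) // /RG; lia.
split=> /=.
- move=> y; rewrite view_hput // andbT /upd (_ : (RG y == RG x) = (y == x));
  last by rewrite /RG; lia.
  by case: ifP => // _; exact: mr.
- by move=> y; rewrite /upd; case: ifP.
- move=> a y ly; rewrite view_hput // (_ : AR a == RG x = false) ?ma //.
  by rewrite /AR /RG; lia.
- by rewrite vP.
- by move=> i li; rewrite vP regs_hput arrs_hput // mc.
Qed.

Lemma rel_set_arr (md : bool) h s a i v :
  (md -> forall nm y, y < S -> arrs h (OVn nm) (regs h vkb + y) = 0) ->
  i < S -> rel s h ->
  rel (State (regs s) (upd (arrs s) a (upd (arrs s a) i v)) (tape s) (out s))
      (hput md h (AR a) i v).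
Proof.
move=> pz li [[mr mb ma mt mc] ro]; split; last by rewrite regs_hput.
have vP : view (hput md h (AR a) i v) PT 0 = view h PT 0.
  by rewrite view_hput // (_ : PT == AR a = false) // /AR; lia.
split=> //=.
- by move=> y; rewrite view_hput // (_ : RG y == AR a = false) // /AR /RG; lia.
- move=> b y ly; rewrite view_hput // /upd.
  rewrite (_ : (AR b == AR a) = (b == a)); last by rewrite /AR; lia.
  by case: eqP => [->|_] /=; [case: ifP => // _; exact: ma | exact: ma].
- by rewrite vP.
- by move=> j lj; rewrite vP regs_hput arrs_hput // mc.
Qed.

Lemma rel_flip (md : bool) h s b r :
  (md -> forall nm y, y < S -> arrs h (OVn nm) (regs h vkb + y) = 0) ->
  rel s h -> tape s = b :: r ->
  rel (State (regs s) (arrs s) r (out s)) (hput md h PT 0 (view h PT 0 + 1)).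
Proof.
move=> pz [[mr mb ma mt mc] ro] ts; split; last by rewrite regs_hput.
have vP : view (hput md h PT 0 (view h PT 0 + 1)) PT 0 = view h PT 0 + 1.
  by rewrite view_hput.
rewrite ts /= in mt mc; split=> //=.
- by move=> y; rewrite view_hput // (_ : RG y == PT = false) // /RG; lia.
- by move=> a y ly; rewrite view_hput // (_ : AR a == PT = false) ?ma // /AR; lia.
- by rewrite vP; lia.
- move=> i li; rewrite vP regs_hput arrs_hput //.
  by rewrite -(mc i.+1) //; congr (arrs h _ _); lia.
Qed.

Lemma val_vreg h s x : rel s h -> evalx inp h (vreg x) = regs s x.
Proof. by move=> [[mr _ _ _ _] _]; rewrite mr. Qed.

Lemma vreg_safe h x : small Z h -> safe W inp h (vreg x).
Proof. by move=> sm; apply: safe_Z => //; rewrite /vreg wfe_vget. Qed.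

Lemma sim_set_reg md sinp h s x ve s' :
  sim_pre md sinp h -> rel s h -> safe W inp h ve -> esize ve <= 300 ->
  set_reg Wsrc x (evalx inp h ve) s = Some s' ->
  hwp W inp (vput md (RG x) (Lit 0) ve) kappa
    (fun h' => rel s' h' /\ frame md h h') h.
Proof.
move=> pre r sv le; rewrite /set_reg; case: ifP => // lv [<-].
have lS : evalx inp h ve < S by exact: leq_trans WS.
have [sm _ pz] := pre.
apply: (@hwp_weak _ _ _ (esize (Lit 0) + esize ve + 11) _
  (fun h' => rel (State (upd (regs s) x (evalx inp h ve)) (arrs s) (tape s) (out s)) h'
     /\ frame md h h')) => //; last by rewrite /kappa /=; lia.
apply: hwp_vput => //=.
by split; [exact: rel_set_reg | exact: frame_hput].
Qed.

Lemma sim_flip md sinp h s x b r s' :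
  sim_pre md sinp h -> rel s h -> tape s = b :: r ->
  set_reg Wsrc x b (State (regs s) (arrs s) r (out s)) = Some s' ->
  hwp W inp (comp md (Flip x)) kappa (fun h' => rel s' h' /\ frame md h h') h.
Proof.
move=> pre r0 ts; rewrite /set_reg /=; case: ifP => // lv [<-].
have [sm _ pz] := pre.
have bS : b < S by exact: leq_trans WS.
set ve := Arr _ _.
have ve_b : evalx inp h ve = b.
  case: r0 => [[_ _ _ _ mc] _].
  by have := mc 0; rewrite ts addn0 /= => <-.
have -> : kappa = ((esize (Lit 0) + esize ve + 11) +
  (kappa - (esize (Lit 0) + esize ve + 12))).+1 by [].
apply: hwp_seq; apply: hwp_vput => //; first by apply: safe_Z => //=; lia.
  by rewrite ve_b.
rewrite ve_b [evalx _ _ _]/=; set h1 := hput _ _ _ _ _.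
have pre1 : sim_pre md sinp h1.
  by apply: (sim_pre_frame pre); exact: frame_hput.
have r1 : rel (State (upd (regs s) x b) (arrs s) (tape s) (out s)) h1.
  exact: rel_set_reg.
have [sm1 _ pz1] := pre1.
have v1 : view h1 PT 0 < Lc.
  by case: r1 => [[_ _ _ /= + _] _]; rewrite ts /=; lia.
have v1S : view h1 PT 0 + 1 < S.
  by lia.
apply: (@hwp_weak _ _ _ (esize (Lit 0) + esize (Bin OAdd (vget PT (Lit 0)) (Lit 1)) + 11) _
  (fun h' => rel (State (upd (regs s) x b) (arrs s) r (out s)) h' /\ frame md h h')) => //.
apply: hwp_vput => //; first by apply: safe_Z => //=; lia.
split; first by apply: (rel_flip pz1 r1); rewrite /= ts.
apply: (@frame_trans md h h1); first exact: frame_hput.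
exact: frame_hput.
Qed.

(** Strong induction on the allowance, as the second part of a sequence starts from a smaller [g1].
    Loops have their own statement because each turn after the first is entered with the guard
    already in [T0]. Its bound is lower by 40, which leaves room for the first evaluation of the
    guard, 35 steps plus some control. *)
Lemma sim md sinp g :
  (forall c s s' g', run Wsrc sinp g [:: c] s = Some (s', g') ->
     forall h, sim_pre md sinp h -> rel s h ->
     hwp W inp (comp md c) (kappa * (g - g'))
       (fun h' => rel s' h' /\ frame md h h') h) /\
  (forall x c s s' g', run Wsrc sinp g [:: While x c] s = Some (s', g') ->
     forall h, sim_pre md sinp h -> rel s h ->
     hwp_loop W inp (vreg x) (comp md c) (kappa * (g - g') - 40)
       (fun h' => rel s' h' /\ frame md h h') h).
Proof.
elim/ltn_ind: g => g IH.
have L x c s s' g' : run Wsrc sinp g [:: While x c] s = Some (s', g') ->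
     forall h, sim_pre md sinp h -> rel s h ->
     hwp_loop W inp (vreg x) (comp md c) (kappa * (g - g') - 40)
       (fun h' => rel s' h' /\ frame md h h') h.
  case: g IH => [|g] IH //=; case: ifP => rx R h pre r; last first.
    move: R; rewrite run_nil => -[<- <-];
      apply: hwp_loop_exit; rewrite ?(val_vreg _ r) //; last first.
    + by split=> //; apply: frame_refl; case: pre.
    + by rewrite subSnn.
    + by move/negbFE/eqP: rx.
  have [s1 [g1 [R1 R2]]] : exists s1 g1,
      run Wsrc sinp g [:: c] s = Some (s1, g1) /\
      run Wsrc sinp g1 [:: While x c] s1 = Some (s', g').
    move: R; rewrite -cat1s run_cat.
    by case: run => [[s1 g1]|] //= R; exists s1, g1.
  have [l1 _] := run_gas R1; have [l2 _] := run_gas R2.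
  (* The remaining execution of [While] takes at least one step, so subtracting 40 from its cost is
     not a truncated subtraction. *)
  have l3 : g' < g1.
    by case: (g1) R2 => // g2 /= R2; have [] := run_gas R2; lia.
  have LL : hwp_loop W inp (vreg x) (comp md c)
     (kappa * (g - g1) + esize (vreg x) + (kappa * (g1 - g') - 40) + 2)
       (fun h' => rel s' h' /\ frame md h h') h.
    apply: hwp_loop_step; first by rewrite (val_vreg _ r) rx.
    have [H1 _] := IH g (ltnSn g).
    apply: hwp_weak (H1 _ _ _ _ R1 h pre r) (leqnn _) _ => h1 [r1 f1].
    have pre1 := sim_pre_frame pre f1.
    split; first by apply: vreg_safe; case: pre1.
    have [_ H2] := IH g1 (leq_ltn_trans l1 (ltnSn g)).
    move=> t et rt.
    have [m [t' [h' [? ? ? [? ?]]]]] := H2 _ _ _ _ _ R2 h1 pre1 r1 t et rt.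
    by exists m, t', h'; split=> //; split=> //; exact: frame_trans f1 _.
  move=> t et rt.
  have [m [t' [h' [lm ? ? ?]]]] := LL t et rt.
  by exists m, t', h'; split=> //; rewrite /kappa /= in lm *; lia.
split=> // c s s' g'.
case: c => [|x v|o x y z|x a y|a x y|x y|x|x|c1 c2|x c1 c2|x c];
  last first.
- move=> R h pre r.
  have l3 : g' < g by case: (g) R => // g2 /= R; have [] := run_gas R; lia.
  rewrite (_ : kappa * (g - g') = (esize (vreg x) + (kappa * (g - g') - 40) + 4).+1);
    last by rewrite /kappa /=; lia.
  apply: hwp_weak (hwp_while _ (L _ _ _ _ _ R h pre r)) _ _ => //; last by lia.
  by apply: vreg_safe; case: pre.
all: case: g IH L => [|g] IH L //=.
- set c' := if _ then _ else _ => R h pre r.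
  have [l1 _] := run_gas R.
  rewrite (_ : kappa * (g.+1 - g')
    = (esize (vreg x) + kappa * (g - g') + 2) + (kappa - 37)); last by rewrite /kappa /=; lia.
  apply: (@hwp_weak _ _ _ (esize (vreg x) + kappa * (g - g') + 2) _
    (fun h' => rel s' h' /\ frame md h h')) => //; last exact: leq_addr.
  have [H _] := IH g (ltnSn g); have {}H := H _ _ _ _ R h pre r.
  apply: hwp_if; rewrite ?(val_vreg _ r) //.
  + by apply: vreg_safe; case: pre.
  + by move=> nx; move: H; rewrite /c' nx.
  + by move=> nx; move: H; rewrite /c' nx.
- move=> R h pre r.
  have [s1 [g1 [R1 R2]]] : exists s1 g1,
      run Wsrc sinp g [:: c1] s = Some (s1, g1) /\
      run Wsrc sinp g1 [:: c2] s1 = Some (s', g').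
    move: R; rewrite -cat1s run_cat.
    by case: run => [[s1 g1]|] //= R; exists s1, g1.
  have [l1 _] := run_gas R1; have [l2 _] := run_gas R2.
  have [H1 _] := IH g (ltnSn g).
  have [H2 _] := IH g1 (leq_ltn_trans l1 (ltnSn g)).
  apply: (@hwp_weak _ _ _ (kappa * (g - g1) + kappa * (g1 - g')).+1 _
    (fun h' => rel s' h' /\ frame md h h')) => //; last by rewrite /kappa; lia.
  apply: hwp_seq; apply: hwp_weak (H1 _ _ _ _ R1 h pre r) (leqnn _) _ => h1 [r1 f1].
  apply: hwp_weak (H2 _ _ _ _ R2 h1 (sim_pre_frame pre f1) r1) (leqnn _) _ => h2 [r2 f2].
  by split=> //; exact: frame_trans f2.
- case ts: (tape s) => [|b t] //; case E: set_reg => [s1|] //=; rewrite run_nil => -[<- <-] h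
  pre r.
  by rewrite subSnn muln1; exact: (sim_flip pre r ts E).
- rewrite run_nil => -[<- <-] h pre r; rewrite subSnn muln1.
  apply: (@hwp_weak _ _ _ (esize (vreg x) + 2) _
    (fun h' => rel (State (regs s) (arrs s) (tape s) (rcons (out s) (regs s x))) h'
      /\ frame md h h')) => //.
  have sm : small Z h by case: pre.
  apply: hwp_asg; first exact: vreg_safe.
  rewrite (val_vreg _ r) //; have [[mr mb ma mt mc] ro] := r; split.
    by split; [split | rewrite /= last_rcons upd_same].
  split=> //=; last by move=> y ly ny; rewrite upd_other.
  by apply: small_set_var => //; have := mb x; lia.
- case E: set_reg => [s1|] //=; rewrite run_nil => -[<- <-] h pre r; rewrite subSnn muln1.
  apply: (sim_set_reg pre r) => //.
    by apply: safe_Z => //; [by case: pre | exact: wfe_vreg].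
  rewrite -E -[evalx _ _ _]/(arrs h _ (evalx inp h (vreg y))) (val_vreg _ r).
  by rewrite (pre_inp pre) //; case: r => [[]].
- rewrite run_nil => -[<- <-] h pre r; rewrite subSnn muln1.
  have [sm _ pz] := pre.
  have [[mr mb _ _ _] _] := r.
  apply: (@hwp_weak _ _ _ (esize (vreg x) + esize (vreg y) + 11) _
    (fun h' => rel (State (regs s) (upd (arrs s) a (upd (arrs s a) (regs s x) (regs s y)))
      (tape s) (out s)) h' /\ frame md h h')) => //.
  apply: hwp_vput; rewrite ?(val_vreg _ r) //.
  + exact: wfe_vreg.
  + exact: vreg_safe.
  by split; [exact: rel_set_arr | exact: frame_hput].
- case E: set_reg => [s1|] //=; rewrite run_nil => -[<- <-] h pre r; rewrite subSnn muln1.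
  apply: (sim_set_reg pre r) => //.
    by apply: safe_Z => //; [by case: pre | apply: wfe_vget; exact: wfe_vreg].
  rewrite -E val_vget (val_vreg _ r) //.
  by case: r => [[_ mb ma _ _] _]; rewrite ma.
- case E: set_reg => [s1|] //=; rewrite run_nil => -[<- <-] h pre r; rewrite subSnn muln1.
  have e1 := val_vreg y r; have e2 := val_vreg z r.
  have EE : evalx inp h (Bin o (vreg y) (vreg z)) = eval_binop o (regs s y) (regs s z).
    by rewrite -e1 -e2.
  apply: (sim_set_reg pre r) => //; last by rewrite EE E.
  rewrite /safe -/(safe W inp h (vreg y)) -/(safe W inp h (vreg z)) EE.
  rewrite !vreg_safe ?andbT; try by case: pre.
  by move: E; rewrite /set_reg; case: ifP => // lv _; have := SW; lia.
- case E: set_reg => [s1|] //=; rewrite run_nil => -[<- <-] h pre r; rewrite subSnn muln1.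
  apply: (sim_set_reg pre r) => //=; rewrite ?E ?andbT //.
  by move: E; rewrite /set_reg; case: ifP => // lv _; have := SW; lia.
- rewrite run_nil => -[<- <-] h pre r; rewrite subSnn muln1.
  apply: (@hwp_weak _ _ _ 1 _ (fun h' => rel s h' /\ frame md h h')) => //.
  by apply: hwp_skip; split=> //; apply: frame_refl; case: pre.
Qed.

End Simulation.

(** * Independent coins *)

Local Open Scope ring_scope.

(** Expectation over [m] fair coins, by conditioning on the first one: independence of disjoint
    segments then follows by induction on plain sequences, without reindexing sums over tuples. *)
Fixpoint Ex (m : nat) (f : seq bool -> rat) : rat :=
  if m is m'.+1 then
    (Ex m' (fun x => f (true :: x)) + Ex m' (fun x => f (false :: x))) / 2
  else f [::].

Lemma sum_tupleS m (f : seq bool -> rat) :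
  \sum_(r : m.+1.-tuple bool) f r =
  \sum_(r : m.-tuple bool) f (true :: r) + \sum_(r : m.-tuple bool) f (false :: r).
Proof.
pose h (p : bool * m.-tuple bool) : m.+1.-tuple bool := [tuple of p.1 :: p.2].
rewrite (reindex h) /=; last first.
  exists (fun r : m.+1.-tuple bool => (thead r, [tuple of behead r])).
    by move=> [b r] _; congr (_, _); apply: val_inj.
  by move=> r _; rewrite /h /= -tuple_eta.
by rewrite -(pair_bigA _ (fun b (r : m.-tuple bool) => f (b :: r))) /= big_bool.
Qed.

Lemma Ex_tuple m (f : seq bool -> rat) :
  Ex m f = (\sum_(r : m.-tuple bool) f r) / (2 ^ m)%N%:R.
Proof.
elim: m f => [|m IH] f /=.
  rewrite expn0 divr1 (eq_bigr (fun=> f [::])) => [|r _]; last by rewrite tuple0.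
  by rewrite sumr_const card_tuple expn0 mulr1n.
rewrite !IH sum_tupleS expnS natrM invfM mulrA -mulrDl.
by rewrite [RHS]mulrAC.
Qed.

Lemma Pr_Ex m (E : pred (m.-tuple bool)) (E' : seq bool -> bool) :
  (forall r : m.-tuple bool, E r = E' r) -> Pr E = Ex m (fun x => (E' x)%:R).
Proof.
move=> EE; rewrite Ex_tuple /Pr; congr (_ / _).
rewrite -sum1_card natr_sum [RHS](eq_bigr (fun r : m.-tuple bool => (E r)%:R)).
  rewrite [RHS](bigID E) /= [X in _ = _ + X]big1 ?addr0.
    by apply: eq_bigr => r Er; rewrite unfold_in in Er; rewrite Er.
  by move=> r /negbTE ->.
by move=> r _; rewrite EE.
Qed.

Lemma Ex_le m (f g : seq bool -> rat) :
  (forall x, size x = m -> f x <= g x) -> Ex m f <= Ex m g.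
Proof.
elim: m f g => [|m IH] f g H /=; first exact: H.
by rewrite ler_pM2r // lerD // IH // => x sx; apply: H; rewrite /= sx.
Qed.

Lemma Ex_eq m (f g : seq bool -> rat) :
  (forall x, size x = m -> f x = g x) -> Ex m f = Ex m g.
Proof. by move=> H; apply/eqP; rewrite eq_le !Ex_le // => x /H ->. Qed.

Lemma Ex_scale m a (f : seq bool -> rat) : Ex m (fun x => a * f x) = a * Ex m f.
Proof. by elim: m f => [|m IH] f //=; rewrite !IH -mulrDr mulrA. Qed.

Lemma Ex_add m (f g : seq bool -> rat) :
  Ex m (fun x => f x + g x) = Ex m f + Ex m g.
Proof. by elim: m f g => [|m IH] f g //=; rewrite !IH -mulrDl addrACA. Qed.

Lemma Ex_const m a : Ex m (fun=> a) = a.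
Proof. by elim: m => [|m IH] //=; rewrite IH; lra. Qed.

Lemma Ex_sum m T (r : seq T) (f : T -> seq bool -> rat) :
  Ex m (fun x => \sum_(i <- r) f i x) = \sum_(i <- r) Ex m (f i).
Proof.
elim: r => [|i r IH].
  by rewrite big_nil -[RHS](Ex_const m); apply: Ex_eq => x _; rewrite big_nil.
by rewrite big_cons -IH -Ex_add; apply: Ex_eq => x _; rewrite big_cons.
Qed.

Lemma Ex_cat a b (f : seq bool -> rat) :
  Ex (a + b) f = Ex a (fun x => Ex b (fun y => f (x ++ y))).
Proof. by elim: a f => [|a IH] f //=; rewrite !IH. Qed.

Lemma Ex_window m s l (f : seq bool -> rat) : (s + l <= m)%N ->
  Ex m (fun x => f (take l (drop s x))) = Ex l f.
Proof.
move=> le_m; rewrite -(subnKC le_m) -addnA Ex_cat.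
rewrite -[RHS](Ex_const s); apply: Ex_eq => x sx.
rewrite Ex_cat; apply: Ex_eq => y sy.
rewrite -[RHS](Ex_const (m - (s + l))); apply: Ex_eq => z _.
by rewrite -sx drop_size_cat // -sy take_size_cat.
Qed.

Lemma Ex_prod l K (g : seq bool -> rat) :
  Ex (K * l) (fun r => \prod_(k < K) g (take l (drop (k * l) r))) = Ex l g ^+ K.
Proof.
elim: K => [|K IH].
  by rewrite expr0 -[RHS](Ex_const (0 * l)); apply: Ex_eq => r _; rewrite big_ord0.
rewrite mulSn Ex_cat exprS mulrC -Ex_scale; apply: Ex_eq => x sx.
rewrite mulrC -IH -Ex_scale; apply: Ex_eq => y sy.
rewrite big_ord_recl mul0n drop0 -{1}sx take_size_cat //; congr (_ * _).
apply: eq_bigr => k _; rewrite lift0 mulSn addnC -drop_drop.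
by have -> : drop l (x ++ y) = y by rewrite -sx drop_size_cat.
Qed.

(* Markov's inequality for 2 to the number of failures, whose expectation is at
   most [(4 / 3) ^+ Kh.*2]. *)
Lemma majority_error m s l Kh (w : seq bool -> bool) :
  (s + Kh.*2 * l <= m)%N -> Ex l (fun x => (w x)%:R) <= 1 / 3 ->
  Ex m (fun r => (Kh <= \sum_(k < Kh.*2) w (take l (drop (s + k * l) r)))%N%:R)
    <= (8 / 9) ^+ Kh.
Proof.
move=> lm hw.
pose g x : rat := 1 + (w x)%:R.
have Eg : Ex l g <= 4 / 3 by rewrite Ex_add Ex_const; lra.
have g0 : 0 <= Ex l g.
  by rewrite -[leLHS](Ex_const l); apply: Ex_le => x _; rewrite /g; case: (w x).
pose X r := (\sum_(k < Kh.*2) w (take l (drop (k * l) r)))%N.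
have prodE r : \prod_(k < Kh.*2) g (take l (drop (k * l) r)) = 2 ^+ X r.
  rewrite /X (big_morph (fun n : nat => 2 ^+ n : rat) (exprD 2) (expr0 2)).
  by apply: eq_bigr => k _; rewrite /g; case: (w _); rewrite ?expr1 ?expr0 ?addr0.
pose F r : rat := (Kh <= X r)%N%:R.
rewrite (_ : Ex m _ = Ex (Kh.*2 * l) F); last first.
  rewrite -(Ex_window _ lm); apply: Ex_eq => r _; rewrite /F /X.
  congr ((Kh <= _)%N%:R); apply: eq_bigr => k _; congr (nat_of_bool (w _)).
  have lk : (l + k * l <= Kh.*2 * l)%N by rewrite -mulSn leq_mul2r ltn_ord orbT.
  rewrite -[in RHS](subnK (leq_trans (leq_addl _ _) lk)) -take_drop drop_drop.
  by rewrite take_takel 1?addnC // leq_subRL ?(leq_trans (leq_addl _ _) lk) // addnC.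
have step1 : Ex (Kh.*2 * l) F <= (2 ^+ Kh)^-1 * (4 / 3) ^+ Kh.*2.
  apply: (@le_trans _ _ ((2 ^+ Kh)^-1 * Ex l g ^+ Kh.*2)); last first.
    by rewrite ler_pM2l ?invr_gt0 ?exprn_gt0 // lerXn2r ?nnegrE //.
  rewrite -Ex_prod -Ex_scale; apply: Ex_le => r _; rewrite prodE /F.
  have [le_X|_] := leqP; last by rewrite mulr_ge0 ?invr_ge0 ?exprn_ge0.
  by rewrite mulrC ler_pdivlMr ?exprn_gt0 // mul1r ler_eXn2l.
(* Per pair of copies the bound is [(4 / 3) ^ 2 / 2 = 8 / 9]. *)
apply: le_trans step1 _.
by rewrite -mul2n exprM -exprVn -exprMn; apply: lerXn2r; rewrite ?nnegrE; lra.
Qed.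

(** * The text of a block *)

Local Open Scope nat_scope.

Definition clr (s : state) : state := State (regs s) (arrs s) (tape s) [::].

(** In [solves_idm] the allowance and the length of the tape depend on the sequence of operations.
    Here every call gets the same allowance [F] and step counts are dropped, so that the state
    reached depends only on the coins and the operations, and sessions of different lengths can be
    compared. *)
Definition serve (W F : nat) (os : option state) (cl : cmd * seq nat) :=
  obind (fun s => omap fst (run W cl.2 F [:: cl.1] (clr s))) os.

Arguments serve : simpl never.

Lemma run_serve W inp g F c s s' g' :
  run W inp g [:: c] (clr s) = Some (s', g') -> g <= F ->
  serve W F (Some s) (c, inp) = Some s'.
Proof.
move=> R lF; rewrite /serve /=.
by have [_ /(_ (F - g))] := run_gas R; rewrite subnKC // => ->.
Qed.

Lemma session_serve W F e calls g s tr : g <= F ->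
  session W g s calls = Some tr ->
  exists2 s', foldl (serve W F) (Some (add_tape s e)) calls = Some s' &
    0 < size calls -> out s' = last_output tr.
Proof.
elim: calls g s tr => [|[c inp] calls IH] g s tr lF /=; first by exists (add_tape s e).
case R: (run _ _ _ _ _) => [[s1 g1]|] //.
have [lg _] := run_gas R.
have R' := run_add_tape e R.
case E: (session W g1 s1 calls) => [tr1|] //= [<-].
rewrite (run_serve (s := add_tape s e) R' lF).
have [s' H1 H2] := IH _ _ _ (leq_trans lg lF) E.
exists s' => // _; case: calls E H1 H2 {IH} => [|cl calls] E H1 H2.
  by case: H1 E => <- /= [<-].
rewrite H2 // /last_output /=.
move: E => /=; case: cl H1 H2 => c2 i2 _ _; case: (run _ _ _ _ _) => [[? ?]|] //.
by case: (session _ _ _ _) => //= tr2 [<-].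
Qed.

Lemma session_split W F e pre cl post bpre b bpost g s tr : g <= F ->
  session W g s (pre ++ cl :: post) = Some tr ->
  all2 (fun steps b => steps <= b) (unzip2 tr) (bpre ++ b :: bpost) ->
  size bpre = size pre ->
  exists s1 s2 m,
    [/\ foldl (serve W F) (Some (add_tape s e)) pre = Some s1, m <= b,
        run W cl.2 m [:: cl.1] (clr s1) = Some (s2, 0) &
        serve W F (Some s1) cl = Some s2].
Proof.
elim: pre bpre g s tr => [|[c inp] pre IH] [|b' bpre] // g s tr lF /=.
  case: cl => c inp; case R: (run _ _ _ _ _) => [[s1 g1]|] //.
  case: (session _ _ _ _) => //= tr1 [<-] /= /andP[lb _] _.
  have R' := run_add_tape e R.
  exists (add_tape s e), (add_tape s1 e), (g - g1); split=> //; first exact: (run_ev R').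
  exact: (run_serve (s := add_tape s e) R' lF).
case R: (run _ _ _ _ _) => [[s1 g1]|] //.
have [lg _] := run_gas R; have R' := run_add_tape e R.
rewrite (run_serve (s := add_tape s e) R' lF).
case E: (session _ _ _ _) => [tr1|] //= [<-] /= /andP[_ H] [sz].
exact: (IH bpre g1 s1 tr1 (leq_trans lg lF) E H sz).
Qed.

(** Emptying a nonempty control stack takes a step. This gives positive operation times, hence
    nonnegative exponents, in the final choice of parameters. *)
Lemma session_step_gt0 W g s calls tr :
  session W g s calls = Some tr -> all (leq 1) (unzip2 tr).
Proof.
elim: calls g s tr => [|[c inp] calls IH] g s tr /=; first by case=> <-.
case R: (run _ _ _ _ _) => [[s1 g1]|] //.
case E: (session _ _ _ _) => [tr1|] //= [<-] /=; rewrite (IH _ _ _ E) andbT.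
by case: g R => //= g; case: step => [[k s2]|] // /run_gas[]; rewrite subn_gt0.
Qed.

Section Block.
Variables (n1 n2 : nat) (mb : nat -> nat -> bool).

Definition text_size := n1.+1 * n2.

(* The [i]-th group of [n2] cells lists the letters j + 1 of the ones of row
   [i < n1], with the letter 0 at the zeros; the group [n1] has all the letters. *)
Definition text_cell p :=
  if (p %/ n2 == n1) || mb (p %/ n2) (p %% n2) then (p %% n2).+1 else 0.

Definition block_text := mkseq text_cell text_size.

(** A pattern must be given by an occurrence in the text, but a column of the block may contain no
    one; the last group of the text provides the occurrence. *)
Definition pattern j := (n1 * n2 + j + 1, n1 * n2 + j + 1).
Definition row_query i := (i * n2 + 1, i.+1 * n2).

Definition inserts (v : nat -> bool) k :=
  [seq Insert (pattern j) | j <- iota 0 k & v j].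
Definition queries k := [seq Exists (row_query i) | i <- iota 0 k].

Hypotheses (n1_gt0 : 0 < n1) (n2_gt0 : 0 < n2).

Lemma text_size_gt0 : 0 < text_size.
Proof. by rewrite muln_gt0 n2_gt0. Qed.

Lemma size_block_text : size block_text = text_size.
Proof. exact: size_mkseq. Qed.

Lemma text_cell_lt p : text_cell p < text_size.
Proof.
rewrite /text_cell /text_size; case: ifP => _; last exact: text_size_gt0.
by have := ltn_pmod p n2_gt0; nia.
Qed.

Lemma block_text_letters : all (fun a => a < size block_text) block_text.
Proof. by apply/allP => a /mapP[p _ ->]; rewrite size_block_text text_cell_lt. Qed.

Lemma fragment_pattern j : j < n2 ->
  fragment block_text (pattern j) = [:: j.+1].
Proof.
move=> lj; rewrite /fragment /pattern /= subnn addn1 /=.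
have lt : n1 * n2 + j < size block_text by rewrite size_block_text /text_size; nia.
rewrite (drop_nth 0 lt) /= take0 nth_mkseq; last by rewrite -size_block_text.
by rewrite /text_cell divnMDl // divn_small // addn0 eqxx /= modnMDl modn_small.
Qed.

Lemma mem_fragment_row i a : i < n1 ->
  (a \in fragment block_text (row_query i)) =
  has (fun j => text_cell (i * n2 + j) == a) (iota 0 n2).
Proof.
move=> li; rewrite /fragment /row_query /= addn1 /=.
have -> : (i.+1 * n2 - (i * n2).+1).+1 = n2 by lia.
have -> : take n2 (drop (i * n2) block_text) =
    [seq text_cell (i * n2 + j) | j <- iota 0 n2].
  rewrite /block_text /mkseq -map_drop -map_take drop_iota take_iota add0n.
  rewrite (minn_idPl _); last by rewrite /text_size; nia.
  by rewrite -{1}(addn0 (i * n2)) iotaDl -map_comp.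
apply/mapP/hasP => [[j lj ->]|[j lj /eqP <-]]; first by exists j.
by exists j.
Qed.

Lemma dict_inserts v k i :
  dict_after [::] (inserts v k ++ queries i) =
  [seq pattern j | j <- iota 0 k & v j].
Proof.
rewrite /dict_after cat0s pmap_cat [X in _ ++ X](_ : _ = [::]) ?cats0.
  by rewrite /inserts; elim: [seq _ <- _ | _] => //= j l ->.
by rewrite /queries; elim: (iota 0 i).
Qed.

Definition block_answer v i := has (fun j => v j && mb i j) (iota 0 n2).

(** The letter [j + 1] can stand only at offset [j] of a group, so it occurs in the group of row [i]
    exactly when the entry [(i, j)] is a one. Zeros carry the letter 0, which no pattern uses. *)
Lemma exists_answer_block v i k : i < n1 ->
  exists_answer block_text (dict_after [::] (inserts v n2 ++ queries k)) (row_query i)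
  = block_answer v i.
Proof.
move=> li; rewrite dict_inserts /exists_answer has_map.
have E j : j < n2 -> infix (fragment block_text (pattern j)) (fragment block_text (row_query
  i)) = mb i j.
  move=> lj; rewrite fragment_pattern // infix1s mem_fragment_row //.
  apply/hasP/idP => [[j' +]|mij]; last first.
    exists j; rewrite ?mem_iota // /text_cell divnMDl // divn_small // addn0.
    by rewrite modnMDl modn_small // mij orbT.
  rewrite mem_iota /= add0n => lj'; rewrite /text_cell divnMDl // divn_small // addn0.
  rewrite modnMDl modn_small // (ltn_eqF li) /=.
  by case: ifP => // mij /eqP[<-].
apply/hasP/hasP => [[j]|[j]].
  rewrite mem_filter mem_iota /= add0n => /andP[vj lj]; rewrite E // => mij.
  by exists j; rewrite ?mem_iota // vj.
rewrite mem_iota /= add0n => lj /andP[vj mij].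
by exists j; rewrite /= ?E // mem_filter vj mem_iota.
Qed.

Lemma inserts_valid v k : k <= n2 -> all (op_valid text_size) (inserts v k).
Proof.
move=> lk; rewrite all_map; apply/allP => j.
rewrite mem_filter mem_iota /= add0n => /andP[_ lj].
by rewrite /= /is_fragment /= /text_size; nia.
Qed.

Lemma row_query_valid i : i < n1 -> is_fragment text_size (row_query i).
Proof. by move=> li; rewrite /is_fragment /= /text_size; nia. Qed.

Lemma queries_valid k : k <= n1 -> all (op_valid text_size) (queries k).
Proof.
move=> lk; rewrite all_map; apply/allP => i; rewrite mem_iota /= add0n => li.
by apply: row_query_valid; exact: leq_trans lk.
Qed.

Lemma queriesS k : queries k.+1 = rcons (queries k) (Exists (row_query k)).
Proof. by rewrite /queries -addn1 iotaD map_cat cats1. Qed.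

Variables (A : idm_algorithm) (C c : nat) (tp ti tq : nat -> nat).
Hypothesis solves : solves_idm A C c tp ti tq.
Variable L : nat.

Notation Ws := (C * text_size ^ c).
Notation nT := text_size.
Hypothesis budget_le : tp nT + n2 * ti nT + n1 * tq nT <= L.

Definition prep_input := text_size :: block_text ++ [:: 0].

Definition op_call o := match o with
  | Insert p => (idm_insert A, [:: p.1; p.2])
  | Exists q => (idm_exists A, [:: q.1; q.2])
  end.

Definition op_budget o := if o is Insert _ then ti nT else tq nT.

Definition idm_state (coins : seq bool) (ops : seq operation) : option state :=
  foldl (serve Ws L) (Some (init coins)) ((idm_prep A, prep_input) :: map op_call ops).

Lemma idm_state_rcons coins ops o :
  idm_state coins (rcons ops o) = serve Ws L (idm_state coins ops) (op_call o).
Proof. by rewrite /idm_state map_rcons -rcons_cons foldl_rcons. Qed.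

Lemma block_calls ops :
  idm_calls A block_text [::] ops = (idm_prep A, prep_input) :: map op_call ops.
Proof. by rewrite /idm_calls size_block_text. Qed.

Lemma sum_budgets_le v k : k <= n1 ->
  sumn (idm_budgets tp ti tq nT (inserts v n2 ++ queries k)) <= L.
Proof.
move=> lk; apply: leq_trans budget_le; rewrite /idm_budgets /= -addnA leq_add2l.
have sumE T (l : seq T) b : sumn [seq b | _ <- l] = size l * b.
  by elim: l => //= _ l ->.
rewrite map_cat sumn_cat leq_add // -map_comp /=.
  rewrite (eq_map (g := fun=> ti nT)) // sumE leq_mul2r size_filter.
  by rewrite (leq_trans (count_size _ _)) ?orbT // size_iota.
by rewrite (eq_map (g := fun=> tq nT)) // sumE size_iota leq_mul2r lk orbT.
Qed.

Lemma add_tape_init x y : add_tape (init x) y = init (x ++ y).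
Proof. by []. Qed.

(** The hypothesis on [A] concerns sequences that end with a query, so the last of the [n1 > 0] row
    queries is split off. The time bounds for every single call are then read off from this one
    session. *)
Lemma block_session v coins : size coins = L ->
  let ops := inserts v n2 ++ queries n1 in
  let bs := idm_budgets tp ti tq nT ops in
  exists2 tr, session Ws (sumn bs) (init (take (sumn bs) coins))
      ((idm_prep A, prep_input) :: map op_call ops) = Some tr &
    all2 (fun steps b => steps <= b) (unzip2 tr) bs.
Proof.
move=> sz ops bs.
have lL : sumn bs <= L by exact: sum_budgets_le.
have ops_rcons : ops = rcons (inserts v n2 ++ queries n1.-1) (Exists (row_query n1.-1)).
  by rewrite rcons_cat -queriesS prednK.
have := @solves block_text [::] (inserts v n2 ++ queries n1.-1) (row_query n1.-1).
cbv zeta; rewrite size_block_text -ops_rcons block_calls => /(_ text_size_gt0).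
rewrite -{1}size_block_text => /(_ block_text_letters isT isT).
rewrite all_cat inserts_valid ?queries_valid ?leq_pred //.
rewrite row_query_valid ?ltn_predL // => /(_ isT isT) /= [H _].
have st : size (take (sumn bs) coins) == sumn bs by rewrite size_takel // sz.
exact: (H (Tuple st)).
Qed.

Lemma block_prep_run coins : size coins = L ->
  exists s1 m, [/\ m <= tp nT,
    run Ws prep_input m [:: idm_prep A] (init coins) = Some (s1, 0) &
    idm_state coins [::] = Some s1].
Proof.
move=> sz; have [tr E H] := block_session xpredT sz.
set bs := idm_budgets _ _ _ _ _ in E H.
have [s1 [s2 [m [E1 lm R SS]]]] := @session_split _ L (drop (sumn bs) coins)
   [::] _ _ [::] _ _ _ _ _ (sum_budgets_le _ (leqnn _)) E H erefl.
rewrite add_tape_init cat_take_drop /= in E1 R.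
exists s2, m; split=> //.
  by case: E1 R => <-.
by rewrite /idm_state /= -SS -E1.
Qed.

Lemma block_op_run v coins ops1 o ops2 : size coins = L ->
  inserts v n2 ++ queries n1 = ops1 ++ o :: ops2 ->
  exists s1 s2 m, [/\ idm_state coins ops1 = Some s1, m <= op_budget o,
    run Ws (op_call o).2 m [:: (op_call o).1] (clr s1) = Some (s2, 0) &
    idm_state coins (rcons ops1 o) = Some s2].
Proof.
move=> sz Eo; have [tr E H] := block_session v sz.
set bs := idm_budgets _ _ _ _ _ in E H.
have Ec : (idm_prep A, prep_input) :: map op_call (inserts v n2 ++ queries n1) =
  ((idm_prep A, prep_input) :: map op_call ops1) ++ op_call o :: map op_call ops2.
  by rewrite Eo map_cat.
have Eb : bs = (tp nT :: map op_budget ops1) ++ op_budget o :: map op_budget ops2.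
  by rewrite /bs /idm_budgets Eo map_cat.
rewrite Ec in E; rewrite Eb in H.
have [|s1 [s2 [m [E1 lm R SS]]]] := @session_split _ L (drop (sumn bs) coins)
   _ _ _ _ _ _ _ _ _ (sum_budgets_le _ (leqnn _)) E H.
  by rewrite /= !size_map.
rewrite add_tape_init cat_take_drop in E1.
by exists s1, s2, m; rewrite idm_state_rcons /idm_state E1.
Qed.

Definition wrong v i coins : bool :=
  omap out (idm_state coins (inserts v n2 ++ queries i.+1))
  != Some [:: nat_of_bool (block_answer v i)].

(** The session that ends with query [i] reads at most a prefix of the [L] coins; the others are
    averaged out by [Ex_window]. Operations and query are determined by the block, [v] and [i],
    hence fixed before the coins, as [solves_idm] demands. *)
Lemma wrong_prob v i : i < n1 ->
  (Ex L (fun coins => (wrong v i coins)%:R) <= 1 / 3)%R.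
Proof.
move=> li.
set ops := inserts v n2 ++ queries i.
have ops_rcons : inserts v n2 ++ queries i.+1 = rcons ops (Exists (row_query i)).
  by rewrite rcons_cat -queriesS.
have := @solves block_text [::] ops (row_query i).
cbv zeta; rewrite size_block_text -ops_rcons block_calls => /(_ text_size_gt0).
rewrite -{1}size_block_text => /(_ block_text_letters isT isT).
rewrite all_cat inserts_valid ?queries_valid ?(ltnW li) //.
rewrite row_query_valid // => /(_ isT isT) [H1].
rewrite exists_answer_block //.
set b := (nat_of_bool _); set l := sumn _; set calls := (_ :: _).
have lL : l <= L by exact: sum_budgets_le.
pose bad x := omap last_output (session Ws l (init x) calls) != Some [:: b].
rewrite (@Pr_Ex _ _ bad) // => H.
apply: le_trans H; rewrite -(@Ex_window L 0 l) ?add0n //.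
apply: Ex_le => x sx; rewrite drop0.
have st : size (take l x) == l by rewrite size_takel // sx.
have [tr E _] := H1 (Tuple st).
have [s' Es Eo] := session_serve (drop l x) lL E.
rewrite add_tape_init cat_take_drop in Es.
rewrite /bad E /wrong /idm_state -/calls Es /=.
by rewrite Eo.
Qed.

End Block.

(** * The reduction after the choice of the parameters *)

Notation "e1 [+] e2" := (Bin OAdd e1 e2) (at level 50, left associativity).
Notation "e1 [*] e2" := (Bin OMul e1 e2) (at level 40, left associativity).
Notation "e1 [/] e2" := (Bin ODiv e1 e2) (at level 40, left associativity).
Notation "e1 [mod] e2" := (Bin OMod e1 e2) (at level 40, left associativity).
Notation "e1 [==] e2" := (Bin OEq e1 e2) (at level 70).
Notation "e1 [<] e2" := (Bin OLt e1 e2) (at level 70).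

Fixpoint asgs (l : seq (nat * expr)) : cmd :=
  if l is (x, e) :: l' then Seq (Asg x e) (asgs l') else Skip.

Definition asgs_time (l : seq (nat * expr)) : nat :=
  foldr (fun p t => esize p.2 + 3 + t) 1 l.

Lemma hwp_le W inp c t t' Q h :
  t <= t' -> hwp W inp c t Q h -> hwp W inp c t' Q h.
Proof. by move=> lt H; exact: hwp_weak H lt _. Qed.

Lemma counter_lt W Z D x : 1 < Z -> 40 <= D -> Z ^ D < W -> x <= Z -> x.+1 < W.
Proof.
move=> Z1 D40 WD lx; apply: leq_ltn_trans WD; apply: leq_trans (_ : Z ^ 2 <= _).
  by rewrite expnS expn1; nia.
by rewrite leq_pexp2l; lia.
Qed.

Section Steps.
Variables (W Z D : nat) (inp : seq nat).
Hypotheses (Z1 : 1 < Z) (inpZ : forall i, nth 0 inp i <= Z) (WD : Z ^ D < W).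

Fixpoint asgs_ok (h : state) (l : seq (nat * expr)) (Q : state -> Prop) : Prop :=
  if l is (x, e) :: l' then
    [/\ wfe Z e, deg e <= D, evalx inp h e <= Z &
      asgs_ok (set_var h x (evalx inp h e)) l' Q]
  else Q h.

Lemma hwp_asgs l h (Q : state -> Prop) : small Z h ->
  asgs_ok h l (fun h' => small Z h' -> Q h') -> hwp W inp (asgs l) (asgs_time l) Q h.
Proof.
elim: l h => [|[x e] l IH] h sm /=; first by move=> q; apply: hwp_skip; exact: q.
move=> [we de le ok]; rewrite (_ : _ + _ = (esize e + 2 + asgs_time l).+1); last first.
  by rewrite -/(asgs_time l); lia.
apply: hwp_seq; apply: hwp_asg; first exact: safe_small WD _ _.
by apply: IH => //; exact: small_set_var.
Qed.

Lemma hwp_asgZ x e h (Q : state -> Prop) : small Z h -> wfe Z e -> deg e <= D ->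
  Q (set_var h x (evalx inp h e)) -> hwp W inp (Asg x e) (esize e + 2) Q h.
Proof. by move=> sm we de q; apply: hwp_asg => //; exact: safe_small WD _ _. Qed.

Lemma hwp_stoZ a e1 e2 h (Q : state -> Prop) : small Z h ->
  wfe Z e1 -> wfe Z e2 -> deg e1 <= D -> deg e2 <= D ->
  Q (set_arr h a (evalx inp h e1) (evalx inp h e2)) ->
  hwp W inp (Sto a e1 e2) (esize e1 + esize e2 + 3) Q h.
Proof. by move=> *; apply: hwp_sto => //; exact: safe_small WD _ _. Qed.

End Steps.

(** Resetting [vout] mirrors the cleared output at the start of a call, as [last 0 [::] = 0]. *)
Definition call (md : bool) (c : cmd) : cmd :=
  Seq (Asg vout (Lit 0)) (comp md c).

Lemma hwp_call W Z D S L Wsrc inp md sinp c s s' m h :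
  1 < Z -> (forall i, nth 0 inp i <= Z) -> Z ^ D < W -> 40 <= D ->
  S <= Z -> L < S -> Wsrc <= S ->
  sim_pre Z S md sinp h -> memrel S L s h ->
  run Wsrc sinp m [:: c] (clr s) = Some (s', 0) ->
  hwp W inp (call md c) (kappa * m + 4)
    (fun h' => rel S L s' h' /\ frame Z S md h h') h.
Proof.
move=> Z1 hi WD D40 SZ LS WS pre mr R.
have S0 : 0 < S by exact: leq_ltn_trans LS.
have sm := pre_small pre.
rewrite (_ : _ + 4 = (esize (Lit 0) + 2 + kappa * m).+1); last by rewrite /=; lia.
apply: hwp_seq; apply: hwp_asg; first by rewrite /= (leq_trans _ WD) // expn_gt0; lia.
set h1 := set_var h vout _.
have f1 : frame Z S md h h1.
  split=> //=; first by apply: small_set_var.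
  by move=> x lx nx; rewrite upd_other.
have r1 : rel S L (clr s) h1 by split=> //=; case: mr.
have [H _] := sim Z1 hi WD D40 SZ LS WS S0 md sinp m.
apply: hwp_weak (H _ _ _ _ R h1 (sim_pre_frame pre f1) r1) _ _.
  by rewrite subn0.
by move=> h2 [r2 f2]; split=> //; exact: frame_trans f1 f2.
Qed.

(** * Instances, their memory windows and the invariants between calls *)

Section Machine.
Variables (A : idm_algorithm) (C c : nat) (tp ti tq : nat -> nat).
Hypothesis solves : solves_idm A C c tp ti tq.
Variables (n s n1 n2 nb1 nb2 Kh L : nat).
Hypotheses (n_gt0 : 0 < n) (n1_gt0 : 0 < n1) (n2_gt0 : 0 < n2) (nb2_gt0 : 0 < nb2).
Hypothesis (Kh_gt0 : 0 < Kh).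
Notation N := (text_size n1 n2).
Notation K := (Kh.*2).
Notation S := (C * N ^ c + L + 1).
Notation NI := (nb1 * nb2 * K).
Hypothesis budget_le : tp N + n2 * ti N + n1 * tq N <= L.
Variables (W Z D : nat).
Hypotheses (Z1 : 1 < Z) (WD : Z ^ D < W) (D40 : 40 <= D).
Hypotheses (ZB : n.+1 * NI * S <= Z) (ZN : N < Z) (Zn : n <= Z)
  (Zs : s <= Z) (ZK : K <= Z) (NI_gt0 : 0 < NI).
Variables (coins : seq bool) (minp : seq nat).
Hypotheses (size_coins : NI * L <= size coins).

(* Contents of the registers 0 to 11.  The instance [e < NI] is the copy [e %% K] of
   the block [e %/ K]; it owns [S] consecutive cells of each base array. *)
Definition params : seq nat :=
  [:: n; s; n1; n2; nb2; Kh; K; N; S; L; NI; NI * L].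

Definition params_rnd rnd := params ++ [:: rnd].
(** The overlay window [(rnd * NI + e) * S] is different for each pair of a round and an instance,
    so the rollback is just a change of register. The base window and the coins depend on [e]
    alone. *)
Definition params_inst rnd e :=
  params_rnd rnd ++ [:: e; (rnd * NI + e) * S; e * S; e * L; e %/ K %/ nb2; (e %/ K) %% nb2].

Definition chunk e := take L (drop (e * L) coins).

(** A block at the right border may run past the last column and then reads entries of the next row.
    This is harmless, since the vector reads as 0 at indices from [n] on. *)
Definition block_mx e i j : bool :=
  nth 0 minp (1 + ((e %/ K %/ nb2) * n1 + i) * n + ((e %/ K) %% nb2 * n2 + j)) != 0.

Definition inst_state e ops := idm_state n1 n2 (block_mx e) A C c L (chunk e) ops.

(** The last two fields match the value 0 that the simulated [Read] finds beyond the end of its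
    input. *)
Record core (Q : seq nat) (h : state) : Prop := Core {
  core_small : small Z h;
  core_regs : forall x, x < size Q -> regs h x = nth 0 Q x;
  core_coin : forall i, i < NI * L -> arrs h COIN i = nth false coins i;
  core_ino : forall y, 1 < y -> arrs h INO y = 0;
  core_inp : forall y, N < y -> arrs h INP y = 0 }.

Lemma core_prefix Q Q' h : core (Q ++ Q') h -> core Q h.
Proof.
move=> [sm pr co io ip]; split=> // x lx.
by rewrite pr ?size_cat ?ltn_addr // nth_cat lx.
Qed.

Lemma core_rcons Q v h : core Q h -> regs h (size Q) = v -> core (rcons Q v) h.
Proof.
move=> [sm pr co io ip] rv; split=> // x; rewrite size_rcons ltnS leq_eqVlt nth_rcons.
by case: ltngtP => //= [lx _|->]; [exact: pr | rewrite rv].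
Qed.

Lemma core_set_var Q h x v : core Q h -> size Q <= x -> v <= Z ->
  core Q (set_var h x v).
Proof.
move=> [sm pr co io ip] lx lv; split=> //; first exact: small_set_var.
by move=> y ly /=; rewrite upd_other ?pr // neq_ltn (leq_trans ly).
Qed.

Lemma core_set_arr Q h a i v : core Q h -> v <= Z -> a != COIN ->
  (a = INO -> i <= 1) -> (a = INP -> i <= N) -> core Q (set_arr h a i v).
Proof.
move=> [sm pr co io ip] lv na li ln; split=> //=; first exact: small_set_arr.
- by move=> j lj; rewrite upd_other 1?eq_sym // co.
- move=> y ly; rewrite /upd; case: eqP => [Ea|_]; last exact: io.
  by case: eqP => [Ey|_]; [have := li (esym Ea); lia | rewrite -Ea; exact: io].
- move=> y ly; rewrite /upd; case: eqP => [Ea|_]; last exact: ip.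
  by case: eqP => [Ey|_]; [have := ln (esym Ea); lia | rewrite -Ea; exact: ip].
Qed.

Lemma core_frame md Q h h' : size Q <= 19 -> core Q h -> frame Z S md h h' -> core Q h'.
Proof.
move=> lQ [sm pr co io ip] [s1 r1 a1 t1 o1 v1 b1]; split=> //.
- move=> x lx; rewrite r1 ?pr //; last by lia.
  by rewrite /T0; lia.
- by move=> i li; rewrite a1 // co.
- by move=> y ly; rewrite a1 // io.
- by move=> y ly; rewrite a1 // ip.
Qed.

(** The content of [memrel] seen through an empty overlay, but without reference to any register: it
    persists while other instances are being served. *)
Record base_rel (e : nat) (s0 h : state) : Prop := BaseRel {
  base_regs : forall x, regs s0 x = arrs h (BSn (RG x)) (e * S);
  base_bound : forall x, regs s0 x < S;
  base_arrs : forall a y, y < S -> arrs s0 a y = arrs h (BSn (AR a)) (e * S + y);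
  base_tape : arrs h (BSn PT) (e * S) + size (tape s0) <= L;
  base_coin : forall i, i < size (tape s0) ->
    arrs h COIN (e * L + arrs h (BSn PT) (e * S) + i) = nth false (tape s0) i }.

Lemma view_base e h nm y :
  (forall nm y, y < S -> arrs h (OVn nm) (regs h vkb + y) = 0) ->
  regs h vbk = e * S -> y < S -> view h nm y = arrs h (BSn nm) (e * S + y).
Proof. by move=> z r ly; rewrite /view z //= add0n mul1n r. Qed.

Lemma base_mem e s0 h :
  (forall nm y, y < S -> arrs h (OVn nm) (regs h vkb + y) = 0) ->
  regs h vbk = e * S -> regs h vcb = e * L ->
  base_rel e s0 h <-> memrel S L s0 h.
Proof.
move=> z r rc; have S0 : 0 < S by rewrite addn1.
have v0 nm : view h nm 0 = arrs h (BSn nm) (e * S) by rewrite (view_base _ z r) // addn0.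
split=> [[br bb ba bt bc]|[mr mb ma mt mc]]; split=> //.
- by move=> x; rewrite v0.
- by move=> a y ly; rewrite (view_base _ z r) // ba.
- by rewrite v0.
- by move=> i li; rewrite v0 rc bc.
- by move=> x; rewrite mr v0.
- by move=> a y ly; rewrite ma // (view_base _ z r).
- by rewrite -v0.
- by move=> i li; rewrite -v0 -rc mc.
Qed.

Definition base_ok e h := exists2 s0, inst_state e [::] = Some s0 & base_rel e s0 h.

Lemma base_ok_eq e h h' : base_ok e h -> arrs h' COIN =1 arrs h COIN ->
  (forall nm y, e * S <= y < e.+1 * S -> arrs h' (BSn nm) y = arrs h (BSn nm) y) ->
  base_ok e h'.
Proof.
move=> [s0 E [br bb ba bt bc]] ac ab; exists s0 => //.
have b0 nm : arrs h' (BSn nm) (e * S) = arrs h (BSn nm) (e * S).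
  by apply: ab; rewrite leqnn ltn_mul2r addn1 ltnSn.
split=> //.
- by move=> x; rewrite b0.
- move=> a y ly; rewrite ab ?ba // leq_addr mulSn addnC ltn_add2r.
  by rewrite addn1 in ly *.
- by rewrite b0.
- by move=> i li; rewrite b0 ac bc.
Qed.

Lemma window_le rnd e : rnd <= n -> e < NI -> (rnd * NI + e).+1 * S <= Z.
Proof.
move=> lr le; apply: leq_trans ZB; rewrite leq_mul2r; apply/orP; right.
by rewrite -addnS mulSn addnC leq_add // leq_mul2r lr orbT.
Qed.

Lemma S_le : S <= Z.
Proof. by have := window_le (leq0n n) NI_gt0; rewrite mul0n add0n mul1n; lia. Qed.

Lemma NIS_le : NI * S <= Z.
Proof. by apply: leq_trans ZB; rewrite leq_mul2r leq_pmull ?orbT. Qed.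

Lemma NI_le : NI <= Z.
Proof. by apply: leq_trans NIS_le; rewrite leq_pmulr // addn1. Qed.

Definition block_setup : seq (nat * expr) :=
  [:: (14, (Var 12 [*] Var 10 [+] Var 13) [*] Var 8);
      (15, Var 13 [*] Var 8); (16, Var 13 [*] Var 9);
      (17, Var 13 [/] Var 6 [/] Var 4); (18, Var 13 [/] Var 6 [mod] Var 4)].

Lemma core_reg Q h x : core Q h -> x < size Q -> regs h x = nth 0 Q x.
Proof. by case=> _ pr _ _ _; exact: pr. Qed.

Lemma hwp_setup inp rnd e h (Q : state -> Prop) :
  (forall i, nth 0 inp i <= Z) -> rnd <= n -> e < NI ->
  core (params_rnd rnd) h -> regs h 13 = e ->
  (forall h', arrs h' = arrs h -> tape h' = tape h -> out h' = out h ->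
    core (params_inst rnd e) h' -> Q h') ->
  hwp W inp (asgs block_setup) (asgs_time block_setup) Q h.
Proof.
move=> hi lr le co r13 HQ; have [sm pr cc io ip] := co.
have win := window_le lr le.
have r12 : regs h 12 = rnd := pr 12 isT.
have r10 : regs h 10 = NI := pr 10 isT.
have r8 : regs h 8 = S := pr 8 isT.
have r9 : regs h 9 = L := pr 9 isT.
have r6 : regs h 6 = K := pr 6 isT.
have r4 : regs h 4 = nb2 := pr 4 isT.
have eZ : e.+1 * S <= Z.
  by apply: leq_trans win; rewrite leq_mul2r; apply/orP; right; lia.
have eZ' : e <= Z by nia.
apply: (hwp_asgs Z1 hi WD sm).
rewrite /asgs_ok /block_setup /= /upd /= r12 r10 r8 r9 r6 r4 r13.
have lQ : e %/ K <= Z by exact: leq_trans (leq_div _ _) eZ'.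
split; [by [] | by lia | by apply: leq_trans win; rewrite leq_mul2r leqnSn orbT | ].
split; [by [] | by lia | by apply: leq_trans eZ; rewrite leq_mul2r leqnSn orbT | ].
split; [by [] | by lia | by nia | ].
split; [by [] | by lia | exact: leq_trans (leq_div _ _) lQ | ].
split; [by [] | by lia | exact: leq_trans (leq_mod _ _) lQ | ].
move=> sm'; apply: HQ => //; split=> // x lx.
have [l13|g13] := ltnP x 13.
  rewrite /= !upd_other ?neq_ltn ?(leq_trans l13) //.
  by rewrite pr // /params_inst nth_cat l13.
by do 19! [case: x lx g13 => [|x] lx g13 //=].
Qed.

(** Branch-free form of [text_cell]: the disjunction is the positivity of a sum, and the letter is
    this truth value times [p %% n2 + 1]. Cell 0 of [INP] is reserved for the length of the text. *)
Definition text_loop : cmd :=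
  For 20 7
    (Sto INP (Var 20 [+] Lit 1)
      ((Lit 0 [<] ((Var 20 [/] Var 3 [==] Var 2) [+]
         (Lit 0 [<] Inp (Lit 1 [+] (Var 17 [*] Var 2 [+] Var 20 [/] Var 3) [*] Var 0
             [+] (Var 18 [*] Var 3 [+] Var 20 [mod] Var 3)))))
       [*] (Var 20 [mod] Var 3 [+] Lit 1))).

Lemma hwp_text e h (Q : state -> Prop) :
  (forall i, nth 0 minp i <= Z) -> e < NI -> core (params_inst 0 e) h ->
  (forall h', core (params_inst 0 e) h' ->
     (forall a, a != INP -> arrs h' a = arrs h a) -> tape h' = tape h ->
     arrs h' INP 0 = arrs h INP 0 ->
     (forall p, p < N -> arrs h' INP p.+1 = text_cell n1 n2 (block_mx e) p) -> Q h') ->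
  hwp W minp text_loop (for_time N 100) Q h.
Proof.
move=> hi le co HQ.
pose J p h' := [/\ core (params_inst 0 e) h',
  (forall a, a != INP -> arrs h' a = arrs h a) /\ tape h' = tape h,
  arrs h' INP 0 = arrs h INP 0 &
  (forall q, q < p -> arrs h' INP q.+1 = text_cell n1 n2 (block_mx e) q)].
apply: (@hwp_weak _ _ _ (for_time N 100) _ (J N)) => //; last first.
  by move=> h' [? [? ?] ? ?]; exact: HQ.
apply: hwp_for => //.
- exact: (counter_lt Z1 D40 WD (ltnW ZN)).
- by move=> i h' [co' _ _ _]; rewrite (core_reg co').
- by split=> //; apply: core_set_var.
move=> p h' lp r20 [co' [ar tp'] i0 it].
have R x (lx : x < 19) := core_reg co' lx.
set ve := (X in Sto _ _ X).
have sm := core_small co'.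
have ve_val : evalx minp h' ve = text_cell n1 n2 (block_mx e) p.
  rewrite /ve /= r20 !R //= /text_cell /block_mx /=.
  rewrite -lt0n addn1; case: (_ == n1) => /=; first by rewrite mul1n.
  by rewrite add0n; case: (0 < nth _ _ _); rewrite ?mul1n ?mul0n.
have vp : evalx minp h' (Var 20 [+] Lit 1) = p.+1 by rewrite /= r20 addn1.
apply: (@hwp_weak _ _ _ (esize (Var 20 [+] Lit 1) + esize ve + 3) _
  (fun h1 => regs h1 20 = p /\ J p.+1 (set_var h1 20 p.+1))) => //.
apply: (hwp_stoZ Z1 hi WD sm); rewrite ?vp ?ve_val //=; try by rewrite /T0; lia.
split=> //; split=> //=.
- apply: core_set_var => //; last by lia.
  apply: core_set_arr => //.
  by have := text_cell_lt (block_mx e) n1_gt0 n2_gt0 p; lia.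
- by split=> // a na; rewrite upd_other // ar.
- move=> q lq; rewrite upd_same /upd eqSS; case: eqP => [->|/eqP nq] //.
  by apply: it; rewrite ltn_neqAle nq.
Qed.

(** * Preprocessing of all the instances *)

Definition prep_body : cmd :=
  Seq (asgs block_setup) (Seq (Sto INP (Lit 0) (Var 7))
    (Seq text_loop (call true (idm_prep A)))).

Lemma size_chunk e : e < NI -> size (chunk e) = L.
Proof.
move=> le; rewrite size_takel // size_drop leq_subRL.
  by rewrite addnC -mulSn (leq_trans _ size_coins) // leq_mul2r le orbT.
by rewrite (leq_trans _ size_coins) // leq_mul2r ltnW ?orbT.
Qed.

Lemma base_rel_init e h : e < NI ->
  (forall i, i < NI * L -> arrs h COIN i = nth false coins i) ->
  (forall nm y, e * S <= y -> arrs h (BSn nm) y = 0) ->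
  base_rel e (init (chunk e)) h.
Proof.
move=> le hc z; have S0 : 0 < S by rewrite addn1.
split=> //=; rewrite ?size_chunk //.
- by move=> x; rewrite z.
- by move=> a y ly; rewrite z // leq_addr.
- by rewrite z.
- move=> i li; rewrite z // addn0 hc; last first.
    by apply: leq_trans (_ : e.+1 * L <= _);
      [rewrite mulSn addnC ltn_add2r | rewrite leq_mul2r le orbT].
  by rewrite nth_take // nth_drop.
Qed.

Definition prep_inv e h := [/\ core (params_rnd 0) h,
  (forall nm y, arrs h (OVn nm) y = 0),
  (forall e', e' < e -> base_ok e' h) &
  (forall nm y, e * S <= y -> arrs h (BSn nm) y = 0)].

(** All texts have length [N], so loading the next one overwrites the previous one and leaves no
    stale letters in [INP]. *)
Lemma hwp_prep_loop h : (forall i, nth 0 minp i <= Z) -> prep_inv 0 h ->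
  hwp W minp (For 13 10 prep_body)
    (for_time NI (for_time N 100 + kappa * tp N + 200)) (prep_inv NI) h.
Proof.
move=> hi inv0; have S0 : 0 < S by rewrite addn1.
apply: hwp_for => //.
- exact: (counter_lt Z1 D40 WD NI_le).
- by move=> i h' [co' _ _ _]; rewrite (core_reg co').
- case: inv0 => co z bo bz; split=> //; apply: core_set_var => //.
move=> e h' le r13 [co z bo bz].
apply: (@hwp_weak _ _ _ (asgs_time block_setup + (esize (Lit 0) + esize (Var 7) + 3 +
  (for_time N 100 + (kappa * tp N + 4)).+1).+1).+1 _
  (fun h1 => regs h1 13 = e /\ prep_inv e.+1 (set_var h1 13 e.+1))) => //; last first.
  by rewrite /asgs_time /=; lia.
apply: hwp_seq; apply: (hwp_setup hi (leq0n n) le co r13) => h1 a1 t1 o1 co1.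
have sm1 := core_small co1.
apply: hwp_seq; apply: (hwp_stoZ Z1 hi WD sm1) => //; try by move=> /=; lia.
rewrite [evalx _ _ _]/= [evalx _ _ (Var 7)]/= (core_reg co1) //; set h2 := set_arr _ _ _ _.
have co2 : core (params_inst 0 e) h2 by apply: core_set_arr => //; exact: ltnW.
apply: hwp_seq; apply: (hwp_text hi le co2) => h3 co3 a3 t3 i3 it3.
have sm3 := core_small co3.
have a13 a : a != INP -> arrs h3 a = arrs h' a.
  by move=> na; rewrite a3 // /h2 /= upd_other // a1.
have vk : regs h3 vkb = e * S by rewrite (core_reg co3).
have vb : regs h3 vbk = e * S by rewrite (core_reg co3).
have vc : regs h3 vcb = e * L by rewrite (core_reg co3).
have z3 nm y : arrs h3 (OVn nm) y = 0 by rewrite a13 ?z // /OVn; lia.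
have bz3 nm y : e * S <= y -> arrs h3 (BSn nm) y = 0.
  by move=> ly; rewrite a13 ?bz // /BSn; lia.
have mr : memrel S L (init (chunk e)) h3.
  by apply/(base_mem _ _ vb vc) => //; apply: base_rel_init => //; case: co3.
have pre : sim_pre Z S true (prep_input n1 n2 (block_mx e)) h3.
  split=> // y ly.
  rewrite /prep_input; case: y ly => [|y] ly; first by rewrite i3 /= upd_same upd_same.
  have [lN|gN] := ltnP y N.
    by rewrite it3 //= nth_cat size_block_text lN nth_mkseq.
  rewrite (core_inp co3) ?ltnS //= nth_cat size_block_text ltnNge gN /=.
  (* The final 0 of [prep_input] is the size of the empty initial dictionary, which coincides with
     the default value. *)
  by case: (y - N) => [|[|k]].
have [s1 [m [lm R E]]] := block_prep_run (block_mx e) n1_gt0 n2_gt0 solves budget_le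
  (size_chunk le).
apply: (@hwp_weak _ _ _ (kappa * m + 4) _ (fun h4 => rel S L s1 h4 /\ frame Z S true h3 h4)).
- have LS : L < S by lia.
  have WS : C * N ^ c <= S by lia.
  exact: (hwp_call Z1 hi WD D40 S_le LS WS pre mr R).
- by rewrite leq_add2r leq_mul2l lm orbT.
move=> h4 [[m4 _] f4].
have co4 : core (params_inst 0 e) h4 by apply: core_frame co3 f4.
have z4 nm y : arrs h4 (OVn nm) y = 0 by case: f4 => _ _ _ _ _ -> // _; exact: z3.
have a4 a : a < 4 -> arrs h4 a = arrs h3 a by case: f4 => _ _ H _ _ _ _; exact: H.
have b4 nm y : ~~ (e * S <= y < e.+1 * S) -> arrs h4 (BSn nm) y = arrs h3 (BSn nm) y.
  move=> ny; case: f4 => _ _ _ _ _ _ H; apply: H => /=.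
  by rewrite vb -mulSnr.
split; first by rewrite (core_reg co4).
have co4' : core (params_rnd 0) h4 by apply: core_prefix co4.
split=> //=.
- by apply: core_set_var => //; have := window_le (leq0n n) le; rewrite mul0n add0n; nia.
- move=> e' le'.
  have [Ee|ne] := eqVneq e' e.
    exists s1; first by rewrite Ee.
    rewrite Ee; apply/base_mem => //=; try by rewrite upd_other // (core_reg co4).
    by case: m4.
  have lee : e' < e by rewrite ltn_neqAle ne.
  apply: (base_ok_eq (bo e' lee)) => [i|nm y /andP[_ ly]] /=.
    by rewrite a4 // a13.
  rewrite b4; first by rewrite a13 // /BSn; lia.
  by rewrite negb_and -ltnNge (leq_trans ly) // leq_mul2r lee orbT.
- move=> nm y ly; rewrite b4 ?bz3 //.
    by rewrite (leq_trans _ ly) // leq_mul2r leqnSn orbT.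
  by apply/negP => /andP[_]; rewrite ltnNge ly.
Qed.

Definition coin_loop : cmd :=
  For 20 11 (Seq (Flip 22) (Sto COIN (Var 20) (Var 22))).

Lemma hwp_coins inp h : (forall i, nth 0 inp i <= Z) -> small Z h ->
  (forall x, x < 13 -> regs h x = nth 0 (params_rnd 0) x) ->
  tape h = coins -> (forall a y, arrs h a y = 0) ->
  hwp W inp coin_loop (for_time (NI * L) 10) (prep_inv 0) h.
Proof.
move=> hi sm pr th az.
pose J i h' := [/\ small Z h', (forall x, x < 13 -> regs h' x = nth 0 (params_rnd 0) x),
  tape h' = drop i coins, (forall k, k < i -> arrs h' COIN k = nth false coins k) &
  forall a y, a != COIN -> arrs h' a y = 0].
have NLZ : NI * L <= Z by apply: leq_trans NIS_le; rewrite leq_mul2l; lia.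
apply: (@hwp_weak _ _ _ (for_time (NI * L) 10) _ (J (NI * L))) => //; last first.
  move=> h' [sm' pr' th' cc az']; split=> //; first split=> //.
  - by move=> y _; exact: az'.
  - by move=> y _; exact: az'.
  - by move=> nm y; rewrite az' // /OVn; lia.
  - by move=> nm y _; rewrite az' // /BSn; lia.
apply: hwp_for => //.
- exact: (counter_lt Z1 D40 WD).
- by move=> i h' [_ pr' _ _ _]; rewrite pr'.
- split=> //=; first exact: small_set_var.
  + by move=> x lx; rewrite upd_other ?pr //; lia.
  + by rewrite drop0.
move=> i h' li r20 [sm' pr' th' cc az'].
have lc : i < size coins by exact: leq_trans size_coins.
rewrite (drop_nth false lc) in th'.
rewrite (_ : 10 = (1 + (esize (Var 20) + esize (Var 22) + 3)).+1 + 3) //.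
apply: hwp_weak (leq_addr _ _) (fun _ q => q).
apply: hwp_seq; apply: hwp_flip th' _; first exact: leq_trans (counter_lt Z1 D40 WD (leq0n _)).
have sm1 : small Z (State (upd (regs h') 22 (nth false coins i)) (arrs h') (drop i.+1 coins)
  (out h')).
  case: sm' => [sr sa]; split=> //= x lx.
  rewrite /upd; case: ifP => _; last exact: sr.
  by apply: leq_trans (_ : 1 <= _); [case: nth | exact: ltnW].
apply: (hwp_stoZ Z1 hi WD sm1) => //=; try lia.
rewrite upd_same upd_other // r20; split=> //; split=> //=.
- apply: small_set_var; last by lia.
  apply: small_set_arr => //.
  by apply: leq_trans (_ : 1 <= _); [case: nth | exact: ltnW].
- by move=> x lx; rewrite !upd_other ?pr' //; lia.
- move=> k lk; rewrite /upd /=; case: eqP => [->//|nk].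
  by apply: cc; lia.
- by move=> a y na; rewrite upd_other ?az'.
Qed.

(** * Serving one vector *)

Section Round.
Variable (vinp : seq nat).
Hypothesis (hv : forall i, nth 0 vinp i <= Z).

Definition block_v e j : bool := nth 0 vinp ((e %/ K) %% nb2 * n2 + j) != 0.

Definition ops_upto e i := inserts n1 n2 (block_v e) n2 ++ queries n2 i.

(** The round number does not occur: owing to the rollback, the recorded answer is a function of the
    matrix, the coins and the current vector. The probabilistic analysis rests on this. *)
Definition bit e i : bool :=
  if inst_state e (ops_upto e i.+1) is Some s0 then last 0 (out s0) != 0
  else false.

Record mem_inv rnd e ops h0 h : Prop := MemInv {
  mi_core : core (params_inst rnd e) h;
  mi_mem : exists2 s0, inst_state e ops = Some s0 & memrel S L s0 h;
  mi_base : forall nm y, arrs h (BSn nm) y = arrs h0 (BSn nm) y;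
  mi_coin : forall y, arrs h COIN y = arrs h0 COIN y;
  mi_over : forall nm y, (rnd * NI + e).+1 * S <= y -> arrs h (OVn nm) y = 0;
  mi_out : out h = out h0 }.

Lemma mem_inv_set_var rnd e ops h0 h x v : 19 <= x -> v <= Z ->
  mem_inv rnd e ops h0 h -> mem_inv rnd e ops h0 (set_var h x v).
Proof.
move=> lx lv [co [s0 E m] mb mc mo mout]; split=> //=.
  by apply: core_set_var.
exists s0 => //; case: m => mr mbo ma mt mco.
have nx y : y < 19 -> upd (regs h) x v y = regs h y.
  by move=> ly; rewrite upd_other // neq_ltn (leq_trans ly).
have vE nm y : view (set_var h x v) nm y = view h nm y by rewrite /view /= !nx.
split=> //=.
- by move=> y; rewrite vE.
- by move=> a y ly; rewrite vE ma.
- by rewrite vE.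
- by move=> i li; rewrite vE nx ?mco.
Qed.

Lemma mem_inv_set_arr rnd e ops h0 h a i v : a < 4 -> a != COIN -> a != INP ->
  v <= Z -> (a = INO -> i <= 1) ->
  mem_inv rnd e ops h0 h -> mem_inv rnd e ops h0 (set_arr h a i v).
Proof.
move=> la nc np lv li [co [s0 E m] mb mc mo mout].
have eB nm : upd (arrs h) a (upd (arrs h a) i v) (BSn nm) = arrs h (BSn nm).
  by rewrite upd_other // /BSn; lia.
have eO nm : upd (arrs h) a (upd (arrs h a) i v) (OVn nm) = arrs h (OVn nm).
  by rewrite upd_other // /OVn; lia.
have vE nm y : view (set_arr h a i v) nm y = view h nm y by rewrite /view /= eB eO.
split=> //=.
- by apply: core_set_arr => // Ea; rewrite Ea in np.
- exists s0 => //; case: m => mr mbo ma mt mco; split=> //=.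
  + by move=> y; rewrite vE.
  + by move=> b y ly; rewrite vE ma.
  + by rewrite vE.
  + by move=> j lj; rewrite vE upd_other ?mco // eq_sym.
- by move=> nm y; rewrite eB.
- by move=> y; rewrite upd_other // eq_sym.
- by move=> nm y ly; rewrite eO mo.
Qed.

Definition op_code (e1 e2 : expr) (c : cmd) : cmd :=
  Seq (Sto INO (Lit 0) e1) (Seq (Sto INO (Lit 1) e2) (call false c)).

(** The premise on [e1] and [e2] covers all states with the same registers because [e2] is evaluated
    after the first write to [INO]. *)
Lemma hwp_op rnd e ops o rest h0 h e1 e2 : rnd <= n -> e < NI ->
  ops ++ o :: rest = ops_upto e n1 ->
  mem_inv rnd e ops h0 h ->
  wfe Z e1 -> wfe Z e2 -> deg e1 <= D -> deg e2 <= D ->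
  (forall h1, regs h1 = regs h ->
     (op_call A o).2 = [:: evalx vinp h1 e1; evalx vinp h1 e2]) ->
  evalx vinp h e1 <= Z -> evalx vinp h e2 <= Z ->
  hwp W vinp (op_code e1 e2 (op_call A o).1)
    (kappa * op_budget n1 n2 ti tq o + esize e1 + esize e2 + 20)
    (fun h' => [/\ mem_inv rnd e (rcons ops o) h0 h',
       forall y, arrs h' ANS y = arrs h ANS y,
       forall x, x < T0 -> x != vout -> regs h' x = regs h x &
       exists2 s', inst_state e (rcons ops o) = Some s' & regs h' vout = last 0 (out s')])
    h.
Proof.
move=> lr le Eops mi w1 w2 d1 d2 He l1 l2.
have sm := core_small (mi_core mi).
set T := (X in hwp _ _ _ X).
apply: (@hwp_le _ _ _ (esize (Lit 0) + esize e1 + 3 + (esize (Lit 1) + esize e2 + 3 +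
  (kappa * op_budget n1 n2 ti tq o + 4)).+1).+1); first by rewrite /T /=; lia.
have LS : L < S by lia.
have WS : C * N ^ c <= S by lia.
apply: hwp_seq; apply: (hwp_stoZ Z1 hv WD sm) => //=; try lia.
set h1 := set_arr _ _ _ _.
have mi1 : mem_inv rnd e ops h0 h1 by apply: mem_inv_set_arr.
have [E1 E2] : nth 0 (op_call A o).2 0 = evalx vinp h e1 /\ nth 0 (op_call A o).2 1
  = evalx vinp h1 e2.
  split; first by rewrite (He h).
  by rewrite (He h1).
have E3 : evalx vinp h1 e2 = evalx vinp h e2.
  by rewrite -E2 (He h).
apply: hwp_seq; apply: (hwp_stoZ Z1 hv WD (core_small (mi_core mi1))) => //=; try lia.
set h2 := set_arr _ _ _ _.
have mi2 : mem_inv rnd e ops h0 h2 by apply: mem_inv_set_arr => //; rewrite E3.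
have [co2 [s0 Es m2] mb mc mo mout] := mi2.
have ino y : arrs h2 INO y = nth 0 (op_call A o).2 y.
  case: y => [|[|y]]; first by rewrite E1.
    by rewrite E2.
  rewrite (core_ino co2) // (He h) //=; by case: (y).
have pre : sim_pre Z S false (op_call A o).2 h2 by split=> //; exact: core_small co2.
have [s1 [s2 [m [Es1 lm R Es2]]]] := block_op_run (block_mx e)
   n1_gt0 n2_gt0 solves budget_le (size_chunk le) (esym Eops).
have Ess : s1 = s0 by move: Es; rewrite /inst_state Es1 => -[].
rewrite Ess in R.
apply: hwp_weak (hwp_call Z1 hv WD D40 S_le LS WS pre m2 R) _ _.
  by rewrite leq_add2r leq_mul2l lm orbT.
move=> h3 [[m3 o3] f3]; have [s3 r3 a3 t3 ou3 v3 b3] := f3.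
split.
- split.
  + by apply: core_frame co2 f3.
  + by exists s2.
  + by move=> nm y; rewrite b3 ?mb.
  + by move=> y; rewrite a3 ?mc.
  + move=> nm y ly; rewrite v3 ?mo // (_ : regs h2 vkb = (rnd * NI + e) * S); last first.
      by rewrite (core_reg co2).
    by apply/negP => /andP[_]; rewrite -mulSnr ltnNge ly.
  + by rewrite ou3.
- by move=> y; rewrite a3.
- by move=> x lx nx; rewrite r3.
- by exists s2.
Qed.

Lemma insertsS v j : inserts n1 n2 v j.+1 =
  if v j then rcons (inserts n1 n2 v j) (Insert (pattern n1 n2 j))
  else inserts n1 n2 v j.
Proof.
rewrite /inserts -addn1 iotaD filter_cat map_cat /= add0n.
by case: (v j); rewrite /= ?cats1 ?cats0.
Qed.

Definition insert_loop : cmd :=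
  let e := Var 2 [*] Var 3 [+] Var 21 [+] Lit 1 in
  For 21 3 (IfE (Inp (Var 18 [*] Var 3 [+] Var 21)) (op_code e e (idm_insert A)) Skip).

Lemma inserts_split e j : j < n2 -> block_v e j -> exists rest,
  inserts n1 n2 (block_v e) j ++ Insert (pattern n1 n2 j) :: rest = ops_upto e n1.
Proof.
move=> lj vj.
exists ([seq Insert (pattern n1 n2 i) | i <- iota j.+1 (n2 - j.+1) & block_v e i] ++ queries n2
  n1).
rewrite /ops_upto /inserts (_ : iota 0 n2 = iota 0 j ++ j :: iota j.+1 (n2 - j.+1)).
  by rewrite filter_cat /= vj map_cat -catA.
by rewrite -{1}(subnKC lj) iotaD -addn1 iotaD /= -catA.
Qed.

Lemma hwp_insert_loop rnd e h0 h : rnd <= n -> e < NI ->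
  mem_inv rnd e [::] h0 h -> (forall y, arrs h ANS y = arrs h0 ANS y) ->
  hwp W vinp insert_loop (for_time n2 (kappa * ti N + 100))
    (fun h' => mem_inv rnd e (ops_upto e 0) h0 h' /\
       forall y, arrs h' ANS y = arrs h0 ANS y) h.
Proof.
move=> lr le mi an.
have n2Z : n2 <= Z by apply: leq_trans (ltnW ZN); rewrite /text_size leq_pmull.
pose J j h' := mem_inv rnd e (inserts n1 n2 (block_v e) j) h0 h' /\
  forall y, arrs h' ANS y = arrs h0 ANS y.
apply: (@hwp_weak _ _ _ (for_time n2 (kappa * ti N + 100)) _ (J n2)) => //; last first.
  by rewrite /J /ops_upto cats0.
apply: hwp_for => //.
- exact: (counter_lt Z1 D40 WD).
- by move=> i h' [mi' _]; rewrite (core_reg (mi_core mi')).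
- by split=> //; apply: mem_inv_set_var.
move=> j h' lj r21 [mi' an'].
have R x (lx : x < 19) := core_reg (mi_core mi') lx.
have sm' := core_small (mi_core mi').
set ec := Inp _; set ep := Var 2 [*] Var 3 [+] Var 21 [+] Lit 1.
have vc : evalx vinp h' ec = nth 0 vinp ((e %/ K) %% nb2 * n2 + j).
  by rewrite /= r21 !R.
have vp h1 : regs h1 = regs h' -> evalx vinp h1 ep = n1 * n2 + j + 1.
  by move=> E; rewrite /= E r21 !R.
apply: (@hwp_le _ _ _ (esize ec + (kappa * ti N + esize ep + esize ep + 20) + 2)).
  by rewrite /=; lia.
have jZ : j.+1 <= Z by exact: leq_trans n2Z.
apply: hwp_if.
- by apply: (safe_small Z1 sm' hv WD); rewrite /= /T0; lia.
- rewrite vc => vj.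
  have [rest Er] := inserts_split lj vj.
  apply: hwp_weak (hwp_op lr le Er mi' _ _ _ _ _ _ _) (leqnn _) _; try by rewrite /= /T0; lia.
  + by move=> h1 E; rewrite vp.
  + by rewrite vp //; move: ZN; rewrite /text_size; nia.
  + by rewrite vp //; move: ZN; rewrite /text_size; nia.
  move=> h1 [mi1 an1 r1 _]; split; first by rewrite r1.
  split; last by move=> y; rewrite /= an1.
  by apply: mem_inv_set_var => //; rewrite insertsS ifT.
- rewrite vc => v0; apply: (@hwp_le _ _ _ 1); first by lia.
  have vj : block_v e j = false by rewrite /block_v v0.
  apply: hwp_skip; split=> //; split=> //.
  by apply: mem_inv_set_var => //; rewrite insertsS vj.
Qed.

Definition query_loop : cmd :=
  For 21 2
    (Seq (op_code (Var 21 [*] Var 3 [+] Lit 1) ((Var 21 [+] Lit 1) [*] Var 3) (idm_exists A))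
         (Sto ANS (Var 13 [*] Var 2 [+] Var 21) (Lit 0 [<] Var 19))).

Lemma queries_split e i : i < n1 -> exists rest,
  ops_upto e i ++ Exists (row_query n2 i) :: rest = ops_upto e n1.
Proof.
move=> li; exists [seq Exists (row_query n2 k) | k <- iota i.+1 (n1 - i.+1)].
rewrite /ops_upto -catA; congr (_ ++ _); rewrite /queries.
rewrite (_ : iota 0 n1 = iota 0 i ++ i :: iota i.+1 (n1 - i.+1)) ?map_cat //.
by rewrite -{1}(subnKC li) iotaD -addn1 iotaD /= -catA.
Qed.

Lemma hwp_query_loop rnd e h0 h : rnd <= n -> e < NI ->
  mem_inv rnd e (ops_upto e 0) h0 h -> (forall y, arrs h ANS y = arrs h0 ANS y) ->
  hwp W vinp query_loop (for_time n1 (kappa * tq N + 100))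
    (fun h' => [/\ mem_inv rnd e (ops_upto e n1) h0 h',
       forall y, y < e * n1 -> arrs h' ANS y = arrs h0 ANS y &
       forall i, i < n1 -> arrs h' ANS (e * n1 + i) = bit e i]) h.
Proof.
move=> lr le mi an.
have n1Z : n1 <= Z by move: ZN; rewrite /text_size; nia.
pose J i h' := [/\ mem_inv rnd e (ops_upto e i) h0 h',
  forall y, y < e * n1 -> arrs h' ANS y = arrs h0 ANS y &
  forall i', i' < i -> arrs h' ANS (e * n1 + i') = bit e i'].
apply: (@hwp_weak _ _ _ (for_time n1 (kappa * tq N + 100)) _ (J n1)) => //.
apply: hwp_for => //.
- exact: (counter_lt Z1 D40 WD).
- by move=> i h' [mi' _ _]; rewrite (core_reg (mi_core mi')).
- by split=> //=; apply: mem_inv_set_var.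
move=> i h' li r21 [mi' an' bt].
have R x (lx : x < 19) := core_reg (mi_core mi') lx.
have iZ : i < Z by exact: leq_trans n1Z.
set e1 := Var 21 [*] Var 3 [+] Lit 1; set e2 := (Var 21 [+] Lit 1) [*] Var 3.
set e3 := Var 13 [*] Var 2 [+] Var 21; set e4 := Lit 0 [<] Var 19.
have v1 h1 : regs h1 = regs h' -> evalx vinp h1 e1 = i * n2 + 1.
  by move=> E; rewrite /= E r21 !R.
have v2 h1 : regs h1 = regs h' -> evalx vinp h1 e2 = i.+1 * n2.
  by move=> E; rewrite /= E r21 !R // addn1.
apply: (@hwp_le _ _ _ ((kappa * tq N + esize e1 + esize e2 + 20) + (esize e3 + esize e4 + 3)).+1).
  by rewrite /=; lia.
have [rest Er] := queries_split e li.
apply: hwp_seq.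
apply: hwp_weak (hwp_op lr le Er mi' _ _ _ _ _ _ _) (leqnn _) _; try by rewrite /= /T0; lia.
- by move=> h1 E; rewrite v1 // v2.
- by rewrite v1 //; move: ZN; rewrite /text_size; nia.
- by rewrite v2 //; move: ZN; rewrite /text_size; nia.
move=> h1 [mi1 an1 r1 [s1 Es1 o1]].
have qS : rcons (ops_upto e i) (Exists (row_query n2 i)) = ops_upto e i.+1.
  by rewrite /ops_upto queriesS rcons_cat.
rewrite qS in mi1 Es1.
apply: (hwp_stoZ Z1 hv WD (core_small (mi_core mi1))); try by rewrite /= /T0; lia.
have R1 x (lx : x < 19) := core_reg (mi_core mi1) lx.
have v3 : evalx vinp h1 e3 = e * n1 + i by rewrite /= (R1 13) // (R1 2) // r1 // r21.
have v4 : evalx vinp h1 e4 = bit e i by rewrite /= /bit Es1 o1 lt0n.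
rewrite v3 v4; split; first by rewrite /= r1.
have bZ : bit e i <= Z by apply: leq_trans (ltnW Z1); case: (bit e i).
split.
- by apply: mem_inv_set_var => //; apply: mem_inv_set_arr.
- move=> y ly; rewrite /= upd_same upd_other ?an1 ?an' //.
  by rewrite neq_ltn (leq_trans ly) // leq_addr.
- move=> k lk; rewrite /= upd_same /upd eqn_add2l; case: eqP => [->//|nk].
  by rewrite an1 bt //; lia.
Qed.

Definition round_body : cmd :=
  Seq (asgs block_setup) (Seq insert_loop query_loop).

Definition round_inv rnd e h := [/\ core (params_rnd rnd) h,
  (forall e', e' < NI -> base_ok e' h),
  (forall nm y, (rnd * NI + e) * S <= y -> arrs h (OVn nm) y = 0),
  (forall e' i, e' < e -> i < n1 -> arrs h ANS (e' * n1 + i) = bit e' i) &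
  out h = [::]].

Lemma hwp_round_loop rnd h : rnd <= n -> round_inv rnd 0 h ->
  hwp W vinp (For 13 10 round_body)
    (for_time NI (for_time n2 (kappa * ti N + 100) + for_time n1 (kappa * tq N + 100) + 100))
    (round_inv rnd NI) h.
Proof.
move=> lr inv0; have S0 : 0 < S by rewrite addn1.
apply: hwp_for => //.
- exact: (counter_lt Z1 D40 WD NI_le).
- by move=> i h' [co' _ _ _ _]; rewrite (core_reg co').
- case: inv0 => co bo ov bt oh; split=> //; first exact: core_set_var.
  by move=> e' le'; apply: (base_ok_eq (bo e' le')).
move=> e h' le r13 [co bo ov bt oh].
apply: (@hwp_le _ _ _ (asgs_time block_setup + (for_time n2 (kappa * ti N + 100) +
   for_time n1 (kappa * tq N + 100)).+1).+1).
  by rewrite /asgs_time /=; lia.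
apply: hwp_seq; apply: (hwp_setup hv lr le co r13) => h1 a1 t1 o1 co1.
have vk : regs h1 vkb = (rnd * NI + e) * S by rewrite (core_reg co1).
have vb : regs h1 vbk = e * S by rewrite (core_reg co1).
have vc : regs h1 vcb = e * L by rewrite (core_reg co1).
have mi1 : mem_inv rnd e [::] h1 h1.
  have [s0 Es bs] := bo e le.
  split=> //.
  - exists s0 => //; apply/(base_mem _ _ vb vc).
      by move=> nm y ly; rewrite a1 vk ov // leq_addr.
    by case: bs => *; split=> //; rewrite a1.
  - move=> nm y ly; rewrite a1 ov // (leq_trans _ ly) // leq_mul2r.
    by rewrite leqnSn orbT.
apply: hwp_seq; apply: hwp_weak (hwp_insert_loop lr le mi1 (fun=> erefl)) (leqnn _) _.
move=> h2 [mi2 an2].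
apply: hwp_weak (hwp_query_loop lr le mi2 an2) (leqnn _) _ => h3 [mi3 an3 bt3].
have [co3 _ mb mc mo mout] := mi3.
split; first by rewrite (core_reg co3).
split=> //=.
- apply: core_set_var => //; first by apply: core_prefix co3.
  by have := NI_le; lia.
- move=> e' le'; apply: (base_ok_eq (bo e' le')) => [i|nm y _] /=.
    by rewrite mc a1.
  by rewrite mb a1.
- by move=> nm y ly; apply: mo; rewrite -addnS.
- move=> e' i le' li.
  have [->|ne] := eqVneq e' e; first exact: bt3.
  have lee : e' < e by rewrite ltn_neqAle ne.
  rewrite an3 ?a1 ?bt //.
  by apply: leq_trans (_ : e'.+1 * n1 <= _);
    [rewrite mulSnr ltn_add2l | rewrite leq_mul2r lee orbT].
- by rewrite mout o1.
Qed.

(** * Majority vote and output of a round *)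

Definition votes i j := \sum_(t < K) bit ((i %/ n1 * nb2 + j) * K + t) (i %% n1).
Definition answer i := has (fun j => Kh < votes i j) (iota 0 nb2).

Definition vote_loop : cmd :=
  For 22 6 (Asg 24 (Var 24 [+] Arr ANS
    (((Var 20 [/] Var 2 [*] Var 4 [+] Var 21) [*] Var 6 [+] Var 22) [*] Var 2
      [+] Var 20 [mod] Var 2))).

Definition row_loop : cmd :=
  For 21 4 (Seq (Asg 24 (Lit 0)) (Seq vote_loop
    (Asg 23 (Lit 0 [<] (Var 23 [+] (Var 5 [<] Var 24)))))).

Definition output_loop : cmd :=
  For 20 0 (Seq (Asg 23 (Lit 0)) (Seq row_loop (Write 23))).

Hypothesis nb1_large : n <= nb1 * n1.

Lemma hwp_vote_loop rnd i j b h : i < n -> j < nb2 ->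
  core (params_rnd rnd) h ->
  (forall e i, e < NI -> i < n1 -> arrs h ANS (e * n1 + i) = bit e i) ->
  regs h 20 = i -> regs h 21 = j -> regs h 23 = b -> regs h 24 = 0 ->
  hwp W vinp vote_loop (for_time K 60)
    (fun h' => [/\ core (params_rnd rnd) h', arrs h' = arrs h, out h' = out h,
       regs h' 20 = i & [/\ regs h' 21 = j, regs h' 23 = b & regs h' 24 = votes i j]]) h.
Proof.
move=> li lj co an r20 r21 r23 r24.
pose J t h' := [/\ core (params_rnd rnd) h', arrs h' = arrs h, out h' = out h &
  [/\ regs h' 20 = i, regs h' 21 = j, regs h' 23 = b &
   regs h' 24 = \sum_(t' < t) bit ((i %/ n1 * nb2 + j) * K + t') (i %% n1)]].
apply: (@hwp_weak _ _ _ (for_time K 60) _ (J K)) => //; last first.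
  by move=> h' [? ? ? [? ? ? ?]].
apply: hwp_for => //.
- exact: (counter_lt Z1 D40 WD).
- by move=> t h' [co' _ _ _]; rewrite (core_reg co').
- by split=> //=; [exact: core_set_var | rewrite big_ord0].
move=> t h' lt r22 [co' ar oh [q20 q21 q23 q24]].
have sm' := core_small co'.
have lin : i %/ n1 < nb1 by rewrite ltn_divLR // (leq_trans li).
have le : (i %/ n1 * nb2 + j) * K + t < NI.
  have H : i %/ n1 * nb2 + j < nb1 * nb2.
    apply: leq_trans (_ : (i %/ n1).+1 * nb2 <= _); first by rewrite mulSnr ltn_add2l.
    by rewrite leq_mul2r lin orbT.
  apply: leq_trans (_ : (i %/ n1 * nb2 + j).+1 * K <= _); first by rewrite mulSnr ltn_add2l.
  by rewrite leq_mul2r H orbT.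
set ev := Var 24 [+] _.
have vv : evalx vinp h' ev = \sum_(t' < t.+1) bit ((i %/ n1 * nb2 + j) * K + t') (i %% n1).
  rewrite big_ord_recr /= q24 q20 q21 r22 (core_reg co' (x := 2)) // (core_reg co' (x := 4)) //.
  by rewrite (core_reg co' (x := 6)) //= ar an // ltn_pmod.
have sumZ : evalx vinp h' ev <= Z.
  rewrite vv; apply: leq_trans ZK; apply: leq_trans lt.
  rewrite -[leqRHS]muln1 -[leqRHS](sum_nat_const_nat 0 t.+1 1) // big_mkord.
  by apply: leq_sum => k _; case: (bit _ _).
apply: (@hwp_le _ _ _ (esize ev + 2)) => //.
apply: (hwp_asgZ Z1 hv WD sm') => //; try by rewrite /= /T0; lia.
split=> //=; split=> //=.
apply: core_set_var => //; first by apply: core_set_var.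
by have := ZK; lia.
Qed.

Lemma hwp_row_loop rnd i h : i < n ->
  core (params_rnd rnd) h ->
  (forall e i, e < NI -> i < n1 -> arrs h ANS (e * n1 + i) = bit e i) ->
  regs h 20 = i -> regs h 23 = 0 ->
  hwp W vinp row_loop (for_time nb2 (for_time K 60 + 40))
    (fun h' => [/\ core (params_rnd rnd) h', arrs h' = arrs h, out h' = out h,
       regs h' 20 = i & regs h' 23 = answer i]) h.
Proof.
move=> li co an r20 r23.
have nb2Z : nb2 <= Z.
  by have [/(_ 4 isT) + _] := core_small co; rewrite (core_reg co).
pose J j h' := [/\ core (params_rnd rnd) h', arrs h' = arrs h, out h' = out h,
  regs h' 20 = i & regs h' 23 = has (fun j => Kh < votes i j) (iota 0 j)].
apply: (@hwp_weak _ _ _ (for_time nb2 (for_time K 60 + 40)) _ (J nb2)) => //.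
apply: hwp_for => //.
- exact: (counter_lt Z1 D40 WD).
- by move=> t h' [co' _ _ _ _]; rewrite (core_reg co').
- by split=> //=; exact: core_set_var.
move=> j h' lj r21 [co' ar oh q20 q23].
set el := Lit 0 [<] _.
apply: (@hwp_le _ _ _ (esize (Lit 0) + 2 + (for_time K 60 + (esize el + 2)).+1).+1).
  by rewrite /=; lia.
apply: hwp_seq; apply: (hwp_asgZ Z1 hv WD (core_small co')) => //; first by move=> /=; lia.
set h1 := set_var _ _ _.
have co1 : core (params_rnd rnd) h1 by apply: core_set_var.
apply: hwp_seq; apply: hwp_weak (hwp_vote_loop li lj co1 _ _ _ _ _) (leqnn _) _ => //=.
  by move=> e k le lk; rewrite ar an.
move=> h2 [co2 a2 o2 w20 [w21 w23 w24]].
have {}w23 := etrans w23 q23.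
apply: (hwp_asgZ Z1 hv WD (core_small co2)) => //; try by rewrite /= /T0; lia.
have ve : evalx vinp h2 el = has (fun j => Kh < votes i j) (iota 0 j.+1).
  rewrite -(addn1 j) iotaD has_cat add0n /= w23 w24 (core_reg co2) //= orbF.
  by case: (has _ _); case: (Kh < votes _ _).
rewrite ve; split=> //; split=> //=.
- apply: core_set_var => //; last exact: leq_trans nb2Z.
  by apply: core_set_var => //; apply: leq_trans (ltnW Z1); case: (_ || _).
- by rewrite a2.
- by rewrite o2.
Qed.

Lemma hwp_output_loop rnd h :
  core (params_rnd rnd) h ->
  (forall e i, e < NI -> i < n1 -> arrs h ANS (e * n1 + i) = bit e i) ->
  out h = [::] ->
  hwp W vinp output_loop (for_time n (for_time nb2 (for_time K 60 + 40) + 20))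
    (fun h' => [/\ core (params_rnd rnd) h', arrs h' = arrs h &
       out h' = mkseq (fun i => nat_of_bool (answer i)) n]) h.
Proof.
move=> co an oh.
pose J i h' := [/\ core (params_rnd rnd) h', arrs h' = arrs h &
  out h' = mkseq (fun i => nat_of_bool (answer i)) i].
apply: (@hwp_weak _ _ _ (for_time n (for_time nb2 (for_time K 60 + 40) + 20)) _ (J n)) => //.
apply: hwp_for => //.
- exact: (counter_lt Z1 D40 WD).
- by move=> t h' [co' _ _]; rewrite (core_reg co').
- by split=> //=; exact: core_set_var.
move=> i h' li r20 [co' ar o'].
apply: (@hwp_le _ _ _ (esize (Lit 0) + 2 + (for_time nb2 (for_time K 60 + 40) + 1).+1).+1).
  by rewrite /=; lia.
apply: hwp_seq; apply: (hwp_asgZ Z1 hv WD (core_small co')) => //; first by move=> /=; lia.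
set h1 := set_var _ _ _.
have co1 : core (params_rnd rnd) h1 by apply: core_set_var.
apply: hwp_seq; apply: hwp_weak (hwp_row_loop li co1 _ _ _) (leqnn _) _ => //=.
  by move=> e k le lk; rewrite ar an.
move=> h2 [co2 a2 o2 w20 w23].
apply: hwp_write => //; rewrite w23 o2 /= o'.
split=> //; split=> //=.
- have co3 : core (params_rnd rnd) (set_var h2 20 i.+1).
    by apply: core_set_var => //; exact: leq_trans Zn.
  by case: co3 => *; split.
- by rewrite a2.
- by rewrite /mkseq -(addn1 i) iotaD map_cat add0n /= cats1.
Qed.

Definition round_prog : cmd :=
  Seq (Asg 12 (Var 12 [+] Lit 1)) (Seq (For 13 10 round_body) output_loop).

(* The state between two calls, after [rnd] rounds. *)
Definition idle rnd h := [/\ core (params_rnd rnd) h,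
  forall e, e < NI -> base_ok e h &
  forall nm y, rnd.+1 * NI * S <= y -> arrs h (OVn nm) y = 0].

Definition round_time := 
  for_time NI (for_time n2 (kappa * ti N + 100) + for_time n1 (kappa * tq N + 100) + 100)
  + for_time n (for_time nb2 (for_time K 60 + 40) + 20) + 20.

Lemma hwp_round rnd h : rnd < n -> idle rnd h -> out h = [::] ->
  hwp W vinp round_prog round_time
    (fun h' => idle rnd.+1 h' /\ out h' = mkseq (fun i => nat_of_bool (answer i)) n) h.
Proof.
move=> lr [co bo ov] oh; have sm := core_small co.
set el := Var 12 [+] Lit 1.
have vl : evalx vinp h el = rnd.+1 by rewrite /= (core_reg co) //= addn1.
apply: (@hwp_le _ _ _ (esize el + 2 + (for_time NI (for_time n2 (kappa * ti N + 100) +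
   for_time n1 (kappa * tq N + 100) + 100) +
   for_time n (for_time nb2 (for_time K 60 + 40) + 20)).+1).+1).
  by rewrite /round_time /=; lia.
apply: hwp_seq; apply: (hwp_asgZ Z1 hv WD sm) => //; try by rewrite /= /T0; lia.
rewrite vl; set h1 := set_var _ _ _.
have co1 : core (params_rnd rnd.+1) h1.
  rewrite /params_rnd cats1; apply: core_rcons; last by rewrite /= upd_same.
  by apply: core_set_var; [exact: core_prefix co | | exact: leq_trans Zn].
apply: hwp_seq; apply: hwp_weak (hwp_round_loop (rnd := rnd.+1) lr _) (leqnn _) _.
  split=> //= [e le|nm y ly]; last by apply: ov; rewrite -{1}(addn0 (rnd.+1 * NI)).
  exact: (base_ok_eq (bo e le)).
move=> h2 [co2 bo2 ov2 an2 o2].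
apply: hwp_weak (hwp_output_loop co2 an2 o2) (leqnn _) _ => h3 [co3 a3 o3].
split=> //; split=> // [e le|nm y ly]; first by apply: (base_ok_eq (bo2 e le)) => *; rewrite a3.
by rewrite a3 ov2 // -mulSnr.
Qed.

End Round.

End Machine.

(** * Computing the parameters *)

(** The integer part of the [d]-th root of [n], written as a count so that a loop of [n] turns
    obtains it by adding truth values. *)
Definition root d n := count (fun i => i.+1 ^ d <= n) (iota 0 n).

Lemma root_upto d n i : 0 < d ->
  let r := count (fun i => i.+1 ^ d <= n) (iota 0 i) in
  [/\ r <= i, r ^ d <= n & (r == i) || (n < r.+1 ^ d)].
Proof.
move=> d0 /=; elim: i => [|i [IH1 IH2 IH3]]; first by rewrite /= exp0n.
rewrite -(addn1 i) iotaD count_cat /= add0n addn0 addn1; set q := count _ _ in IH1 IH2 IH3 *.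
case/orP: IH3 => [/eqP Eq|lq].
  rewrite Eq; have [le|gt] := leqP (i.+1 ^ d) n.
    by rewrite addn1 le eqxx leqnn.
  by rewrite addn0 leqnSn gt orbT -Eq.
have -> : i.+1 ^ d <= n = false.
  apply/negbTE; rewrite -ltnNge; apply: leq_trans lq _.
  by rewrite leq_exp2r.
by rewrite addn0 lq orbT leqW.
Qed.

Lemma rootP d n : 0 < d -> 0 < n ->
  [/\ 0 < root d n, root d n <= n, root d n ^ d <= n & n < (root d n).+1 ^ d].
Proof.
move=> d0 n0; have [] := root_upto n n d0; rewrite -/(root d n) => r1 r2 r3.
split=> //.
- case/orP: r3 => [/eqP->//|]; rewrite lt0n; case: eqP => // ->.
  by rewrite exp1n ltnNge n0.
- case/orP: r3 => [/eqP ->|//].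
  by apply: leq_trans (leq_pexp2l (ltn0Sn n) d0); rewrite expn1.
Qed.

Section Preparation.
Variables (A : idm_algorithm) (C c d a b K0 K1 k1 : nat).

Definition root_loop : cmd :=
  For 20 0 (Asg 1 (Var 1 [+] (pow (Var 20 [+] Lit 1) d [<] (Var 0 [+] Lit 1)))).

(** Register 9 is set before register 8, because the window size [S] includes the number [L] of
    coins. *)
Definition size_params : seq (nat * expr) :=
  [:: (2, pow (Var 1) a); (3, pow (Var 1) b); (4, Var 0 [/] Var 3 [+] Lit 1);
      (5, Var 1 [+] Lit K0); (6, Lit 2 [*] Var 5);
      (7, (Var 2 [+] Lit 1) [*] Var 3); (9, Lit K1 [*] pow (Var 7) k1);
      (8, Lit C [*] pow (Var 7) c [+] Var 9 [+] Lit 1);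
      (10, (Var 0 [/] Var 2 [+] Lit 1) [*] Var 4 [*] Var 6);
      (11, Var 10 [*] Var 9)].

Definition prep_prog : cmd :=
  Seq (Asg 0 (Inp (Lit 0))) (Seq root_loop (Seq (asgs size_params)
    (Seq coin_loop (For 13 10 (prep_body A))))).

Definition root_time := esize (pow (Var 20 [+] Lit 1) d) + 20.

Variables (tp ti tq : nat -> nat).
Hypothesis solves : solves_idm A C c tp ti tq.
Hypotheses (d_gt0 : 0 < d).
Variable n : nat.
Hypothesis n_gt0 : 0 < n.
Notation s := (root d n).
Notation n1 := (s ^ a).
Notation n2 := (s ^ b).
Notation nb1 := (n %/ n1 + 1).
Notation nb2 := (n %/ n2 + 1).
Notation Kh := (s + K0).
Notation N := (text_size n1 n2).
Notation K := (Kh.*2).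
Notation L := (K1 * N ^ k1).
Notation S := (C * N ^ c + L + 1).
Notation NI := (nb1 * nb2 * K).
Hypothesis budget_le : tp N + n2 * ti N + n1 * tq N <= L.
Variables (W Z D : nat).
Hypotheses (Z1 : 1 < Z) (WD : Z ^ D < W).
Hypothesis D_large : 40 + 3 * d + a + b + c + k1 <= D.
Hypotheses (ZB : n.+1 * NI * S <= Z) (ZN : N < Z) (ZK : K <= Z).
Variables (coins : seq bool) (minp : seq nat).
Hypotheses (size_coins : NI * L <= size coins) (minp0 : nth 0 minp 0 = n)
  (minpZ : forall i, nth 0 minp i <= Z).

Definition prep_time := esize (Inp (Lit 0)) + 10 + for_time n root_time
  + asgs_time size_params + for_time (NI * L) 10
  + for_time NI (for_time N 100 + kappa * tp N + 200).

Lemma hwp_prep : hwp W minp prep_prog prep_time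
  (idle A C c n s n1 n2 nb1 nb2 Kh L Z coins minp 0) (init coins).
Proof.
have [s_gt0 sn sd ds] := rootP d_gt0 n_gt0.
have n1_gt0 : 0 < n1 by rewrite expn_gt0 s_gt0.
have n2_gt0 : 0 < n2 by rewrite expn_gt0 s_gt0.
have D40 : 40 <= D by lia.
have NI_gt0 : 0 < NI by rewrite !muln_gt0 !addn1 /= double_gt0 addn_gt0 s_gt0.
have N_gt0 : 0 < N by exact: text_size_gt0.
have NIS : NI * S <= Z by apply: leq_trans ZB; rewrite leq_mul2r leq_pmull ?orbT.
have NZ : NI <= Z by apply: leq_trans NIS; rewrite leq_pmulr // addn1.
have SZ : S <= Z by apply: leq_trans NIS; rewrite leq_pmull.
have Zn : n <= Z.
  by apply: leq_trans ZB; apply: leq_trans (leqnSn n) _; rewrite -mulnA leq_pmulr // muln_gt0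
    NI_gt0 addn1.
have sm0 : small Z (init coins) by [].
have nb2NI : nb2 <= NI by rewrite mulnAC leq_pmull // muln_gt0 addn1 /= double_gt0 addn_gt0 s_gt0.
have n1N : n1 <= N by exact: leq_trans (leqnSn _) (leq_pmulr _ n2_gt0).
have n2N : n2 <= N by rewrite /text_size leq_pmull.
have CS : C <= S.
  by apply: leq_trans (_ : C * N ^ c <= _); [rewrite leq_pmulr // expn_gt0 N_gt0 | lia].
have K1L : K1 <= L by rewrite leq_pmulr // expn_gt0 N_gt0.
have lt_W x : x <= Z -> x.+1 < W by exact: (counter_lt Z1 D40 WD).
apply: (@hwp_le _ _ _ (esize (Inp (Lit 0)) + 2 + (for_time n root_time + (asgs_time size_params +
  (for_time (NI * L) 10 + for_time NI (for_time N 100 + kappa * tp N + 200)).+1).+1).+1).+1).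
  by rewrite /prep_time; lia.
apply: hwp_seq; apply: (hwp_asgZ Z1 minpZ WD sm0) => //; first by move=> /=; lia.
rewrite [evalx _ _ _]/= minp0; set h1 := set_var _ _ _.
pose J i h := [/\ small Z h, regs h 0 = n,
  regs h 1 = count (fun i => i.+1 ^ d <= n) (iota 0 i) &
  [/\ forall x, 1 < x < 20 -> regs h x = 0, tape h = coins, forall a y, arrs h a y
    = 0 & out h = [::]]].
have Hroot : hwp W minp root_loop (for_time n root_time) (J n) h1.
  apply: hwp_for => //.
  - exact: lt_W.
  - by move=> i h [].
  - split=> //; first by apply: small_set_var => //; exact: small_set_var.
    split=> //= x lx; rewrite !upd_other //; lia.
  move=> i h li r20 [sm r0 r1 [rz th az oh]].
  set el := Var 1 [+] _.
  have ve : evalx minp h el = count (fun i => i.+1 ^ d <= n) (iota 0 i.+1).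
    rewrite -(addn1 i) iotaD count_cat [evalx _ _ _]/= r0 r1 val_pow /= r20.
    by rewrite add0n addn0 !addn1 ltnS.
  have vZ : evalx minp h el <= Z.
    rewrite ve; have [l1 _ _] := root_upto n i.+1 d_gt0.
    by apply: leq_trans l1 _; exact: leq_trans Zn.
  apply: (@hwp_le _ _ _ (esize el + 2)); first by rewrite /root_time /=; lia.
  apply: (hwp_asgZ Z1 minpZ WD sm).
  - by rewrite /= wfe_pow /= ?/T0; lia.
  - by rewrite /= deg_pow /=; lia.
  rewrite ve; split; first by rewrite /= upd_other.
  split=> //=.
  - apply: small_set_var; last exact: leq_trans Zn.
    by apply: small_set_var => //; rewrite ve in vZ.
  - by split=> // x lx; rewrite !upd_other ?rz //; lia.
apply: hwp_seq; apply: hwp_weak Hroot (leqnn _) _ => h2 [sm2 r0 r1 [rz th az oh]].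
rewrite -[count _ _]/s in r1.
have PR : asgs_ok Z D minp h2 size_params (fun h => small Z h ->
    [/\ small Z h, forall x, x < 13 -> regs h x
      = nth 0 (params_rnd C c n s n1 n2 nb1 nb2 Kh L 0) x,
      tape h = coins & forall a y, arrs h a y = 0]).
  rewrite /size_params /asgs_ok /= /upd /= !val_pow /= !deg_pow !wfe_pow /=; try by rewrite
    /T0; lia.
  rewrite /upd /= r0 r1 (_ : (n1 + 1) * n2 = N) 1?addn1 // mul2n.
  have NLZ : NI * L <= Z by apply: leq_trans NIS; rewrite leq_mul2l; lia.
  have LZ : L <= Z by lia.
  have NZ' : N <= Z by exact: ltnW.
  clear ZB WD.
  do 10 (split; [by rewrite /T0; lia | by lia | by lia |]).
  move=> sm3; split=> // x lx.
  by do 13! [case: x lx => [|x] lx; first by rewrite /= ?r0 ?r1 ?rz].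
apply: hwp_seq; apply: hwp_weak (hwp_asgs Z1 minpZ WD sm2 PR) (leqnn _) _.
move=> h3 [sm3 pr3 th3 az3].
have Kh_gt0 : 0 < Kh by rewrite addn_gt0 s_gt0.
have nb2_gt0 : 0 < nb2 by rewrite addn1.
have sZ : s <= Z by exact: leq_trans Zn.
apply: hwp_seq; apply: hwp_weak (hwp_coins A n_gt0 n1_gt0 n2_gt0 nb2_gt0 Kh_gt0
  budget_le Z1 WD D40 ZB ZN Zn sZ ZK NI_gt0 minp size_coins minpZ sm3 pr3 th3 az3) (leqnn _) _
    => h4 inv4.
apply: hwp_weak (hwp_prep_loop solves n_gt0 n1_gt0 n2_gt0 nb2_gt0 Kh_gt0
  budget_le Z1 WD D40 ZB ZN Zn sZ ZK NI_gt0 size_coins minpZ inv4) (leqnn _) _.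
by move=> h5 [co5 z5 b5 _]; split.
Qed.

End Preparation.

(** * The answers of the reduction *)

Lemma nth_flatten_rows T1 T2 (f : T1 -> T2 -> nat) s t i0 j0 k l :
  k < size s -> l < size t ->
  nth 0 (flatten [seq [seq f i j | j <- t] | i <- s]) (k * size t + l) =
  f (nth i0 s k) (nth j0 t l).
Proof.
move=> + lt; elim: s k => [|i s IH] [|k] //= lk; rewrite nth_cat size_map.
  by rewrite mul0n add0n lt (nth_map j0).
by rewrite mulSn -addnA ltnNge leq_addr /= addKn IH.
Qed.

Lemma nth_mx_code n (M : 'M[bool]_n) (i j : 'I_n) :
  nth 0 (mx_code M) (i * n + j) = M i j.
Proof.
have se : size (enum 'I_n) = n by rewrite size_enum_ord.
have := @nth_flatten_rows _ _ (fun i j => nat_of_bool (M i j)) (enum 'I_n) (enum 'I_n) i j i j.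
by rewrite !nth_ord_enum !se => ->.
Qed.

Lemma nth_cv_code n (v : 'cV[bool]_n) (i : 'I_n) : nth 0 (cv_code v) i = v i ord0.
Proof. by rewrite /cv_code (nth_map i) ?size_enum_ord // nth_ord_enum. Qed.

Lemma nth_cv_code_out n (v : 'cV[bool]_n) i : n <= i -> nth 0 (cv_code v) i = 0.
Proof. by move=> le; rewrite nth_default // size_map size_enum_ord. Qed.

Lemma nth_code_le (s : seq nat) x : all (leq^~ x) s -> forall i, nth 0 s i <= x.
Proof.
move=> H i; have [li|gi] := ltnP i (size s); last by rewrite nth_default.
exact: (all_nthP 0 H).
Qed.

Section Answers.
Variables (A : idm_algorithm) (C c n n1 n2 nb1 nb2 Kh L : nat).
Variables (M : 'M[bool]_n) (v : 'cV[bool]_n) (coins : seq bool).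
Notation K := (Kh.*2).
Notation minp := (n :: mx_code M).
Notation vinp := (cv_code v).
Hypotheses (n1_gt0 : 0 < n1) (n2_gt0 : 0 < n2) (nb2_gt0 : 0 < nb2) (Kh_gt0 : 0 < Kh).
Hypotheses (nb1_large : n <= nb1 * n1) (nb2_large : n <= nb2 * n2).

Notation mx := (block_mx n n1 n2 nb2 Kh minp).
Notation bv := (block_v n2 nb2 Kh vinp).

(** The matrix and the vector are those of copy 0 of the block, which all copies share; only the
    segment of coins varies with [t]. *)
Definition wrong_copy Bk i t : bool :=
  wrong n1 n2 (mx (Bk * K)) A C c L (bv (Bk * K)) i (chunk L coins (Bk * K + t)).

Lemma mx_copy Bk t : t < K -> mx (Bk * K + t) = mx (Bk * K).
Proof.
move=> lt; have K0 : 0 < K by exact: leq_ltn_trans lt.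
by rewrite /block_mx divnMDl // (divn_small lt) addn0 mulnK.
Qed.

Lemma bv_copy Bk t : t < K -> bv (Bk * K + t) = bv (Bk * K).
Proof.
move=> lt; have K0 : 0 < K by exact: leq_ltn_trans lt.
by rewrite /block_v divnMDl // (divn_small lt) addn0 mulnK.
Qed.

Notation bt := (bit A C c n n1 n2 nb2 Kh L coins minp vinp).

Lemma bit_copy Bk i t : t < K -> ~~ wrong_copy Bk i t ->
  bt (Bk * K + t) i = block_answer n2 (mx (Bk * K)) (bv (Bk * K)) i.
Proof.
move=> lt; rewrite /wrong_copy /wrong negbK /bit /ops_upto /inst_state mx_copy // bv_copy //.
case: idm_state => [s0|] //= /eqP[->] /=.
by case: block_answer.
Qed.

(** If fewer than [Kh] of the [2 * Kh] copies err, a true answer gets more than [Kh] votes, and a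
    false one gets votes from erring copies only, hence fewer than [Kh]: ties do not occur. *)
Lemma majority Bk i : \sum_(t < K) wrong_copy Bk i t < Kh ->
  (Kh < \sum_(t < K) bt (Bk * K + t) i) =
  block_answer n2 (mx (Bk * K)) (bv (Bk * K)) i.
Proof.
move=> lw; set ans := block_answer _ _ _ _.
have E (t : 'I_K) : ~~ wrong_copy Bk i t -> bt (Bk * K + t) i = ans.
  exact: bit_copy.
case: ans E => E.
  have H : K <= \sum_(t < K) bt (Bk * K + t) i + \sum_(t < K) wrong_copy Bk i t.
    rewrite -big_split /= -[leqLHS]muln1 -[in leqLHS](card_ord K) -sum_nat_const.
    by apply: leq_sum => t _; case W: wrong_copy; rewrite ?addn1 // E ?W.
  by apply/idP; lia.
apply/negbTE; rewrite -leqNgt; apply: leq_trans (ltnW lw).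
by apply: leq_sum => t _; case W: wrong_copy; [case: bit | rewrite E ?W].
Qed.

Lemma answer_correct :
  (forall Bk i, Bk < nb1 * nb2 -> i < n1 -> \sum_(t < K) wrong_copy Bk i t < Kh) ->
  mkseq (fun i => nat_of_bool (answer A C c n n1 n2 nb2 Kh L coins minp vinp i)) n
  = cv_code (bool_mulmx M v).
Proof.
move=> good; apply: (@eq_from_nth _ 0).
  by rewrite size_mkseq size_map size_enum_ord.
rewrite size_mkseq => i0 li; pose i := Ordinal li.
rewrite nth_mkseq // (nth_cv_code (bool_mulmx M v) i) mxE; congr nat_of_bool.
have lin : i %/ n1 < nb1 by rewrite ltn_divLR // (leq_trans li).
have voteE j : j < nb2 -> (Kh < votes A C c n n1 n2 nb2 Kh L coins minp vinp i j) =
    has (fun k => (nth 0 vinp (j * n2 + k) != 0) &&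
       (nth 0 (mx_code M) (i * n + (j * n2 + k)) != 0)) (iota 0 n2).
  move=> lj; rewrite /votes majority ?good ?ltn_pmod //; last first.
    apply: leq_trans (_ : (i %/ n1).+1 * nb2 <= _); first by rewrite mulSnr ltn_add2l.
    by rewrite leq_mul2r lin orbT.
  rewrite /block_answer /block_v /block_mx mulnK ?double_gt0 //.
  rewrite modnMDl (modn_small lj) divnMDl // (divn_small lj) addn0.
  by apply: eq_has => k; rewrite -divn_eq add1n.
rewrite /answer; apply/hasP/existsP => [[j]|[j /andP[Mij vj]]].
  rewrite mem_iota /= add0n => lj; rewrite voteE // => /hasP[k _ /andP[vk mk]].
  (* A nonzero entry of the vector has index below [n], which discards the matrix entries read past
     the border. *)
  have lk : j * n2 + k < n.
    by rewrite ltnNge; apply: contra vk => le; rewrite nth_cv_code_out.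
  exists (Ordinal lk); move: vk mk.
  rewrite (nth_cv_code v (Ordinal lk)) (nth_mx_code M i (Ordinal lk)).
  by case: (v _ _); case: (M _ _).
exists (j %/ n2).
  by rewrite mem_iota /= add0n ltn_divLR // (leq_trans (ltn_ord j)).
rewrite voteE; last by rewrite ltn_divLR // (leq_trans (ltn_ord j)).
apply/hasP; exists (j %% n2); first by rewrite mem_iota /= add0n ltn_pmod.
by rewrite -divn_eq nth_cv_code nth_mx_code vj Mij.
Qed.

End Answers.

Lemma hwp_run W inp c t Q s h g : hwp W inp c t Q h -> eqv s h -> t <= g ->
  exists s' h' g', [/\ run W inp g [:: c] s = Some (s', g'), g - t <= g',
    eqv s' h' & Q h'].
Proof.
move=> H E lt; have [m [s' [h' [lm ev_m E' q]]]] := H s E.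
exists s', h', (g - m); split=> //; last by lia.
by rewrite -[in LHS](subnKC (leq_trans lm lt)) ev_m run_nil.
Qed.

Lemma eqv_clr s h : eqv s h -> eqv (clr s) (clr h).
Proof. by case. Qed.

(* [J r] is the invariant between the calls, after [r] rounds. *)
Lemma session_rounds W c t n (J : nat -> state -> Prop) (res : seq nat -> seq nat)
    (ok : seq nat -> Prop) :
  (forall r inp h, r < n -> ok inp -> J r h -> out h = [::] ->
     hwp W inp c t (fun h' => J r.+1 h' /\ out h' = res inp) h) ->
  (forall r h, J r h -> J r (clr h)) ->
  forall inps r s h g, r + size inps <= n -> (forall inp, inp \in inps -> ok inp) ->
    eqv s h -> J r h -> size inps * t <= g ->
  exists2 tr, session W g s [seq (c, inp) | inp <- inps] = Some tr &
    unzip1 tr = map res inps.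
Proof.
move=> step J_clr; elim=> [|inp inps IH] r s h g lr oks E Jr lg /=; first by exists [::].
have lrn : r < n by move: lr => /=; lia.
have oki : ok inp by apply: oks; rewrite inE eqxx.
have lt : t <= g by apply: leq_trans lg; rewrite /= mulSn leq_addr.
have [s' [h' [g' [R lg' E' [Jr' oh']]]]] :=
  hwp_run (step r inp (clr h) lrn oki (J_clr _ _ Jr) erefl) (eqv_clr E) lt.
rewrite R.
have lr' : r.+1 + size inps <= n by move: lr => /=; lia.
have oks' inp' : inp' \in inps -> ok inp' by move=> H; apply: oks; rewrite inE H orbT.
have lg'' : size inps * t <= g' by move: lg lg'; rewrite /= mulSn; lia.
have [tr -> Etr] := IH r.+1 s' h' g' lr' oks' E' Jr' lg''.
by eexists; first by []; rewrite /= Etr; case: E' => _ _ _ ->; rewrite oh'.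
Qed.

(** * Error probability of the reduction *)

Lemma for_time_ge x t : (x <= for_time x t)%N.
Proof. by rewrite /for_time; nia. Qed.

Section Reduction.
Variables (A : idm_algorithm) (C c d a b K0 K1 k1 : nat) (tp ti tq : nat -> nat).
Hypothesis solves : solves_idm A C c tp ti tq.
Hypothesis d_gt0 : (0 < d)%N.

Definition reduction : omv_algorithm :=
  OMvAlgorithm (prep_prog A C c d a b K0 K1 k1) (round_prog A).

Variable n : nat.
Hypothesis n_gt0 : (0 < n)%N.
Notation s := (root d n).
Notation n1 := (s ^ a)%N.
Notation n2 := (s ^ b)%N.
Notation nb1 := (n %/ n1 + 1)%N.
Notation nb2 := (n %/ n2 + 1)%N.
Notation Kh := (s + K0)%N.
Notation N := (text_size n1 n2).
Notation K := (Kh.*2).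
Notation L := (K1 * N ^ k1)%N.
Notation S := (C * N ^ c + L + 1)%N.
Notation NI := (nb1 * nb2 * K)%N.
Hypothesis budget_le : (tp N + n2 * ti N + n1 * tq N <= L)%N.
Variables (W Z D T : nat).
Hypotheses (Z1 : (1 < Z)%N) (WD : (Z ^ D < W)%N).
Hypothesis D_large : (40 + 3 * d + a + b + c + k1 <= D)%N.
Hypotheses (ZB : (n.+1 * NI * S <= Z)%N) (ZN : (N < Z)%N) (ZK : (K <= Z)%N).
Hypothesis time_le :
  (prep_time C c d a b K0 K1 k1 tp n + n * round_time ti tq n n1 n2 nb1 nb2 Kh <= T)%N.
Hypothesis union_le : (3 * (n * (nb1 * nb2 * n1)) * 8 ^ Kh <= 9 ^ Kh)%N.
Variables (M : 'M[bool]_n) (vs : n.-tuple 'cV[bool]_n).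
Notation minp := (n :: mx_code M).

Let s_gt0 : (0 < s)%N. Proof. by have [] := rootP d_gt0 n_gt0. Qed.
Let n1_gt0 : (0 < n1)%N. Proof. by rewrite expn_gt0 s_gt0. Qed.
Let n2_gt0 : (0 < n2)%N. Proof. by rewrite expn_gt0 s_gt0. Qed.
Let nb2_gt0 : (0 < nb2)%N. Proof. by rewrite addn1. Qed.
Let Kh_gt0 : (0 < Kh)%N. Proof. by rewrite addn_gt0 s_gt0. Qed.
Let NI_gt0 : (0 < NI)%N. Proof. by rewrite !muln_gt0 !addn1 /= double_gt0. Qed.
Let nb1_large : (n <= nb1 * n1)%N. Proof. by rewrite addn1 ltnW // ltn_ceil. Qed.
Let nb2_large : (n <= nb2 * n2)%N. Proof. by rewrite addn1 ltnW // ltn_ceil. Qed.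

Let Zn : (n <= Z)%N.
Proof.
apply: leq_trans ZB; apply: leq_trans (leqnSn n) _.
by rewrite -mulnA leq_pmulr // muln_gt0 NI_gt0 addn1.
Qed.

Let sZ : (s <= Z)%N.
Proof. by have [_ sn _ _] := rootP d_gt0 n_gt0; exact: leq_trans Zn. Qed.

(** Drawing a coin takes a turn of a loop, so the time bound [T], which is also the length of the
    tape, leaves enough coins. *)
Let coins_le : (NI * L <= T)%N.
Proof.
apply: leq_trans time_le; apply: leq_trans (leq_addr _ _).
have := for_time_ge (NI * L) 10; rewrite /prep_time.
by move: (for_time _ _) (for_time _ _) (for_time _ _) (asgs_time _) => *; lia.
Qed.

Lemma code_le (v : 'cV[bool]_n) i : (nth 0%N (cv_code v) i <= Z)%N.
Proof.
apply: nth_code_le; apply/allP => x /mapP[j _ ->].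
by apply: leq_trans (ltnW Z1); case: (v _ _).
Qed.

Lemma minp_le i : (nth 0%N minp i <= Z)%N.
Proof.
apply: nth_code_le; rewrite /= Zn; apply/allP => x /allpairsP[[k j] [_ _ ->]].
by apply: leq_trans (ltnW Z1); case: (M _ _).
Qed.

Definition answers coins (v : 'cV[bool]_n) :=
  mkseq (fun i => nat_of_bool (answer A C c n n1 n2 nb2 Kh L coins minp (cv_code v) i)) n.

Lemma reduction_session coins : size coins = T ->
  exists2 tr, session W T (init coins) (omv_calls reduction M vs) = Some tr &
    behead (unzip1 tr) = [seq answers coins v | v <- vs].
Proof.
move=> sz; have size_coins : (NI * L <= size coins)%N by rewrite sz.
have lt : (prep_time C c d a b K0 K1 k1 tp n <= T)%N by exact: leq_trans (leq_addr _ _) time_le.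
have [s' [h' [g' [R lg E J0]]]] := hwp_run (hwp_prep (minp := minp) solves d_gt0 n_gt0 budget_le
   Z1 WD D_large ZB ZN ZK size_coins erefl minp_le) (eqv_refl (init coins)) lt.
have -> : session W T (init coins) (omv_calls reduction M vs) =
    if run W minp T [:: prep_prog A C c d a b K0 K1 k1] (init coins) is Some (s', g') then
      omap (cons (out s', T - g')%N)
        (session W g' s' [seq (round_prog A, cv_code v) | v <- vs])
    else None by [].
rewrite R.
have D40 : (40 <= D)%N by lia.
pose J := idle A C c n s n1 n2 nb1 nb2 Kh L Z coins minp.
pose res vinp := mkseq (fun i => nat_of_bool (answer A C c n n1 n2 nb2 Kh L coins minp vinp i)) n.
pose ok vinp := forall i, (nth 0 vinp i <= Z)%N.
have step r inp h : (r < n)%N -> ok inp -> J r h -> out h = [::] ->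
    hwp W inp (round_prog A) (round_time ti tq n n1 n2 nb1 nb2 Kh)
      (fun h' => J r.+1 h' /\ out h' = res inp) h.
  move=> lr oki Jr oh.
  exact: (hwp_round solves n_gt0 n1_gt0 n2_gt0 nb2_gt0 Kh_gt0 budget_le Z1 WD D40 ZB ZN Zn sZ ZK
    NI_gt0 size_coins oki nb1_large lr Jr oh).
have J_clr r h : J r h -> J r (clr h).
  case=> [[sm pr cc io ip] bo ov]; split=> //.
  by move=> e le; apply: (base_ok_eq (bo e le)).
have sv : size [seq cv_code v | v <- vs] = n by rewrite size_map size_tuple.
have oks inp : inp \in [seq cv_code v | v <- vs] -> ok inp.
  by case/mapP => v _ -> i; exact: code_le.
have lg' : (size [seq cv_code v | v <- vs] * round_time ti tq n n1 n2 nb1 nb2 Kh <= g')%N.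
  rewrite sv; apply: leq_trans lg; rewrite leq_subRL //.
have [tr Etr Htr] := session_rounds (r := 0%N) step J_clr (eq_leq sv) oks E J0 lg'.
rewrite -map_comp in Htr.
have -> : [seq (round_prog A, cv_code v) | v <- vs] =
  [seq (round_prog A, inp) | inp <- [seq cv_code v | v <- vs]] by rewrite -map_comp.
rewrite Etr /=; eexists; first by [].
by rewrite /= Htr.
Qed.

(** The event is fixed by a vector, a block and a row of it; neither the round nor earlier answers
    enter. *)
Definition bad_event (x : 'cV[bool]_n * (nat * nat)) coins : bool :=
  (Kh <= \sum_(t < K) wrong_copy A C c n1 n2 nb2 Kh L M x.1 coins x.2.1 x.2.2 t)%N.

Definition events : seq ('cV[bool]_n * (nat * nat)) :=
  [seq (v, p) | v <- vs, p <- [seq (Bk, i) | Bk <- iota 0 (nb1 * nb2), i <- iota 0 n1]].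

Lemma size_events : size events = (n * (nb1 * nb2 * n1))%N.
Proof. by rewrite size_allpairs size_tuple size_allpairs !size_iota. Qed.

Lemma reduction_correct coins : size coins = T ->
  ~~ has (bad_event^~ coins) events ->
  omv_correct M vs (session W T (init coins) (omv_calls reduction M vs)).
Proof.
move=> sz nb; have [tr -> /= ->] := reduction_session sz.
apply/eqP/eq_in_map => v vin; apply: (answer_correct (nb1 := nb1)) => // Bk i lB li.
rewrite ltnNge; apply: contra nb => bad; apply/hasP; exists (v, (Bk, i)) => //.
by apply: allpairs_f => //; apply: allpairs_f; rewrite mem_iota.
Qed.

Local Open Scope ring_scope.

(** The copies of block [Bk] own consecutive segments of [L] coins starting at [Bk * K * L], the
    layout that [majority_error] expects. *)
Lemma bad_event_prob x : x \in events ->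
  Ex T (fun coins => (bad_event x coins)%:R) <= (8 / 9) ^+ Kh.
Proof.
case/allpairsP => [[v p]] /= [_ /allpairsP[[Bk i] /= [+ + ->]] ->].
rewrite !mem_iota /= !add0n => lB li.
have lT : (Bk * K * L + K * L <= T)%N.
  apply: leq_trans coins_le; rewrite -mulnDl leq_mul2r; apply/orP; right.
  by rewrite -mulSnr leq_mul2r lB orbT.
have H := wrong_prob (block_mx n n1 n2 nb2 Kh minp (Bk * K)%N) n1_gt0 n2_gt0 solves budget_le
  (block_v n2 nb2 Kh (cv_code v) (Bk * K)%N) li.
apply: le_trans (majority_error lT H).
apply: Ex_le => r _; rewrite /bad_event /= ler_nat.
by rewrite /wrong_copy /chunk; under eq_bigr do rewrite mulnDl.
Qed.

Lemma reduction_error :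
  Pr (fun r : T.-tuple bool =>
    ~~ omv_correct M vs (session W T (init r) (omv_calls reduction M vs))) <= 1 / 3.
Proof.
rewrite (@Pr_Ex _ _ (fun r => ~~ omv_correct M vs (session W T (init r) (omv_calls reduction M
  vs)))) //.
apply: (@le_trans _ _ (Ex T (fun r => \sum_(x <- events) (bad_event x r)%:R))).
  apply: Ex_le => r sr; rewrite -natr_sum ler_nat.
  apply: (@leq_trans (has (bad_event^~ r) events)).
    by case: (boolP (has _ _)) => [_|/(reduction_correct sr)->] //; case: omv_correct.
  rewrite has_count -sum1_count big_mkcond /=.
  by case: (leqP (\sum_(_ <- _) _)%N 0).
rewrite Ex_sum; apply: (@le_trans _ _ (\sum_(x <- events) (8 / 9) ^+ Kh)).
  by rewrite big_seq [leRHS]big_seq; apply: ler_sum => x /bad_event_prob.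
rewrite big_const_seq count_predT iter_addr addr0 -[_ *+ size events]mulr_natl size_events
  expr_div_n.
rewrite mulrA ler_pdivrMr ?exprn_gt0 //.
by move: union_le; rewrite -(ler_nat rat) !natrM !natrX; lra.
Qed.

End Reduction.

(** * Running time of the reduction *)

Local Open Scope nat_scope.

(** Bernoulli's inequality in the form [(x / (x + 1)) ^ e >= 1 - e / x], cleared of denominators. *)
Lemma bernoulli_nat e x : e <= x -> (x - e) * x.+1 ^ e <= x * x ^ e.
Proof.
elim: e => [|e IH] le; first by rewrite subn0 !expn0.
have {}IH := IH (ltnW le).
have H : (x - e.+1) * x.+1 <= x * (x - e) by nia.
rewrite !expnS mulnA; apply: leq_trans (leq_mul H (leqnn _)) _.
by rewrite -mulnA leq_mul2l IH orbT.
Qed.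

(** Once [m >= 9 * e], Bernoulli's inequality gives [((m + 2) / (m + 1)) ^ e <= 9 / 8], so the claim
    passes from [m] to [m + 1]. Smaller [m] are covered by the constant. *)
Lemma poly_geometric e : exists C, forall m, m.+1 ^ e * 8 ^ m <= C * 9 ^ m.
Proof.
exists ((9 * e).+1 ^ e); elim=> [|m IH].
  by rewrite !muln1 exp1n expn_gt0.
have [lm|gm] := ltnP m.+1 (9 * e).+1.
  by apply: leq_mul; [case: e IH lm => // e IH lm; rewrite leq_exp2r | rewrite leq_exp2r].
have le : e <= m.+1 by lia.
have H : 8 * m.+2 ^ e <= 9 * m.+1 ^ e.
  have B := bernoulli_nat le.
  rewrite -(leq_pmul2l (ltn0Sn m)).
  have : 8 * m.+1 <= 9 * (m.+1 - e) by lia.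
  move=> /(leq_mul (leqnn (m.+2 ^ e))).
  by move: B; move: (m.+2 ^ e) (m.+1 ^ e) (m.+1 - e) => X Y z; nia.
rewrite !expnS; move: IH H.
by move: (m.+2 ^ e) (m.+1 ^ e) (8 ^ m) (9 ^ m) ((9 * e).+1 ^ e) => x y z w v; nia.
Qed.

(** The previous bound is used with exponent [e + 1]: the additional factor [m + 1], with
    [m = s + k * C], absorbs the constant [k * C], which is therefore taken as [K0]. *)
Lemma poly_lt_geometric e k : exists K0, forall s, k * s.+1 ^ e * 8 ^ (s + K0) <= 9 ^ (s + K0).
Proof.
have [C HC] := poly_geometric e.+1; exists (k * C) => s.
set m := s + k * C; have := HC m; rewrite expnS => H.
have ls : s.+1 ^ e <= m.+1 ^ e.
  by case: (e) => // e'; rewrite leq_exp2r // ltnS leq_addr.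
have lm : k * C <= m.+1 by rewrite leqW // leq_addl.
have m0 : 0 < m.+1 by [].
rewrite -(leq_pmul2l m0).
apply: (@leq_trans (k * (m.+1 * m.+1 ^ e * 8 ^ m))).
  rewrite (_ : m.+1 * (k * s.+1 ^ e * 8 ^ m) = k * (m.+1 * s.+1 ^ e * 8 ^ m)); last by lia.
  by rewrite !leq_mul.
by apply: leq_trans (leq_mul (leqnn k) H) _; rewrite mulnA leq_mul2r lm orbT.
Qed.

Lemma add_scaled_le u v n x y : x <= u * n ^ 3 -> y <= v * n ^ 2 ->
  x + n * y <= (u + v) * n ^ 3.
Proof.
move=> lx ly; rewrite mulnDl leq_add //.
by apply: leq_trans (leq_mul (leqnn n) ly) _; rewrite mulnCA -expnS.
Qed.

(** * Counting the steps against the cube of n *)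

Section Counting.
Variables (tp ti tq : nat -> nat) (C c a b Kp k Ci Cq : nat).
Notation q := (a + b).
Definition sN s := text_size (s ^ a) (s ^ b).
Hypotheses (a2 : 2 <= a) (b2 : 2 <= b).
Hypotheses (tp_le : forall m, 0 < m -> tp m <= Kp * m ^ k).
Hypotheses (ti_gt0 : forall m, 0 < m -> 0 < ti m) (tq_gt0 : forall m, 0 < m -> 0 < tq m).
Hypotheses (ti_le : forall s, 0 < s -> s ^ b * ti (sN s) * s ^ 2 <= Ci * s ^ q).
Hypotheses (tq_le : forall s, 0 < s -> s ^ a * tq (sN s) * s ^ 2 <= Cq * s ^ q).

(** With [k1 >= 1], [N ^ k1] is at least [N >= s ^ q], so that [L] also bounds the insertions and
    queries of one instance. The last unit of [K1] makes it positive, whence [N <= L]: loading a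
    text is charged to [L] too. *)
Let k1 := k.+1.
Let K1 := Kp + Ci + Cq + 1.
(** Preprocessing takes about [NI * L] steps, that is [O(n ^ 2 * s * s ^ (q * k1))]; for a gain of
    [s] over [n ^ 3] this asks that [s ^ (q * k1 + 2) <= n]. The sides of a block and [s ^ q] are at
    most [n] as well, since [q <= d]. *)
Let d := q * k1 + q + 2.

Lemma expn_le_root n s e : 0 < s -> e <= d -> s ^ d <= n -> s ^ e <= n.
Proof. by move=> s0 le; apply: leq_trans; rewrite leq_pexp2l. Qed.

Lemma sN_gt0 s : 0 < s -> 0 < sN s.
Proof. by move=> s0; rewrite /sN text_size_gt0 // expn_gt0 s0. Qed.

Lemma sN_ge s : s ^ q <= sN s.
Proof. by rewrite /sN /text_size expnD leq_mul. Qed.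

Lemma sN_le s : 0 < s -> sN s <= 2 * s ^ q.
Proof.
move=> s0; rewrite /sN /text_size expnD mulnA leq_mul //.
by rewrite mul2n -addnn -addn1 leq_add2l expn_gt0 s0.
Qed.

Lemma budget s : 0 < s ->
  tp (sN s) + s ^ b * ti (sN s) + s ^ a * tq (sN s) <= K1 * sN s ^ k1.
Proof.
move=> s0; have N0 := sN_gt0 s0; have s2 : 0 < s ^ 2 by rewrite expn_gt0 s0.
have H x y : x * s ^ 2 <= y * s ^ q -> x <= y * sN s ^ k1.
  move=> H; apply: leq_trans (leq_pmulr _ s2) _; apply: leq_trans H _.
  rewrite leq_mul2l; apply/orP; right; apply: leq_trans (sN_ge s) _.
  by rewrite /k1 expnS leq_pmulr // expn_gt0 N0.
have H1 := H _ _ (ti_le s0); have H2 := H _ _ (tq_le s0).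
have H3 : tp (sN s) <= Kp * sN s ^ k1.
  by apply: leq_trans (tp_le N0) _; rewrite leq_mul2l /k1 leq_pexp2l ?orbT.
by rewrite /K1 !mulnDl; lia.
Qed.

Variable K0 : nat.
Variable n : nat.
Hypothesis n_gt0 : 0 < n.
Notation s := (root d n).
Notation n1 := (s ^ a).
Notation n2 := (s ^ b).
Notation nb1 := (n %/ n1 + 1).
Notation nb2 := (n %/ n2 + 1).
Notation Kh := (s + K0).
Notation N := (sN s).
Notation K := (Kh.*2).
Notation L := (K1 * N ^ k1).
Notation S := (C * N ^ c + L + 1).
Notation NI := (nb1 * nb2 * K).

Let d_gt0 : 0 < d. Proof. by rewrite /d; lia. Qed.
Let s_gt0 : 0 < s. Proof. by have [] := rootP d_gt0 n_gt0. Qed.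
Let s_le : s <= n. Proof. by have [] := rootP d_gt0 n_gt0. Qed.
Let sd_le : s ^ d <= n. Proof. by have [] := rootP d_gt0 n_gt0. Qed.

Lemma pow_le e : e <= d -> s ^ e <= n.
Proof. by move=> le; exact: expn_le_root s_gt0 le sd_le. Qed.

Let n1_gt0 : 0 < n1. Proof. by rewrite expn_gt0 s_gt0. Qed.
Let n2_gt0 : 0 < n2. Proof. by rewrite expn_gt0 s_gt0. Qed.

Let n1_le : n1 <= n. Proof. by apply: pow_le; rewrite /d; lia. Qed.
Let n2_le : n2 <= n. Proof. by apply: pow_le; rewrite /d; lia. Qed.

Let nb1_le : nb1 * n1 <= 2 * n.
Proof. by rewrite mulnDl mul1n mul2n -addnn leq_add ?n1_le // leq_trunc_div. Qed.
Let nb2_le : nb2 * n2 <= 2 * n.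
Proof. by rewrite mulnDl mul1n mul2n -addnn leq_add // leq_trunc_div. Qed.

Let K_le : K <= 2 * K0.+1 * s.
Proof. by rewrite -mul2n -mulnA leq_mul2l /= mulSn leq_add2l leq_pmulr. Qed.

Let N_le : N <= 2 * n.
Proof.
apply: leq_trans (sN_le s_gt0) _; rewrite leq_mul2l /=.
by apply: pow_le; rewrite /d; lia.
Qed.

(** There are [n * (nb1 * nb2 * n1) <= 4 * n ^ 3] events, from [nb1 * n1 <= 2 * n] and
    [nb2 <= 2 * n]; the factor 3 comes from the target [1 / 3]. The inequality [n < s.+1 ^ d] turns
    [n ^ 3] into a polynomial in [s]. *)
Lemma union_bound : (forall s, 12 * s.+1 ^ (3 * d) * 8 ^ (s + K0) <= 9 ^ (s + K0)) ->
  3 * (n * (nb1 * nb2 * n1)) * 8 ^ Kh <= 9 ^ Kh.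
Proof.
move=> /(_ s); apply: leq_trans; rewrite leq_mul2r; apply/orP; right.
have [_ _ _ lt] := rootP d_gt0 n_gt0.
have H : nb2 <= 2 * n by apply: leq_trans nb2_le; rewrite leq_pmulr.
apply: (@leq_trans (12 * n ^ 3)).
  have := leq_mul nb1_le H; rewrite !expnS expn0.
  by move: (n %/ n1 + 1) (n %/ n2 + 1) (s ^ a) => x y z; nia.
rewrite leq_mul2l /= mulnC expnM leq_exp2r //; exact: ltnW.
Qed.

(** The factor 16 collects [n.+1 <= 2 * n], [nb1 <= 2 * n], [nb2 <= 2 * n] and [K <= 2 * K0.+1 * n];
    the parenthesis bounds [S] through [N <= 2 * n]. Adding 3 gives [3 * n <= bigZ], hence
    [N < bigZ]. *)
Definition Zc := 16 * K0.+1 * (C * 2 ^ c + K1 * 2 ^ k1 + 1) + 3.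
Definition ze := c + k1 + 4.
Definition bigZ := Zc * n ^ ze.

Lemma window_bound : n.+1 * NI * S <= bigZ.
Proof.
have nn e : 0 < n ^ e by rewrite expn_gt0 n_gt0.
have HN e f : N ^ e * n ^ f <= 2 ^ e * n ^ (e + f).
  rewrite expnD mulnA leq_mul2r -expnMn; apply/orP; right.
  by case: (e) => // e'; rewrite leq_exp2r.
have HS X : C * N ^ c + X * N ^ k1 + 1 <= (C * 2 ^ c + X * 2 ^ k1 + 1) * n ^ (c + k1).
  rewrite !mulnDl; apply: leq_add; last by rewrite mul1n.
  apply: leq_add; rewrite -!mulnA leq_mul2l; apply/orP; right.
    apply: leq_trans (HN c k1); exact: leq_pmulr.
  apply: leq_trans (_ : _ <= 2 ^ k1 * n ^ (k1 + c)) _; last by rewrite addnC.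
  apply: leq_trans (HN k1 c); exact: leq_pmulr.
have H1 : nb1 <= 2 * n by apply: leq_trans nb1_le; rewrite leq_pmulr.
have H2 : nb2 <= 2 * n by apply: leq_trans nb2_le; rewrite leq_pmulr.
have HK : K <= 2 * K0.+1 * n by apply: leq_trans K_le _; rewrite leq_mul2l s_le orbT.
have HI : n.+1 * NI <= 16 * K0.+1 * n ^ 4.
  have := leq_mul (leq_mul H1 H2) HK; rewrite !expnS expn0.
  by move: NI => x; nia.
apply: leq_trans (leq_mul HI (HS K1)) _.
rewrite /bigZ /Zc [leqRHS]mulnDl -[leqLHS]addn0 leq_add //.
by rewrite /ze (expnD n (c + k1) 4) mulnACA [n ^ 4 * _]mulnC.
Qed.

Lemma bigZ_ge : 3 * n <= bigZ.
Proof.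
apply: leq_mul; first by rewrite /Zc leq_addl.
by rewrite -{1}(expn1 n) leq_pexp2l // /ze; lia.
Qed.

Lemma bigZ_N : N < bigZ.
Proof. by apply: leq_trans bigZ_ge; lia. Qed.

Lemma bigZ_K : K <= bigZ.
Proof.
apply: leq_trans window_bound; rewrite -mulnA mulnCA.
apply: leq_trans (_ : nb1 * nb2 * K * 1 <= _).
  by rewrite muln1 leq_pmull // muln_gt0 !addn1.
by rewrite leq_mul2l muln_gt0 !addn1 orbT.
Qed.

Lemma bigZ_gt1 : 1 < bigZ.
Proof. by apply: leq_trans bigZ_ge; lia. Qed.

Lemma sN_pow_le e : N ^ e <= 2 ^ e * s ^ (q * e).
Proof.
rewrite expnM -expnMn; case: e => // e; rewrite leq_exp2r //; exact: sN_le.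
Qed.

(** The blocks have total area at most [4 * n ^ 2], rounding at the borders included, and each one
    occurs in [K <= 2 * K0.+1 * s] copies. *)
Lemma NI_sq : NI * s ^ q <= 8 * K0.+1 * n ^ 2 * s.
Proof.
have := leq_mul (leq_mul nb1_le nb2_le) K_le; rewrite expnD !expnS expn0.
by move: (n %/ n1 + 1) (n %/ n2 + 1) (s ^ a) (s ^ b) => x y z w; nia.
Qed.

Lemma prep_bound : NI * L * s <= 8 * K0.+1 * K1 * 2 ^ k1 * n ^ 3.
Proof.
have H0 : NI <= 8 * K0.+1 * n ^ 2 * s.
  by apply: leq_trans NI_sq; rewrite leq_pmulr // expn_gt0 s_gt0.
apply: leq_trans (_ : 8 * K0.+1 * n ^ 2 * s * (K1 * (2 ^ k1 * s ^ (q * k1))) * s <= _).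
  by rewrite leq_mul2r; apply/orP; right; rewrite leq_mul // leq_mul2l sN_pow_le orbT.
have H : s ^ (q * k1) * s * s <= n.
  by rewrite -!expnSr; apply: pow_le; rewrite /d; lia.
move: H; rewrite [n ^ 3]expnS.
by move: (s ^ (q * k1)) (2 ^ k1) (n ^ 2) => x y z; nia.
Qed.

(** A copy of a block of [s ^ q] entries costs at most [(Ci + Cq) * s ^ (q - 2)] per vector. One
    factor [s] is spent on the copies, so a round takes [O(n ^ 2 / s)] steps for its operations. *)
Lemma work_bound :
  NI * (n2 * ti N + n1 * tq N) * s <= 8 * K0.+1 * (Ci + Cq) * n ^ 2.
Proof.
have H := leq_add (ti_le s_gt0) (tq_le s_gt0).
rewrite -!mulnDl in H.
rewrite -(leq_pmul2r s_gt0).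
have H2 := leq_mul (leqnn NI) H.
rewrite -mulnA mulnn -[_ * _ * s ^ 2]mulnA; apply: leq_trans H2 _.
have := leq_mul (leqnn (Ci + Cq)) NI_sq.
by move: NI (s ^ q) (n ^ 2) => x y z; nia.
Qed.

(** This is where [b >= 2] matters: of the factor [s * s <= n2], one half pays for the copies and
    the other is the gain. *)
Lemma output_bound : n * (nb2 * K) * s <= 4 * K0.+1 * n ^ 2.
Proof.
have s2 : s * s <= n2 by rewrite mulnn leq_pexp2l.
have := leq_mul (leqnn (2 * K0.+1 * n)) (leq_trans (leq_mul (leqnn nb2) s2) nb2_le).
have := leq_mul (leqnn (n * nb2 * s)) K_le.
rewrite !expnS expn0.
by move: (n %/ n2 + 1) K => x y; nia.
Qed.

Let X := n2 * ti N + n1 * tq N.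

Lemma prep_time_le : prep_time C c d a b K0 K1 k1 tp n <=
  (asgs_time (size_params C c a b K0 K1 k1) + root_time d + 200) * n
  + (kappa + 390) * (NI * L).
Proof.
have N0 : 0 < N by exact: sN_gt0.
have NL : N <= L.
  by rewrite /k1 expnS mulnCA leq_pmulr // muln_gt0 expn_gt0 N0 /K1 addn1.
have TL : tp N <= L.
  by apply: leq_trans (budget s_gt0); rewrite -addnA leq_addr.
rewrite /prep_time /for_time -/(sN s) [esize _]/=.
have L0 : 0 < L by exact: leq_trans NL.
move: NL TL L0 n_gt0; move: N L (tp N) NI (asgs_time _) (root_time _) => y l x i u r.
move=> h1 h2 h3 h4.
have E1 : i * (y * (100 + 20) + 20 + kappa * x + 200 + 20) <= i * (l * (kappa + 360)).
  rewrite leq_mul2l; apply/orP; right.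
  by have := leq_mul (leqnn kappa) h2; lia.
have E2 : u + r + 200 <= (u + r + 200) * n by exact: leq_pmulr.
by move: E1; nia.
Qed.

(** As [ti N] and [tq N] are positive, the constant overhead of each turn of the loops is charged to
    the budget of an operation. *)
Lemma round_time_le : round_time ti tq n n1 n2 nb1 nb2 Kh <=
  (kappa + 280) * (NI * X) + 220 * (n * (nb2 * K)) + 60.
Proof.
have N0 : 0 < N by exact: sN_gt0.
have H1 := ti_gt0 N0; have H2 := tq_gt0 N0.
have K0' : 0 < K by rewrite double_gt0 addn_gt0 s_gt0.
have B0 : 0 < nb2 by rewrite addn1.
rewrite /round_time /for_time -/(sN s) /X.
move: H1 H2 K0' B0 n1_gt0 n2_gt0.
move: (ti N) (tq N) (s ^ a) (s ^ b) => t u x y.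
move: (n %/ x + 1) (n %/ y + 1) K => i j k' h1 h2 h3 h4 h5 h6.
have E1 : i * j * k' * (y * (kappa * t + 100 + 20) + 20 + (x * (kappa * u + 100 + 20) + 20) +
  100 + 20)
   <= i * j * k' * ((kappa + 280) * (y * t + x * u)).
  rewrite leq_mul2l; apply/orP; right.
  have G1 : y <= y * t by exact: leq_pmulr.
  have G2 : x <= x * u by exact: leq_pmulr.
  move: kappa => ka; lia.
have E2 : j * (k' * (60 + 20) + 20 + 40 + 20) + 20 + 20 + 20 <= 220 * (j * k').
  have G1 : j <= j * k' by exact: leq_pmulr.
  lia.
have := leq_mul (leqnn n) E2; lia.
Qed.

Definition Ct := asgs_time (size_params C c a b K0 K1 k1) + root_time d + 200
  + (kappa + 390) * (8 * K0.+1 * K1 * 2 ^ k1)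
  + ((kappa + 280) * (8 * K0.+1 * (Ci + Cq)) + 220 * (4 * K0.+1) + 60).

Lemma total_time_le : (prep_time C c d a b K0 K1 k1 tp n +
  n * round_time ti tq n n1 n2 nb1 nb2 Kh) * s <= Ct * n ^ 3.
Proof.
have P1 := leq_mul prep_time_le (leqnn s).
have P2 := leq_mul round_time_le (leqnn s).
rewrite mulnDl.
have ns : n * s <= n ^ 3.
  by rewrite !expnS expn0 muln1 leq_mul // (leq_trans s_le) // leq_pmulr.
have sn2 : s <= n ^ 2 by apply: leq_trans s_le _; rewrite expnS leq_pmulr // expn_gt0 n_gt0.
have Q1 : prep_time C c d a b K0 K1 k1 tp n * s <=
   (asgs_time (size_params C c a b K0 K1 k1) + root_time d + 200 +
    (kappa + 390) * (8 * K0.+1 * K1 * 2 ^ k1)) * n ^ 3.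
  apply: leq_trans P1 _; rewrite [leqLHS]mulnDl [leqRHS]mulnDl leq_add //.
    by rewrite -[leqLHS]mulnA leq_mul2l ns orbT.
  by rewrite -[leqLHS]mulnA -[leqRHS]mulnA leq_mul2l prep_bound orbT.
have Q2 : round_time ti tq n n1 n2 nb1 nb2 Kh * s <=
   ((kappa + 280) * (8 * K0.+1 * (Ci + Cq)) + 220 * (4 * K0.+1) + 60) * n ^ 2.
  apply: leq_trans P2 _; rewrite [leqLHS]mulnDl [leqRHS]mulnDl.
  apply: leq_add; last by rewrite leq_mul2l sn2 orbT.
  rewrite [leqLHS]mulnDl [leqRHS]mulnDl.
  apply: leq_add; rewrite -[leqLHS]mulnA -[leqRHS]mulnA leq_mul2l; apply/orP; right.
    exact: work_bound.
  exact: output_bound.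
by rewrite -mulnA; exact: add_scaled_le Q1 Q2.
Qed.

End Counting.

(** * Choice of the exponents *)

Local Open Scope ring_scope.

(** Since [m ^ a > 0] for [m >= 1], the finitely many arguments below the threshold are absorbed by
    enlarging the constant, by induction on the threshold. *)
Lemma bigO_bound (R : realType) (t : nat -> nat) (a : R) : time_bigO t a ->
  exists K : nat, forall m, (0 < m)%N -> (t m)%:R <= K%:R * m%:R `^ a.
Proof.
move=> /eqO_exP[k k0 [N0 _ H]].
have pos m : (0 < m)%N -> 0 < m%:R `^ a by move=> m0; rewrite powR_gt0 // ltr0n.
have [K1 HK1] : exists K1 : nat, forall m, (0 < m < N0)%N -> (t m)%:R <= K1%:R * m%:R `^ a.
  elim: (N0) => [|M [K1 IH]]; first by exists 0%N => m; lia.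
  exists (K1 + (Num.truncn ((t M)%:R / M%:R `^ a)).+1)%N => m /andP[m0].
  rewrite ltnS leq_eqVlt => /orP[/eqP Em|lm].
    rewrite Em in m0 *; rewrite -ler_pdivrMr ?pos //.
    apply: (@le_trans _ _ (Num.truncn ((t M)%:R / M%:R `^ a)).+1%:R);
      last by rewrite ler_nat leq_addl.
    by rewrite ltW // truncnS_gt.
  apply: le_trans (IH m _) _; first by rewrite m0.
  by rewrite ler_pM2r ?pos // ler_nat leq_addr.
exists (K1 + (Num.truncn k).+1)%N => m m0.
have [lm|gm] := ltnP m N0.
  apply: le_trans (HK1 m _) _; first by rewrite m0.
  by rewrite ler_pM2r ?pos // ler_nat leq_addr.
have := H m gm; rewrite /= ger0_norm // (ger0_norm (ltW (pos m m0))) => /le_trans; apply.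
rewrite ler_pM2r ?pos //; apply: (@le_trans _ _ (Num.truncn k).+1%:R).
  by rewrite ltW // truncnS_gt.
by rewrite ler_nat leq_addl.
Qed.

(** For [a < 0] the right-hand side would tend to 0. Applied to operation times, which are at least
    1, this gives [alpha >= 0] and [beta >= 0], and then both are at most 1. *)
Lemma powR_ge1_bounded (R : realType) (a : R) (K : nat) :
  (forall m, (0 < m)%N -> 1 <= K%:R * m%:R `^ a) -> 0 <= a.
Proof.
move=> H; rewrite leNgt; apply/negP => a0.
have na : 0 < - a by rewrite oppr_gt0.
(* Beyond this point [m ^ (- a)] exceeds [K + 1], so [K * m ^ a < 1]. *)
pose x : R := (K%:R + 1) `^ (- a)^-1.
have K1 : 0 < K%:R + 1 :> R by rewrite ltr_wpDl.
pose m := (Num.truncn x).+1.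
have xm : x < m%:R by rewrite truncnS_gt.
have x0 : 0 < x by rewrite powR_gt0.
have L : (K%:R + 1) < m%:R `^ (- a).
  have -> : K%:R + 1 = x `^ (- a).
    by rewrite /x -powRrM mulVf ?gt_eqF // powRr1 // ltW.
  by rewrite gt0_ltr_powR // ?nnegrE ltW // (lt_trans x0).
have := H m isT; rewrite -(opprK a) powRN ler_pdivlMr ?powR_gt0 ?ltr0n // mul1r => L2.
by move: (lt_le_trans L L2); rewrite ltNge lerDl ler01.
Qed.

(** The factor 2 comes from [(2 * s ^ q) ^ x <= 2 * s ^ (q * x)], valid as [x <= 1]; monotonicity in
    the text length uses [x >= 0]. The exponents then add up to at most [q]. *)
Lemma power_work_bound (R : realType) (t : nat -> nat) (x : R) (K e q : nat) :
  (forall m, (0 < m)%N -> (t m)%:R <= K%:R * m%:R `^ x) -> 0 <= x <= 1 ->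
  e%:R + q%:R * x + 2 <= q%:R ->
  forall s m, (0 < s)%N -> (0 < m <= 2 * s ^ q)%N ->
  (s ^ e * t m * s ^ 2 <= 2 * K * s ^ q)%N.
Proof.
move=> ht /andP[x0 x1] he s m s0 /andP[m0 lm].
have sR : 1 <= s%:R :> R by rewrite ler1n.
have s0R : 0 < s%:R :> R by rewrite ltr0n.
rewrite -(ler_nat R) !natrM !natrX.
have H1 : (t m)%:R <= K%:R * (2 * s%:R `^ (q%:R * x)).
  apply: le_trans (ht m m0) _; rewrite ler_wpM2l //.
  apply: (@le_trans _ _ ((2 * s ^ q)%N%:R `^ x)).
    by rewrite ge0_ler_powR ?nnegrE ?ler_nat.
  rewrite natrM natrX powRM ?exprn_ge0 // -powR_mulrn // -powRrM ler_wpM2r ?powR_ge0 //.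
  by rewrite -[leRHS]powRr1 // ler_powR // ler1n.
have H2 : s%:R ^+ e * s%:R `^ (q%:R * x) * s%:R ^+ 2 <= s%:R ^+ q :> R.
  rewrite -!powR_mulrn // -!powRD ?(gt_eqF s0R) ?implybT //.
  by rewrite ler_powR.
apply: (@le_trans _ _ (2 * K%:R * (s%:R ^+ e * s%:R `^ (q%:R * x) * s%:R ^+ 2))); last first.
  by rewrite ler_wpM2l // mulr_ge0.
rewrite (_ : 2 * _ * _ = s%:R ^+ e * (K%:R * (2 * s%:R `^ (q%:R * x))) * s%:R ^+ 2); last by ring.
by rewrite -expr2 ler_pM2r ?exprn_gt0 // ler_pM2l ?exprn_gt0.
Qed.

(** From [n < (s + 1) ^ d <= (2 * s) ^ d] follows [n ^ (1 / d) <= 2 * s]: dividing by the integer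
    root loses only a factor 2. *)
Lemma root_time_bigO (R : realType) (Ct d : nat) : (0 < d)%N ->
  time_bigO (fun n => (Ct * n ^ 3) %/ root d n)%N (3 - (d%:R)^-1 : R).
Proof.
move=> d0; apply/eqO_exP; exists (2 * Ct%:R + 1); first by rewrite ltr_wpDl // mulr_ge0.
exists 1%N => // n /= n0.
have [s0 sn sd ds] := rootP d0 n0; set s := root d n in s0 sn sd ds *.
have nR : 0 < n%:R :> R by rewrite ltr0n.
have sR : 0 < s%:R :> R by rewrite ltr0n.
rewrite ger0_norm // ger0_norm ?powR_ge0 //.
have H1 : n%:R `^ d%:R^-1 <= 2 * s%:R :> R.
  have L : n%:R <= (2 * s%:R) `^ d%:R :> R.
    rewrite powR_mulrn ?mulr_ge0 // -natrM -natrX ler_nat ltnW //.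
    by apply: leq_trans ds _; rewrite leq_exp2r // mul2n -addnn -addn1 leq_add2l.
  have := @ge0_ler_powR R d%:R^-1 _ _ _ _ _ L.
  rewrite -powRrM divff ?pnatr_eq0 -?lt0n // powRr1 ?mulr_ge0 //.
  by apply; rewrite ?nnegrE ?invr_ge0 ?powR_ge0.
have H2 : ((Ct * n ^ 3) %/ s)%N%:R * s%:R <= Ct%:R * n%:R ^+ 3 :> R.
  by rewrite -natrX -!natrM ler_nat leq_trunc_div.
have P : 0 < n%:R `^ d%:R^-1 :> R by rewrite powR_gt0.
have -> : n%:R `^ (3 - d%:R^-1) = n%:R ^+ 3 / n%:R `^ d%:R^-1 :> R.
  by rewrite powRB ?(gt_eqF nR) ?implybT // (powR_mulrn 3).
rewrite mulrA ler_pdivlMr //.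
apply: (@le_trans _ _ (((Ct * n ^ 3) %/ s)%N%:R * (2 * s%:R))); first by rewrite ler_wpM2l.
rewrite mulrCA; apply: (@le_trans _ _ (2 * (Ct%:R * n%:R ^+ 3))); first by rewrite ler_pM2l.
by rewrite mulrA ler_wpM2r ?exprn_ge0 // lerDl.
Qed.

(** The budgets bound a session with one insertion and one query on a constant text, and each of
    these calls takes at least one step. *)
Lemma idm_time_gt0 A C c tp ti tq : solves_idm A C c tp ti tq ->
  forall m, (0 < m)%N -> (0 < ti m)%N /\ (0 < tq m)%N.
Proof.
move=> sol m m0.
have fr : is_fragment m (1, 1)%N by rewrite /is_fragment m0.
have va : all (op_valid m) [:: Insert (1, 1)%N] by rewrite /= fr.
have al : all (fun a => a < m)%N (nseq m 0%N) by rewrite all_nseq m0 orbT.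
have := sol (nseq m 0%N) [::] [:: Insert (1, 1)]%N (1, 1)%N.
cbv zeta; rewrite size_nseq => /(_ m0 al isT isT va fr) [+ _].
set l := sumn _ => H; have [tr E] := H [tuple of nseq l false].
have := session_step_gt0 E.
by case: (unzip2 tr) => [|x [|y [|z [|? ?]]]] /=; lia.
Qed.

Theorem theorem8 (R : realType) :
  OMv_conjecture R ->
  ~ exists (A : idm_algorithm) (C c k : nat) (tp ti tq : nat -> nat)
      (alpha beta eps : R),
      [/\ 0 < eps, alpha + beta = 1 - eps & solves_idm A C c tp ti tq] /\
      [/\ time_bigO tp (k%:R : R), time_bigO ti alpha & time_bigO tq beta].
Proof.
move=> conj [A [C [c [k [tp [ti [tq [alpha [beta [eps]]]]]]]]]].
move=> [[eps0 ab sol] [Op Oi Oq]].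
have [Kp Hp] := bigO_bound Op; have [Ki Hi] := bigO_bound Oi.
have [Kq Hq] := bigO_bound Oq.
have tp_le m : (0 < m)%N -> (tp m <= Kp * m ^ k)%N.
  by move=> /Hp; rewrite powR_mulrn // -natrX -natrM ler_nat.
have pos := idm_time_gt0 sol.
have ti_gt0 m (m0 : (0 < m)%N) : (0 < ti m)%N := (pos m m0).1.
have tq_gt0 m (m0 : (0 < m)%N) : (0 < tq m)%N := (pos m m0).2.
have al0 : 0 <= alpha.
  by apply: (@powR_ge1_bounded _ _ Ki) => m m0; apply: le_trans (Hi m m0); rewrite ler1n ti_gt0.
have be0 : 0 <= beta.
  by apply: (@powR_ge1_bounded _ _ Kq) => m m0; apply: le_trans (Hq m m0); rewrite ler1n tq_gt0.
(* Of the 5 units in [q * eps], two provide the margin [s ^ 2] for insertions, two the margin for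
   queries, and one absorbs the rounding of [q * alpha] to an integer. *)
pose q := (Num.truncn (5 / eps)).+1.
have qe : 5 <= q%:R * eps by rewrite -ler_pdivrMr // ltW // truncnS_gt.
pose u := (Num.truncn (q%:R * alpha)).+1.
have u_gt : q%:R * alpha <= u%:R by rewrite ltW // truncnS_gt.
have u_le : u%:R <= q%:R * alpha + 1.
  by rewrite /u -natr1 lerD2r truncn_le mulr_ge0.
have qb0 : 0 <= q%:R * beta by rewrite mulr_ge0.
have qab : q%:R * alpha + q%:R * beta = q%:R - q%:R * eps.
  by rewrite -mulrDr ab mulrBr mulr1.
have aq : (u + 4 <= q)%N by rewrite -(ler_nat R) natrD; lra.
(* As [a >= q * alpha + 2], the [s ^ b] insertions of a block cost [O(s ^ (b + q * alpha))], within
   [O(s ^ (q - 2))]; and [b >= q * beta + 2] does the same for its [s ^ a] queries. *)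
pose a := (u + 2)%N; pose b := (q - a)%N.
have abq : (a + b = q)%N by rewrite /b subnKC // /a; lia.
have a2 : (2 <= a)%N by rewrite /a; lia.
have b2 : (2 <= b)%N by rewrite /b /a; lia.
have aR : a%:R = u%:R + 2 :> R by rewrite /a natrD.
have bR : b%:R = q%:R - a%:R :> R by rewrite -abq natrD addrC addKr.
have al1 : alpha <= 1 by lra.
have be1 : beta <= 1 by lra.
have ti_le s : (0 < s)%N -> (s ^ b * ti (sN a b s) * s ^ 2 <= 2 * Ki * s ^ (a + b))%N.
  move=> s0; rewrite abq; apply: (power_work_bound Hi) => //; first by rewrite al0.
    by lra.
  by rewrite sN_gt0 // -abq sN_le.
have tq_le s : (0 < s)%N -> (s ^ a * tq (sN a b s) * s ^ 2 <= 2 * Kq * s ^ (a + b))%N.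
  move=> s0; rewrite abq; apply: (power_work_bound Hq) => //; first by rewrite be0.
    by lra.
  by rewrite sN_gt0 // -abq sN_le.
pose k1 := k.+1; pose K1 := (Kp + 2 * Ki + 2 * Kq + 1)%N.
pose d := ((a + b) * k1 + (a + b) + 2)%N.
have d0 : (0 < d)%N by rewrite /d addn2.
have [K0 HK0] := poly_lt_geometric (3 * d) 12.
pose D := (40 + 3 * d + a + b + c + k1)%N.
pose Z0 := Zc C c Kp k (2 * Ki) (2 * Kq) K0.
(* By [total_time_le] the running time multiplied by the root is at most [Ct * n ^ 3]. *)
pose T n := ((Ct C c a b Kp k (2 * Ki) (2 * Kq) K0 * n ^ 3) %/ root d n)%N.
apply: (conj d%:R^-1); first by rewrite invr_gt0 ltr0n.
(* The word bound is [Z ^ D.+1], again of the form [C * n ^ c]; the exponent [D.+1] makes it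
   strictly larger than [Z ^ D]. *)
exists (reduction A C c d a b K0 K1 k1), (Z0 ^ D.+1)%N, (ze c k * D.+1)%N, T.
split; last exact: root_time_bigO.
move=> n M vs n0; cbv zeta.
have -> : (Z0 ^ D.+1 * n ^ (ze c k * D.+1) = bigZ C c Kp k (2 * Ki) (2 * Kq) K0 n ^ D.+1)%N.
  by rewrite expnM -expnMn.
set Z := bigZ _ _ _ _ _ _ _ _.
have Z1 : (1 < Z)%N by exact: bigZ_gt1.
have WD : (Z ^ D < Z ^ D.+1)%N by rewrite ltn_exp2l.
have s0 : (0 < root d n)%N by have [] := rootP d0 n0.
have bud := budget a2 b2 tp_le ti_le tq_le s0.
have ZB := window_bound C c Kp k (2 * Ki) (2 * Kq) a2 b2 K0 n0.
have ZN := bigZ_N C c Kp k (2 * Ki) (2 * Kq) a2 b2 K0 n0.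
have ZK := bigZ_K C c Kp k (2 * Ki) (2 * Kq) a2 b2 K0 n0.
have UB := union_bound Kp (2 * Ki) (2 * Kq) a2 b2 n0 HK0.
have TB := total_time_le C c a2 b2 tp_le ti_gt0 tq_gt0 ti_le tq_le K0 n0.
rewrite -leq_divRL // in TB.
split=> [r|]; last exact: (reduction_error sol d0 n0 bud Z1 WD (leqnn D) ZB ZN ZK TB UB).
have [tr E _] := reduction_session sol d0 n0 bud Z1 WD (leqnn D) ZB ZN ZK TB UB M vs
  (size_tuple r).
by rewrite E.
Qed.
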